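(* Let $\mathfrak A=(A,V)$ be a $\mathsf{BT}$-box over an algebraically closed field $k$. (1) $\mathfrak A$ is brick-tame. Moreover, for every vector dimension $\mathbf d$ with $\mathrm{Br}(\mathbf d,\mathfrak A)\neq\emptyset$, all bricks of vector dimension $\mathbf d$ belong to a unique (i.e. one and the same) rational family $\mathcal F_{\mathbf d}:A\to\mathrm{add}\,k[t]$. (2) If $\mathfrak A$ is solid-connected, has no superfluous arrows and does not coincide with $k[t]$, then $\mathfrak A$ is wild.
   Context: Boxes. $k$ is an algebraically closed field. A box $\mathfrak A=(A,V)$ is a $k$-category $A$ with an $A$-$A$-bimodule $V$ carrying a coassociative comultiplication $\mu:V\to V\otimes_AV$ and a counit $\varepsilon:V\to A$ (bimodule maps). It is free if $A$ is the path category of a quiver and the kernel $\overline V=\ker\varepsilon$ is a free bimodule, i.e. a direct sum of bimodules $A1_i\otimes_k 1_jA$; it is normal if there are $\omega_i\in V(i,i)$ ($i\in\mathrm{Ob}A$) with $\varepsilon(\omega_i)=1_i$, $\mu(\omega_i)=\omega_i\otimes\omega_i$. All boxes are free and normal. The biquiver $Q=(I,Q_0,Q_1)$ has vertex set $I=\{1,\dots,n\}=\mathrm{Ob}A$, solid arrows $Q_0$ (the free generators of $A$) and dotted arrows $Q_1$ (the free generators of $\overline V$; the generator $1_i\otimes1_j$ of a summand $A1_i\otimes1_jA$ is a dotted arrow from $j$ to $i$); $I,Q_0,Q_1$ are finite. Paths are composed from right to left; the path category $kQ$ is graded by the number $|p|$ of dotted arrows in $p$. The differential $\partial$ is $\partial(a)=\omega_ia-a\omega_j$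 for a solid arrow $a:j\to i$ and $\partial(v)=\mu(v)-v\otimes\omega_j-\omega_i\otimes v$ for a dotted arrow $v$ from $j$ to $i$; it extends to a $k$-linear map $\partial:kQ\to kQ$ of degree $1$ with $\partial^2=0$ and $\partial(xy)=\partial(x)y+(-1)^{|x|}x\partial(y)$. The pair $(Q,\partial)$ (the differential biquiver) determines the box. It is solid-triangular if there is $h:Q_0\to\mathbb N$ (a triangulation) such that for each $a\in Q_0$ only solid arrows $b$ with $h(b)<h(a)$ occur in $\partial(a)$; a box is solid-triangular if it has a solid-triangular differential biquiver for some choice of free generators. The box is solid-connected if the graph $(I,Q_0)$ is connected. Modules. A representation ($\mathfrak A$-module) $M$ is an $A$-module: vector spaces $M_i$ ($i\in I$) and linear maps $M(a):M_i\to M_j$ for solid $a:i\to j$. $\mathfrak A\text{-mod}$ is the category of finite dimensional modules. A morphism $S:M\to N$ is an $A$-homomorphism $V\otimes_AM\to N$, i.e. linear maps $S_i:M_i\to N_i$ ($i\in I$) and $S(v):M_i\to N_j$ for dotted $v$ from $i$ to $j$ such that for each solid $a:i\to j$ one has $S_jM(a)-N(a)S_i=\sum\lambda N(p')S(u)M(p)$, where $\partial(a)=\sum\lambda p'up$ ($\lambda\in k$, $u\in Q_1$, $p,p'$ solid paths). The composite $T=S'S$ is given by $T_i=S'_iS_i$ and $T(v)=S'_jS(v)+S'(v)S_i+\sum\lambda L(p_1)S'(u')N(p_2)S(u)M(p_3)$ for $v$ from $i$ to $j$, $\partial(v)=\sum\lambda p_1u'p_2up_3$, $S:M\to N$, $S':N\to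 L$. The vector dimension is $\mathbf d(M)=(\dim M_1,\dots,\dim M_n)$. A brick is a nonzero module all of whose endomorphisms are scalar. $\mathrm{Br}(\mathbf d,\mathfrak A)$ is the set of isomorphism classes of bricks of vector dimension $\mathbf d$. $\mathsf{BT}$-boxes. A solid-triangular box with (solid-triangular) differential biquiver $(Q,\partial)$ is a $\mathsf{BT}$-box if $Q_0$ contains a set of loops $\mathfrak a=\{a_i:i\to i\mid i\in I\}$ (distinguished loops), and there is an injective map $\mathfrak b=Q_0\setminus\mathfrak a\to Q_1$, $x\mapsto\tilde x$, such that $\tilde x$ is a dotted arrow from $j$ to $i$ if $x:i\to j$, and for each $i\in I$ $$\partial(a_i)=\sum_{x\in\hat{\mathfrak b}(\cdot,i)}(-1)^{|x|}x\tilde x,$$ where $\tilde{\mathfrak b}=\{\tilde x\mid x\in\mathfrak b\}$, $\hat{\mathfrak b}=\mathfrak b\cup\tilde{\mathfrak b}$, $\tilde{\tilde x}=x$ for $x\in\mathfrak b$, and $\hat{\mathfrak b}(\cdot,i)$ is the set of arrows of $\hat{\mathfrak b}$ ending at $i$. Families and brick-tameness. A rational algebra is $R=k[t,f(t)^{-1}]$ with $f\neq0$; $\mathrm{add}\,R$ is identified with the category of finitely generated projective $R$-modules. A rational family of representations of $\mathfrak A$ is a functor $\mathcal F:A\to\mathrm{add}\,R$. For $\lambda\in k$ with $f(\lambda)\ne0$, $\mathcal F^*(\lambda)$ denotes the $\mathfrak A$-module obtained by composing $\mathcal F$ with the specialization $t\mapsto\lambda$, i.e. with tensoring by $R/(t-\lambda)$.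 $\mathcal F$ is a rational family of bricks if all $\mathcal F^*(\lambda)$ are bricks and $\mathcal F^*(\lambda)\not\simeq\mathcal F^*(\lambda')$ for $\lambda\ne\lambda'$; then the bricks isomorphic to some $\mathcal F^*(\lambda)$ are said to belong to the family. $\mathfrak A$ is brick-tame if for every vector dimension $\mathbf d$ there is a finite set $\Sigma$ of rational families of bricks such that all but finitely many (up to isomorphism) bricks of vector dimension $\mathbf d$ belong to one of the families in $\Sigma$. Superfluous arrows, $k[t]$, wildness. A solid arrow $b:j\to i$ is superfluous if $\partial(b)=v$ for a dotted arrow $v$ from $j$ to $i$; ''no superfluous arrows'' means that there are none for any choice of free generators. ''$\mathfrak A$ coincides with $k[t]$'' means that $Q$ has only one vertex and only one solid arrow (the distinguished loop). $\mathfrak A$ is wild if for every finitely generated $k$-algebra $\Lambda$ there is a functor $F$ from $A$ to the category of finitely generated projective $\Lambda$-modules such that the induced functor $F^*:\Lambda\text{-mod}\to\mathfrak A\text{-mod}$ on finite dimensional modules maps indecomposables to indecomposables and non-isomorphic modules to non-isomorphic ones.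
   Formalization: In the composition of morphisms the last sum in T(v) is taken with a minus sign: with the stated rule ∂(xy)=∂(x)y+(-1)^{|x|}x∂(y), the plus sign would make composites fail to be morphisms (equivalently, ∂(v)=ω_i v+vω_j−μ(v) for dotted v). *)

(* Defs.v *)
From HB Require Import structures.
From mathcomp Require Import all_boot all_order all_algebra.
From mathcomp Require Import finmap.
From mathcomp.multinomials Require Import monalg.

Set Implicit Arguments.
Unset Strict Implicit.
Unset Printing Implicit Defensive.

Import GRing.Theory.
Local Open Scope ring_scope.

Record biquiver (I : finType) := Biquiver {
  solid : finType;
  dotted : finType;
  ssrc : solid -> I;
  stgt : solid -> I;
  dsrc : dotted -> I;
  dtgt : dotted -> I }.

(* [qpath Q j i]: paths from j to i.  The outermost constructor is the last
   arrow of the path, i.e. its leftmost letter. *)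
Inductive qpath (I : finType) (Q : biquiver I) (j : I) : I -> Type :=
| qid : qpath Q j j
| qsol (a : solid Q) of qpath Q j (ssrc a) : qpath Q j (stgt a)
| qdot (v : dotted Q) of qpath Q j (dsrc v) : qpath Q j (dtgt v).

Arguments qid {I Q} j.
Arguments qsol {I Q j} a p.
Arguments qdot {I Q j} v p.

Section Paths.
Variables (I : finType) (Q : biquiver I).

Definition sarrow (a : solid Q) : qpath Q (ssrc a) (stgt a) :=
  qsol a (qid (ssrc a)).

Definition darrow (v : dotted Q) : qpath Q (dsrc v) (dtgt v) :=
  qdot v (qid (dsrc v)).

Fixpoint qword (j i : I) (p : qpath Q j i) : seq (solid Q + dotted Q) :=
  match p with
  | qid => [::]
  | qsol a p' => inl a :: qword p'
  | qdot v p' => inr v :: qword p'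
  end.

Definition qcast (j i i' : I) (e : i = i') (p : qpath Q j i) : qpath Q j i' :=
  ecast l (qpath Q j l) e p.

(* The path from j to i with the given word, if there is one. *)
Fixpoint qpath_of_word (j i : I) (s : seq (solid Q + dotted Q)) :
    option (qpath Q j i) :=
  match s with
  | [::] => if j =P i is ReflectT e then Some (qcast e (qid j)) else None
  | inl a :: s' =>
      if stgt a =P i is ReflectT e then
        omap (fun p => qcast e (qsol a p)) (qpath_of_word j (ssrc a) s')
      else None
  | inr v :: s' =>
      if dtgt v =P i is ReflectT e then
        omap (fun p => qcast e (qdot v p)) (qpath_of_word j (dsrc v) s')
      else None
  end.

Lemma qwordK (j i : I) : pcancel (@qword j i) (qpath_of_word j i).
Proof.
elim=> [|a p IHp|v p IHp] /=.
- by case: eqP => // e; rewrite (eq_axiomK e).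
- by case: eqP => // e; rewrite IHp (eq_axiomK e).
- by case: eqP => // e; rewrite IHp (eq_axiomK e).
Qed.

HB.instance Definition _ (j i : I) := Choice.copy (qpath Q j i)
  (pcan_type (@qwordK j i)).

(* Composition is written right to left: [qcomp p q] is "first q, then p". *)
Fixpoint qcomp (j i l : I) (p : qpath Q i l) : qpath Q j i -> qpath Q j l :=
  match p with
  | qid => fun q => q
  | qsol a p' => fun q => qsol a (qcomp p' q)
  | qdot v p' => fun q => qdot v (qcomp p' q)
  end.

Fixpoint qdeg (j i : I) (p : qpath Q j i) : nat :=
  match p with
  | qid => 0
  | qsol _ p' => qdeg p'
  | qdot _ p' => (qdeg p').+1
  end.

End Paths.

Section PathCategory.
Variables (k : fieldType) (I : finType) (Q : biquiver I).

(* The morphism space kQ(j, i) of the path category is {malg k[qpath Q j i]}. *)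
Definition kpath (j i : I) (p : qpath Q j i) : {malg k[qpath Q j i]} := << p >>.

(* The word s seen in kQ(j, i); 0 if s is not a path from j to i. *)
Definition kword (j i : I) (s : seq (solid Q + dotted Q)) :
    {malg k[qpath Q j i]} :=
  if qpath_of_word j i s is Some p then kpath p else 0.

Definition kcomp (j i l : I) (x : {malg k[qpath Q i l]})
    (y : {malg k[qpath Q j i]}) : {malg k[qpath Q j l]} :=
  \sum_(p <- msupp x) \sum_(q <- msupp y) (x@_p * y@_q) *: kpath (qcomp p q).

Definition homogeneous (d : nat) (j i : I) (x : {malg k[qpath Q j i]}) : Prop :=
  forall p, p \in msupp x -> qdeg p = d.

(* Linear extension to kQ(j, i) of a function defined on paths. *)
Definition klift (V : lmodType k) (j i : I) (f : qpath Q j i -> V)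
    (x : {malg k[qpath Q j i]}) : V :=
  \sum_(p <- msupp x) x@_p *: f p.

End PathCategory.

(* A free normal box, given by its biquiver and differential; the normal section
   omega is part of the box. *)
Record diff_biquiver (k : fieldType) (I : finType) := DiffBiquiver {
  quiver :> biquiver I;
  dif : forall j i : I,
    {linear {malg k[qpath quiver j i]} -> {malg k[qpath quiver j i]}};
  dif_deg : forall d (j i : I) (x : {malg k[qpath quiver j i]}),
    homogeneous d x -> homogeneous d.+1 (dif j i x);
  dif_dif : forall (j i : I) (x : {malg k[qpath quiver j i]}),
    dif j i (dif j i x) = 0;
  dif_comp : forall d (j i l : I) (x : {malg k[qpath quiver i l]})
      (y : {malg k[qpath quiver j i]}), homogeneous d x ->
    dif j l (kcomp x y) =
      kcomp (dif i l x) y + (-1) ^+ d *: kcomp x (dif j i y) }.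

Arguments dif {k I} D {j i} : rename.

Section Box.
Variables (k : fieldType) (I : finType).
Implicit Type D : diff_biquiver k I.

Definition dsolid D (a : solid D) : {malg k[qpath D (ssrc a) (stgt a)]} :=
  dif D (kpath k (sarrow a)).

Definition ddotted D (v : dotted D) : {malg k[qpath D (dsrc v) (dtgt v)]} :=
  dif D (kpath k (darrow v)).

Definition solid_occurs D (b : solid D) (j i : I) (x : {malg k[qpath D j i]}) :=
  exists2 p, p \in msupp x & inl b \in qword p.

(* D' presents the same box as D by another choice of free generators: kQ' and
   kQ are identified by an isomorphism of graded k-categories which is the
   identity on objects and commutes with the differentials. *)
Definition same_box D D' : Prop :=
  exists phi : forall j i : I,
      {linear {malg k[qpath D' j i]} -> {malg k[qpath D j i]}},
    [/\ forall j i, bijective (phi j i),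
        forall i, phi i i (kpath k (qid i)) = kpath k (qid i),
        forall j i l (x : {malg k[qpath D' i l]}) (y : {malg k[qpath D' j i]}),
          phi j l (kcomp x y) = kcomp (phi i l x) (phi j i y),
        forall d j i (x : {malg k[qpath D' j i]}),
          homogeneous d x -> homogeneous d (phi j i x) &
        forall j i (x : {malg k[qpath D' j i]}),
          phi j i (dif D' x) = dif D (phi j i x)].

Definition superfluous D (b : solid D) : Prop :=
  exists2 v : dotted D, dsrc v = ssrc b /\ dtgt v = stgt b &
    dsolid b = kword k (ssrc b) (stgt b) [:: inr v].

Definition no_superfluous_arrows D : Prop :=
  forall D', same_box D D' -> forall b : solid D', ~ superfluous b.

Definition triangulation D (h : solid D -> nat) : Prop :=
  forall a b : solid D, solid_occurs b (dsolid a) -> (h b < h a)%N.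

Definition solid_triangular D : Prop :=
  exists h : solid D -> nat, triangulation h.

Definition solid_adj D (i j : I) : bool :=
  [exists a : solid D,
     ((ssrc a == i) && (stgt a == j)) || ((ssrc a == j) && (stgt a == i))].

(* A connected graph is nonempty. *)
Definition solid_connected D : Prop :=
  (0 < #|I|)%N /\ forall i j : I, connect (solid_adj D) i j.

Definition coincides_with_kt D : Prop := #|I| = 1%N /\ #|solid D| = 1%N.

(* al i is the distinguished loop at i; the elements of \mathfrak b are the
   solid arrows outside the image of al, and tld is x |-> \tilde x.  The first
   sum in the last clause ranges over the arrows of \mathfrak b ending at i, the
   second one over the arrows of \tilde{\mathfrak b} ending at i. *)
Definition BT_box D : Prop :=
  solid_triangular D /\
  exists (al : I -> solid D)
         (tld : {x : solid D | x \notin codom al} -> dotted D),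
    [/\ forall i, ssrc (al i) = i /\ stgt (al i) = i,
        injective tld,
        forall x, dsrc (tld x) = stgt (val x) /\ dtgt (tld x) = ssrc (val x) &
        forall i, dif D (kword k i i [:: inl (al i)]) =
            \sum_(x | stgt (val x) == i) kword k i i [:: inl (val x); inr (tld x)]
          - \sum_(x | dtgt (tld x) == i) kword k i i [:: inr (tld x); inl (val x)]].

End Box.

Section Modules.
Variables (k : fieldType) (I : finType).
Implicit Type D : diff_biquiver k I.

Record rep (Q : biquiver I) := Rep {
  rep_ob :> I -> vectType k;
  rep_map : forall a : solid Q, 'Hom(rep_ob (ssrc a), rep_ob (stgt a)) }.

Definition dimvec (Q : biquiver I) (M : rep Q) : I -> nat :=
  fun i => \dim {: M i}.

Definition rep_zero (Q : biquiver I) (M : rep Q) : Prop :=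
  forall i, dimvec M i = 0%N.

(* The data of a morphism, without the compatibility condition [is_hom]. *)
Record hom_data (Q : biquiver I) (M N : rep Q) := HomData {
  hob : forall i : I, 'Hom(M i, N i);
  hdot : forall v : dotted Q, 'Hom(M (dsrc v), N (dtgt v)) }.

(* M(p) for a solid path p; paths with dotted arrows are sent to 0. *)
Fixpoint ev0 (Q : biquiver I) (M : rep Q) (j i : I) (p : qpath Q j i) :
    'Hom(M j, M i) :=
  match p with
  | qid => \1%VF
  | qsol a p' => (rep_map M a \o ev0 M p')%VF
  | qdot _ _ => 0
  end.

(* N(p')S(u)M(p) for a path p'up with one dotted arrow u; the other paths are
   sent to 0. *)
Fixpoint ev1 (Q : biquiver I) (M N : rep Q) (S : hom_data M N)
    (j i : I) (p : qpath Q j i) : 'Hom(M j, N i) :=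
  match p with
  | qid => 0
  | qsol a p' => (rep_map N a \o ev1 S p')%VF
  | qdot u p' => (hdot S u \o ev0 M p')%VF
  end.

(* L(p1)S'(u')N(p2)S(u)M(p3) for a path p1u'p2up3 with two dotted arrows u', u;
   the other paths are sent to 0. *)
Fixpoint ev2 (Q : biquiver I) (M N L : rep Q) (S' : hom_data N L)
    (S : hom_data M N) (j i : I) (p : qpath Q j i) : 'Hom(M j, L i) :=
  match p with
  | qid => 0
  | qsol a p' => (rep_map L a \o ev2 S' S p')%VF
  | qdot u p' => (hdot S' u \o ev1 S p')%VF
  end.

Definition is_hom D (M N : rep D) (S : hom_data M N) : Prop :=
  forall a : solid D,
    (hob S (stgt a) \o rep_map M a)%VF - (rep_map N a \o hob S (ssrc a))%VF =
    klift (@ev1 D M N S (ssrc a) (stgt a)) (dsolid a).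

(* The sign of the last term is forced by the sign in [dif_comp]: it is the one
   for which the composite of two morphisms is a morphism. It corresponds to
   \partial(v) = \omega_i v + v \omega_j - \mu(v) for dotted v : j -> i. *)
Definition hcomp D (M N L : rep D) (S' : hom_data N L) (S : hom_data M N) :
    hom_data M L :=
  HomData
    (fun i => hob S' i \o hob S i)%VF
    (fun v => (hob S' (dtgt v) \o hdot S v)%VF + (hdot S' v \o hob S (dsrc v))%VF
              - klift (@ev2 D M N L S' S (dsrc v) (dtgt v)) (ddotted v)).

Definition is_scalar D (M : rep D) (c : k) (S : hom_data M M) : Prop :=
  (forall i, hob S i = c *: \1%VF) /\ (forall v, hdot S v = 0).

Definition rep_iso D (M N : rep D) : Prop :=
  exists (S : hom_data M N) (S' : hom_data N M),
    [/\ is_hom S, is_hom S', is_scalar 1 (hcomp S' S) & is_scalar 1 (hcomp S S')].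

Definition brick D (M : rep D) : Prop :=
  ~ rep_zero M /\
  forall S : hom_data M M, is_hom S -> exists c : k, is_scalar c S.

Definition rep_sum (Q : biquiver I) (M N : rep Q) : rep Q :=
  @Rep Q (fun i => (M i * N i)%type)
    (fun a => linfun (fun z => (rep_map M a z.1, rep_map N a z.2))).

Definition rep_indecomposable D (M : rep D) : Prop :=
  ~ rep_zero M /\
  forall M1 M2 : rep D, rep_iso M (rep_sum M1 M2) -> rep_zero M1 \/ rep_zero M2.

End Modules.

Section Algebras.
Variable (k : fieldType).

Definition alg_finitely_generated (La : algType k) : Prop :=
  exists s : seq La, forall P : La -> Prop,
    (forall x, x \in s -> P x) -> P 1 ->
    (forall c x y, P x -> P y -> P (c *: x + y)) ->
    (forall x y, P x -> P y -> P (x * y)) ->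
    forall x, P x.

Definition mod_fin_dim (La : algType k) (L : lmodType La) : Prop :=
  exists (m : nat) (e : 'I_m -> L),
    forall x : L, exists c : 'I_m -> k, x = \sum_i (c i)%:A *: e i.

Definition mod_zero (La : algType k) (L : lmodType La) : Prop :=
  forall x : L, x = 0.

Definition mod_iso (La : algType k) (L L' : lmodType La) : Prop :=
  exists f : {linear L -> L'}, bijective f.

Definition mod_indecomposable (La : algType k) (L : lmodType La) : Prop :=
  ~ mod_zero L /\
  forall L1 L2 : lmodType La, mod_iso L (L1 * L2)%type ->
    mod_zero L1 \/ mod_zero L2.

(* Right La-modules are left modules over La^c. *)
Definition fg_projective (La : algType k) (P : lmodType La^c) : Prop :=
  exists (m : nat) (s : {linear P -> 'rV[La^c]_m})
         (r : {linear 'rV[La^c]_m -> P}), cancel s r.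

(* A k-linear functor from the path category A of the solid arrows to the
   category of finitely generated projective right La-modules. *)
Record proj_functor (I : finType) (Q : biquiver I) (La : algType k) :=
  ProjFunctor {
    pf_ob : I -> lmodType La^c;
    pf_proj : forall i, fg_projective (pf_ob i);
    pf_map : forall a : solid Q, {linear pf_ob (ssrc a) -> pf_ob (stgt a)} }.

Definition balanced (La : algType k) (P : lmodType La^c) (L : lmodType La)
    (W : lmodType k) (b : P -> L -> W) : Prop :=
  [/\ forall p p' l, b (p + p') l = b p l + b p' l,
      forall p l l', b p (l + l') = b p l + b p l',
      forall p (r : La) l, b ((r : La^c) *: p) l = b p (r *: l) &
      forall (c : k) p l, b p (c%:A *: l) = c *: b p l].

(* T, with the pure tensors tau p l, is the tensor product of P and L over La. *)
Definition is_tensor (La : algType k) (P : lmodType La^c) (L : lmodType La)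
    (T : lmodType k) (tau : P -> L -> T) : Prop :=
  balanced tau /\
  forall (W : lmodType k) (b : P -> L -> W), balanced b ->
    exists f : {linear T -> W}, (forall p l, f (tau p l) = b p l) /\
      forall g : {linear T -> W}, (forall p l, g (tau p l) = b p l) -> g =1 f.

(* N is (a copy of) F^*(L), the tensor product of F and L over La. *)
Definition is_induced (I : finType) (Q : biquiver I) (La : algType k)
    (F : proj_functor Q La) (L : lmodType La) (N : rep k Q) : Prop :=
  exists tau : forall i, pf_ob F i -> L -> N i,
    (forall i, is_tensor (tau i)) /\
    forall (a : solid Q) p l, rep_map N a (tau (ssrc a) p l) =
                              tau (stgt a) (pf_map F a p) l.

Definition wild (I : finType) (D : diff_biquiver k I) : Prop :=
  forall La : algType k, alg_finitely_generated La ->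
  exists F : proj_functor D La,
    (forall (L : lmodType La) (N : rep k D),
       mod_fin_dim L -> mod_indecomposable L -> is_induced F L N ->
       rep_indecomposable N) /\
    (forall (L L' : lmodType La) (N N' : rep k D),
       mod_fin_dim L -> mod_fin_dim L' -> is_induced F L N ->
       is_induced F L' N' -> rep_iso N N' -> mod_iso L L').

(* R is k[t, f(t)^-1], the localization of k[t] at the powers of f. *)
Definition is_rational (R : comAlgType k) (t : R) (f : {poly k}) : Prop :=
  [/\ f != 0,
      exists g : R, horner_alg t f * g = 1,
      injective (horner_alg t) &
      forall r : R, exists (p : {poly k}) (m : nat),
        r * horner_alg t f ^+ m = horner_alg t p].

Record rational_algebra := RationalAlgebra {
  ra_alg :> comAlgType k;
  ra_t : ra_alg;
  ra_f : {poly k};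
  ra_rational : is_rational ra_t ra_f }.

Lemma is_rational_kt : @is_rational {poly k} 'X 1.
Proof.
have hX (p : {poly k}) : horner_alg ('X : {poly k}) p = p.
  by rewrite -(poly_alg_initial (@idfun {poly k})).
split; first exact: oner_neq0.
- by exists 1; rewrite rmorph1 mulr1.
- by move=> p q; rewrite !hX.
- by move=> r; exists r, 0%N; rewrite expr0 mulr1 hX.
Qed.

Definition rational_kt : rational_algebra := RationalAlgebra is_rational_kt.

(* L is the R-module R/(t - lambda). *)
Definition is_quotient_at (R : rational_algebra) (lambda : k)
    (L : lmodType R) : Prop :=
  exists q : {linear R^o -> L},
    (forall l, exists r, q r = l) /\
    (forall r : R, q r = 0 <-> exists s : R, r = (ra_t R - lambda%:A) * s).

Section Families.
Variables (I : finType) (D : diff_biquiver k I).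

(* M is (a copy of) F^*(lambda). *)
Definition is_specialization (R : rational_algebra) (F : proj_functor D R)
    (lambda : k) (M : rep k D) : Prop :=
  exists2 L : lmodType R, is_quotient_at lambda L & is_induced F L M.

Definition brick_family (R : rational_algebra) (F : proj_functor D R) : Prop :=
  (forall lambda M, (ra_f R).[lambda] != 0 ->
     is_specialization F lambda M -> brick M) /\
  (forall lambda lambda' M M',
     (ra_f R).[lambda] != 0 -> (ra_f R).[lambda'] != 0 ->
     is_specialization F lambda M -> is_specialization F lambda' M' ->
     rep_iso M M' -> lambda = lambda').

Definition belongs_to (R : rational_algebra) (F : proj_functor D R)
    (M : rep k D) : Prop :=
  exists lambda N, [/\ (ra_f R).[lambda] != 0, is_specialization F lambda N &
                       rep_iso M N].

Definition brick_tame : Prop :=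
  forall d : I -> nat,
  exists (m : nat) (R : 'I_m -> rational_algebra)
         (Sigma : forall s, proj_functor D (R s)) (e : nat) (E : 'I_e -> rep k D),
    (forall s, brick_family (Sigma s)) /\
    forall M : rep k D, brick M -> dimvec M =1 d ->
      (exists s, belongs_to (Sigma s) M) \/ (exists s, rep_iso M (E s)).

End Families.
End Algebras.

(* Main.v *)
(* (1) The formula for the differential of the distinguished loops, combined with
   the vanishing of the square of the differential, makes the morphisms act on the
   loops by a twisted coadjoint action: once the restriction of a module to the
   other arrows is fixed, a module is a matrix a (the loops), a morphism a -> a' is
   a matrix S with S a + K = a' S, where the infinitesimal part K of S is a
   derivation, skew for the trace form. Given a brick a1, the loops of all bricks
   are normalized to agree with a1 on larger and larger subspaces P, the morphisms
   still allowed being the orthogonal Hp of P. By Burnside's theorem, and since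
   derivations of a matrix algebra are inner, this only stops when Hp is the scalars
   modulo P; then a line a1 + c e of loops is left, which is the family. Two bricks
   of the same dimension are joined by the line through their restrictions, whose
   generic point is isomorphic to both ends, so one restriction is enough.
   (2) Let b be a solid arrow of minimal height which is not distinguished. Its
   differential is a combination of dotted arrows; if it were nonzero, a change of
   dotted generators would make b superfluous, so it vanishes. Then modules on which
   only b and the loops at its ends act nontrivially contain the modules over any
   finitely generated algebra: the generators are put into a companion matrix, and
   the morphisms are forced to be triangular with one and the same linear map on
   the whole diagonal, which reflects isomorphisms and idempotents. *)
Require Import Defs.
From HB Require Import structures.
From mathcomp Require Import all_boot all_order all_algebra all_field finmap ring.
From mathcomp.multinomials Require Import monalg.
From Stdlib Require Import Classical.

Set Implicit Arguments.
Unset Strict Implicit.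
Unset Printing Implicit Defensive.

Import GRing.Theory.
Local Open Scope ring_scope.

(** * Linear algebra *)

(** A brick a1 equips the algebra H of admissible S with the skew form tr(beta S T). Its radical is
    the scalars, and it satisfies form(ST, U) = form(S, TU) + form(T, US). Normalizing loops is a
    reduction of this form: P is frozen, Hp is its orthogonal, and the cocycle identity makes Hp an
    algebra again. P grows by a two-sided ideal J of Hp, the annihilator of a simple Hp-module. The
    possible obstruction is a simple quotient M_r of Hp on which the form is still nondegenerate
    modulo scalars. There the form is tr(D x y) for a derivation D, inner by some z; z lies in the
    kernel of D, hence is scalar, so D = 0 and r = 1. For wildness the obstacle is that the
    component h of a morphism at the dual dotted arrow of b is arbitrary, so the equations at the
    loops hold only up to b h and h b. The block patterns place the decisive equations where these
    terms do not reach, or where other equations kill the disturbing entries of h. *)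

Lemma lfun_of_linear (k : fieldType) (U V : vectType k) (f : U -> V) :
  linear f -> exists g : 'Hom(U, V), forall x, g x = f x.
Proof.
move=> flin.
pose fl : {linear U -> V} := HB.pack f (GRing.isLinear.Build k U V *:%R f flin).
by exists (linfun fl) => x; rewrite lfunE.
Qed.

(** A subspace inside P is enlarged by a vector of P outside it until the dimension stops the
    process; the case distinction is classical. Existential conditions become subspaces in this way,
    to which separation and bases apply. *)
Lemma vspace_of_pred (k : fieldType) (vT : vectType k) (P : vT -> Prop) :
  P 0 -> (forall c x y, P x -> P y -> P (c *: x + y)) ->
  exists U : {vspace vT}, forall v, v \in U <-> P v.
Proof.
move=> P0 PD.
suff H : forall m (U : {vspace vT}), (forall v, v \in U -> P v) ->
    (\dim {: vT} - \dim U <= m)%N -> exists U : {vspace vT}, forall v, v \in U <-> P v.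
  by apply: (H _ 0%VS _ (leqnn _)) => v; rewrite memv0 => /eqP ->.
elim=> [|m IHm] U UP.
  rewrite leqn0 subn_eq0 => dU; exists U => v; split; first exact: UP.
  have /eqP -> : U == fullv by rewrite eqEdim subvf.
  by rewrite memvf.
move=> dU.
have [[v [Pv vU]]|nP] := classic (exists v, P v /\ v \notin U).
  apply: (IHm (U + <[v]>)%VS).
    move=> x /memv_addP[u uU [w /vlineP[c ->] ->]].
    by rewrite addrC; apply: PD => //; apply: UP.
  have lt : (\dim U < \dim (U + <[v]>))%N.
    rewrite ltnNge; apply/negP => le.
    have /eqP E : U == (U + <[v]>)%VS by rewrite eqEdim addvSl.
    by case/negP: vU; rewrite E memvE addvSr.
  rewrite -ltnS; apply: leq_trans dU; rewrite ltn_sub2l //.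
  by apply: leq_trans lt _; exact: dimvS (subvf _).
exists U => v; split; first exact: UP.
by move=> Pv; apply/negPn/negP => vU; apply: nP; exists v.
Qed.

Lemma vspace_separation (k : fieldType) (vT : vectType k) (U : {vspace vT}) v :
  v \notin U ->
  exists f : 'Hom(vT, k^o), f v = 1 /\ forall u, u \in U -> f u = 0.
Proof.
move=> vU; pose q := (\1 - projv U)%VF.
have qE x : q x = x - projv U x by rewrite add_lfunE opp_lfunE id_lfunE.
have qU u : u \in U -> q u = 0 by move=> uU; rewrite qE projv_id ?subrr.
have qv : q v != 0.
  by apply: contra vU; rewrite qE subr_eq0 => /eqP ->; apply: memv_proj.
pose b := vbasis {:vT}.
have [i bi] : exists i, coord b i (q v) != 0.
  apply/existsP; apply: contraR qv => /existsPn H.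
  rewrite (coord_vbasis (memvf (q v))) big1 // => i _.
  by have /negPn/eqP -> := H i; rewrite scale0r.
pose c : {linear vT -> k^o} := coord b i.
exists ((c (q v))^-1 *: (linfun c \o q))%VF.
split; first by rewrite scale_lfunE comp_lfunE (lfunE c) -[_ *: _]/((c (q v))^-1 * c (q v)) mulVf.
by move=> u /qU qu0; rewrite scale_lfunE comp_lfunE qu0 linear0 scaler0.
Qed.

Lemma mxtrace_delta (k : fieldType) n (Y : 'M[k]_n) i j :
  \tr (delta_mx i j *m Y) = Y j i.
Proof.
rewrite /mxtrace (bigD1 i) //= big1 ?addr0.
  rewrite mxE (bigD1 j) //= !mxE !eqxx mul1r big1 ?addr0 // => l lj.
  by rewrite !mxE (negbTE lj) andbF mul0r.
by move=> l li; rewrite mxE big1 // => m _; rewrite !mxE (negbTE li) mul0r.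
Qed.

Lemma mxtrace_nondegenerate (k : fieldType) n (X : 'M[k]_n) :
  (forall Y, \tr (X *m Y) = 0) -> X = 0.
Proof.
move=> H; apply/matrixP=> i j; rewrite mxE -(mxtrace_delta X j i).
by rewrite mxtrace_mulC.
Qed.

Lemma functional_mxtrace (k : fieldType) n (f : 'Hom('M[k]_n, k^o)) :
  exists X, forall Y, f Y = \tr (X *m Y).
Proof.
exists (\matrix_(i, j) f (delta_mx j i)) => Y.
rewrite [in LHS](matrix_sum_delta Y) linear_sum /=; under eq_bigr => i _.
  rewrite linear_sum /=; under eq_bigr => j _ do
    rewrite linearZ /= -[_ *: _]/(_ * _) mulrC.
  over.
rewrite exchange_big; apply: eq_bigr => j _; rewrite mxE.
by apply: eq_bigr => i _; rewrite mxE.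
Qed.

Lemma mxtrace_separation (k : fieldType) n (U : {vspace 'M[k]_n}) v :
  v \notin U -> exists X, \tr (X *m v) = 1 /\ forall u, u \in U -> \tr (X *m u) = 0.
Proof.
move=> /vspace_separation[f [fv fU]]; have [X fE] := functional_mxtrace f.
by exists X; rewrite -fE; split=> // u uU; rewrite -fE fU.
Qed.

(** Double orthogonal in finite dimension: if X is not in beta(U) plus the annihilator of H, a
    separating Z is killed by that annihilator, hence lies in H, and it is orthogonal to beta(U).
    Then tr(X Z) = 1 contradicts the hypothesis. *)
Lemma form_separation (k : fieldType) n (beta : 'End('M[k]_n)) X
    (U H : {vspace 'M[k]_n}) :
  (forall z, z \in H -> (forall y, y \in U -> \tr (beta y *m z) = 0) ->
     \tr (X *m z) = 0) ->
  exists2 y, y \in U & forall z, z \in H -> \tr (X *m z) = \tr (beta y *m z).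
Proof.
move=> sepX.
have [Hp HpP] : exists Hp : {vspace 'M[k]_n}, forall Y, Y \in Hp <->
    forall z, z \in H -> \tr (Y *m z) = 0.
  apply: vspace_of_pred => [z _|c x y Px Py z zH]; first by rewrite mul0mx mxtrace0.
  by rewrite mulmxDl -scalemxAl mxtraceD mxtraceZ Px ?Py // mulr0 addr0.
have [/memv_addP[w /memv_imgP[y yU ->] [h hHp ->]]|XW] :=
    boolP (X \in (beta @: U + Hp)%VS).
  by exists y => // z zH; rewrite mulmxDl mxtraceD (HpP h).1 // addr0.
have [Z [ZX ZW]] := mxtrace_separation XW.
have ZH : Z \in H.
  apply/negPn/negP=> /mxtrace_separation[Y [YZ YH]].
  have : \tr (Z *m Y) = 0 by rewrite ZW // memvE (subv_trans _ (addvSr _ _)) -?memvE ?HpP.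
  by rewrite mxtrace_mulC YZ => /eqP; rewrite oner_eq0.
have := sepX _ ZH; rewrite mxtrace_mulC ZX => /(_ _)/eqP; rewrite oner_eq0 => F.
suff: false by []; apply: F => y yU; rewrite mxtrace_mulC ZW //.
by rewrite memvE (subv_trans _ (addvSl _ _)) // -memvE memv_img.
Qed.

(** At a root c of the nonconstant polynomial p X + 1 one has p(c) c = -1. *)
Lemma closed_field_avoid_roots (k : closedFieldType) (p : {poly k}) :
  p != 0 -> exists c, p.[c] != 0.
Proof.
move=> p0; have /closed_rootP[c] : size (p * 'X + 1) != 1%N.
  by rewrite -polyC1 size_MXaddC (negbTE p0) /= eqSS size_poly_eq0.
rewrite rootE !hornerE => /eqP E; exists c; apply: contra_eq_neq E => ->.
by rewrite mul0r add0r oner_neq0.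
Qed.

(** * Burnside's theorem on irreducible matrix algebras *)

Section Burnside.
Variables (k : closedFieldType) (r : nat) (Q : {vspace 'M[k]_r}).
Hypothesis mulQ : forall x y, x \in Q -> y \in Q -> x *m y \in Q.
Hypothesis irrQ : forall w w' : 'rV[k]_r, w != 0 -> exists2 x, x \in Q & w *m x = w'.

(** Irreducibility gives s in Q sending row i of x to the j-th unit row, where row j of x is not a
    multiple of row i. On the row space of x the map s x has an eigenvalue a. Then z = x s x - a x
    is nonzero, since its row i is (row j) - a (row i), and an eigenvector enlarges its left
    kernel. *)
Lemma irreducible_rank_decreasing x : x \in Q -> (1 < \rank x)%N ->
  exists z, [/\ z \in Q, z != 0 & (\rank z < \rank x)%N].
Proof.
move=> xQ rx.
have [i xi] : exists i, row i x != 0.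
  apply/existsP; apply: contraTT rx => /existsPn H.
  suff -> : x = 0 by rewrite mxrank0.
  by apply/row_matrixP=> i; rewrite row0; apply/eqP/negPn.
have [j xj] : exists j, ~~ (row j x <= row i x)%MS.
  apply/existsP; apply: contraTT rx => /existsPn H; rewrite -leqNgt.
  have: (x <= row i x)%MS by apply/row_subP => j; apply/negPn.
  by move/mxrankS/leq_trans; apply; apply: rank_leq_row.
have [s sQ ws] := irrQ (delta_mx 0 j) xi.
pose b := row_base x.
pose M := b *m s *m x *m pinvmx b.
have Mb : M *m b = b *m s *m x.
  by rewrite mulmxKpV // (submx_trans (submxMl _ _)) // eq_row_base.
have [a /eigenvalueP[u uM u0]] : exists a, eigenvalue M a.
  have /closed_rootP[a ra] : size (char_poly M) != 1%N.
    by rewrite size_char_poly eqSS -lt0n (ltn_trans _ rx).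
  by exists a; rewrite eigenvalue_root_char.
have /submxP[y yx] : (u *m b <= x)%MS.
  by rewrite (submx_trans (submxMl _ _)) // eq_row_base.
have ub0 : u *m b != 0.
  apply: contra u0 => /eqP E; have := row_base_free x; rewrite -/b => /row_freeP[c bc].
  by rewrite -[u]mulmx1 -bc mulmxA E mul0mx.
pose z := x *m (s *m x - a%:M).
have zE : z = x *m s *m x - a *: x by rewrite /z mulmxBr mulmxA mul_mx_scalar.
exists z; split.
- by rewrite zE memvB ?memvZ // mulQ // mulQ.
- apply: contra xj => /eqP /(congr1 (row i)).
  rewrite zE linearB linearZ /= row0 !row_mul ws -rowE.
  by move/subr0_eq => ->; rewrite scalemx_sub.
- have lt : (kermx x < kermx z)%MS.
    rewrite ltmxE; apply/andP; split.
      by apply/sub_kermxP; rewrite /z mulmxA mulmx_ker mul0mx.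
    apply/negP => H; have: (y <= kermx z)%MS.
      apply/sub_kermxP; rewrite /z mulmxA -yx mulmxBr mul_mx_scalar !mulmxA.
      by rewrite -!(mulmxA u) -Mb mulmxA uM -scalemxAl subrr.
    by move/submx_trans => /(_ _ _ H)/sub_kermxP; rewrite -yx => /eqP; apply/negP.
  have := rank_ltmx lt; rewrite !mxrank_ker => lt2.
  by rewrite -(ltn_sub2lE _ (rank_leq_row x)).
Qed.

Lemma irreducible_rank_one x : x \in Q -> x != 0 ->
  exists2 z, z \in Q & \rank z = 1%N.
Proof.
have [m] := ubnP (\rank x); elim: m x => // m IHm x rm xQ x0.
have [r1|] := eqVneq (\rank x) 1%N; first by exists x.
rewrite -mxrank_eq0 in x0; rewrite neq_ltn ltnS leqn0 (negbTE x0) /= => r1.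
have [z [zQ z0 zx]] := irreducible_rank_decreasing xQ r1.
by apply: IHm zQ z0; rewrite (leq_trans zx).
Qed.

(** If X is nonzero and tr(X Q) = 0, multiply a rank one element c v of Q by a and b from Q: tr(X a
    c v b) = (v b) X a c. Irreducibility allows v b = w and w X a = a chosen unit row, so the trace
    can be made a nonzero entry of c. *)
Lemma burnside x : x \in Q.
Proof.
apply/negPn/negP=> /mxtrace_separation[X [Xx XQ]].
have X0 : X != 0.
  by apply: contra_eq_neq Xx => ->; rewrite mul0mx mxtrace0 eq_sym oner_neq0.
have [w wX] : exists w : 'rV[k]_r, w *m X != 0.
  have: ~~ [forall i, row i X == 0].
    apply: contra X0 => /forallP H; apply/eqP/row_matrixP=> i.
    by rewrite row0; apply/eqP.
  by rewrite negb_forall => /existsP[i]; rewrite rowE; exists (delta_mx 0 i).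
have [y0 y0Q wy0] := irrQ w wX.
have y0n : y0 != 0.
  by apply: contra_neq wX => y00; move: wy0; rewrite y00 mulmx0 => <-; rewrite mul0mx.
have [y yQ ry] := irreducible_rank_one y0Q y0n.
have [c [v [yE c0 v0]]] : exists c : 'cV_r, exists v : 'rV_r, [/\ y = c *m v, c != 0 & v != 0].
  have := mulmx_base y; move: (col_base y) (row_base y); rewrite ry => c v E.
  exists c, v; split=> //.
    by apply: contra_eq_neq ry => c0; rewrite -E c0 mul0mx mxrank0.
  by apply: contra_eq_neq ry => v0; rewrite -E v0 mulmx0 mxrank0.
have [i ci] : exists i, c i 0 != 0.
  apply/existsP; apply: contraR c0 => /existsPn H.
  by apply/eqP/matrixP => i j; rewrite ord1 mxE; apply/eqP/negPn.
have [b bQ vb] := irrQ w v0.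
have [a aQ wXa] := irrQ (delta_mx 0 i) wX.
have := XQ _ (mulQ aQ (mulQ yQ bQ)).
rewrite yE -mulmxA vb !mulmxA mxtrace_mulC !mulmxA wXa -rowE /mxtrace big_ord1 !mxE.
by move/eqP; apply/negP.
Qed.
End Burnside.

(* The classical argument for the separable algebra M_r: with D the derivation
   and z = \sum_i D(e_i0) e_0i one gets D x = z x - x z. *)
Lemma mx_derivation_inner (k : fieldType) r (D : 'End('M[k]_r.+1)) :
  (forall x y, D (x *m y) = D x *m y + x *m D y) ->
  exists z, forall x, D x = z *m x - x *m z.
Proof.
move=> DM.
pose z := \sum_(i < r.+1) D (delta_mx i 0) *m delta_mx 0 i.
exists z => x; apply/eqP; rewrite eq_sym subr_eq; apply/eqP.
have sum1 : \sum_(i < r.+1) (delta_mx i 0 : 'M[k]_r.+1) *m delta_mx 0 i = 1%:M :> 'M_r.+1.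
  rewrite [in RHS](matrix_sum_delta 1%:M); apply: eq_bigr => i _.
  rewrite (bigD1 i) //= big1 ?addr0; first by rewrite !mxE eqxx scale1r mul_delta_mx.
  by move=> j ji; rewrite mxE eq_sym (negbTE ji) scale0r.
transitivity (\sum_(i < r.+1) D (x *m delta_mx i 0) *m delta_mx 0 i); last first.
  under eq_bigr => i _ do rewrite DM mulmxDl -!mulmxA.
  by rewrite big_split /= -!mulmx_sumr sum1 mulmx1.
have xe i : x *m delta_mx i 0 = \sum_j x j i *: delta_mx j 0 :> 'M_r.+1.
  rewrite [LHS](matrix_sum_delta (x *m _)); apply: eq_bigr => j _.
  rewrite (bigD1 0) //= big1 ?addr0.
    congr (_ *: _); rewrite mxE (bigD1 i) //= big1 ?addr0 ?mxE ?eqxx ?mulr1 //.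
    by move=> l li; rewrite mxE (negbTE li) mulr0.
  move=> l l0; rewrite mxE big1 ?scale0r // => m _.
  by rewrite mxE (negbTE l0) andbF mulr0.
rewrite /z mulmx_suml.
under [RHS]eq_bigr => i _.
  rewrite xe linear_sum mulmx_suml; under eq_bigr => j _ do rewrite linearZ -scalemxAl /=.
  over.
rewrite exchange_big; apply: eq_bigr => j _ /=.
under [RHS]eq_bigr do rewrite scalemxAr.
rewrite -mulmx_sumr -mulmxA; congr (_ *m _).
rewrite [LHS](matrix_sum_delta (_ *m x)) (bigD1 0) //= [X in _ + X]big1 ?addr0.
  apply: eq_bigr => i _; congr (_ *: _); rewrite mxE (bigD1 j) //= big1 ?addr0.
    by rewrite mxE !eqxx mul1r.
  by move=> l lj; rewrite mxE (negbTE lj) andbF mul0r.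
move=> l l0; rewrite big1 // => m _; rewrite mxE big1 ?scale0r // => q _.
by rewrite mxE (negbTE l0) mul0r.
Qed.

(** The z that defines the inner derivation D lies in the kernel of D, so it is scalar and D = 0.
    Then every matrix is scalar, and an off-diagonal matrix unit is a contradiction. *)
Lemma mx_derivation_kernel (k : fieldType) r (D : 'End('M[k]_r.+1)) :
  (forall x y, D (x *m y) = D x *m y + x *m D y) ->
  (forall x, D x = 0 -> exists c, x = c%:M) -> r = 0%N.
Proof.
move=> DM D0; have [z Dz] := mx_derivation_inner DM.
have [c zc] := D0 z (etrans (Dz z) (subrr _)).
case: r => // r in D DM D0 z Dz zc *.
have [|b] := D0 (delta_mx 0 1).
  by rewrite Dz zc mul_scalar_mx mul_mx_scalar subrr.
by move/matrixP=> /(_ 0 1); rewrite !mxE !eqxx /= => /eqP; rewrite oner_eq0.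
Qed.

Lemma mx_derivation_dim (k : fieldType) r (D : 'End('M[k]_r)) : (0 < r)%N ->
  (forall x y, D (x *m y) = D x *m y + x *m D y) ->
  (forall x, D x = 0 -> exists c, x = c%:M) ->
  forall x : 'M[k]_r, exists c, x = c%:M.
Proof.
case: r D => // r D _ DM D0; have r0 := mx_derivation_kernel DM D0.
by case: r r0 D DM D0 => // _ D _ _ x; exists (x 0 0); rewrite -mx11_scalar.
Qed.

(* Along the line the solution u0 is continued by u = D u0 - u0 F adj(N) s
   with N = s F and D = det N. *)
Lemma polynomial_kernel_extension (k : fieldType) (a b n : nat)
    (F : 'M[{poly k}]_(a, b)) (s : 'M[k]_(b, a)) t0 (u0 : 'rV[k]_a)
    (iota : {linear 'rV[k]_a -> 'M[k]_n}) :
  let Fat t := map_mx (horner_eval t) F in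
  s *m Fat t0 = 1%:M -> u0 *m Fat t0 = 0 -> \det (iota u0) != 0 ->
  exists2 p : {poly k}, p.[t0] != 0 &
    forall t, p.[t] != 0 -> exists2 u, u *m Fat t = 0 & \det (iota u) != 0.
Proof.
move=> Fat sF uF det0.
pose sP := map_mx polyC s; pose uP := map_mx polyC u0.
pose N := sP *m F; pose v := \det N *: uP - uP *m F *m \adj N *m sP.
have vF : v *m F = 0.
  rewrite mulmxBl -!mulmxA -/N mul_adj_mx mul_mx_scalar -scalemxAl.
  by rewrite scalemxAr subrr.
pose vat t := map_mx (horner_eval t) v.
have vatF t : vat t *m Fat t = 0 by rewrite -map_mxM vF map_mx0.
have polyCK t m1 m2 (A : 'M[k]_(m1, m2)) : map_mx (horner_eval t) (map_mx polyC A) = A.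
  by apply/matrixP=> i j; rewrite !mxE /horner_eval hornerC.
have v0 : vat t0 = u0.
  rewrite /vat map_mxB map_mxZ !map_mxM !map_mx_adj !polyCK uF !mul0mx subr0.
  rewrite -det_map_mx /= map_mxM polyCK sF.
  by rewrite det1 scale1r.
pose P := \matrix_(i, j) \sum_l v 0 l * (iota (delta_mx 0 l) i j)%:P.
have PE t : (\det P).[t] = \det (iota (vat t)).
  rewrite -[LHS]/(horner_eval t _) -det_map_mx; congr (\det _).
  rewrite [in RHS](row_sum_delta (vat t)) linear_sum /=; apply/matrixP=> i j.
  rewrite !mxE /horner_eval horner_sum summxE; apply: eq_bigr => l _.
  by rewrite hornerM hornerC linearZ !mxE.
exists (\det P) => [|t]; first by rewrite PE v0.
by rewrite PE => Pt; exists (vat t).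
Qed.

(** * Bricks for a twisted coadjoint action *)

Lemma vspace_memV (k : fieldType) (A : falgType k) (U : {vspace A}) u :
  1 \in U -> (forall x y, x \in U -> y \in U -> x * y \in U) ->
  u \in U -> u^-1 \in U.
Proof.
move=> U1 UM uU.
have aspU : is_aspace U by rewrite /is_aspace has_algid1 //; apply/prodvP.
by rewrite -[U]/(asval (ASpace aspU)) memvV.
Qed.

Lemma trC (k : fieldType) n (x y : 'M[k]_n.+1) : \tr (x * y) = \tr (y * x).
Proof. exact: mxtrace_mulC. Qed.

Lemma daddv_pi0 (k : fieldType) (vT : vectType k) (U V : {vspace vT}) v :
  (U :&: V = 0)%VS -> v \in V -> daddv_pi U V v = 0.
Proof.
move=> UV0 vV; have vUV : v \in (U + V)%VS by rewrite memvE (subv_trans _ (addvSr _ _)).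
have := daddv_pi_add UV0 vUV.
by rewrite (@daddv_pi_id _ _ V) ?[(V :&: U)%VS]capvC // => /eqP; rewrite -subr_eq0 addrK => /eqP.
Qed.

(** Nilpotency of W is expressed in the manner of Nakayama, by the absence of a nonzero V contained
    in V W. If w (1 + y) = 0, the matrix all of whose rows are w spans such a V. *)
Lemma nilpotent_unit (k : fieldType) n (W : {vspace 'M[k]_n.+1}) y :
  (forall V : {vspace 'M[k]_n.+1}, (V <= V * W)%VS -> V = 0%VS) ->
  y \in W -> 1 + y \is a GRing.unit.
Proof.
move=> nilW yW; apply/negPn/negP => nu.
have /det0P[w w0 wT] : \det (1 + y) == 0.
  by apply: contraR nu => d0; rewrite -[_ \is a _]/(_ \in unitmx) unitmxE unitfE.
pose v : 'M[k]_n.+1 := \matrix_(i < n.+1) w.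
have vT : v * (1 + y) = 0.
  by apply/row_matrixP => i; rewrite row_mul rowK wT row0.
have v0 : v != 0.
  by apply: contra_neq w0 => /(congr1 (row 0)); rewrite rowK row0.
have vV : (<[v]> <= <[v]> * W)%VS.
  rewrite -memvE; move: vT; rewrite mulrDr mulr1 => /eqP; rewrite addr_eq0 => /eqP E.
  by rewrite {1}E memvN memv_mul ?memv_line.
by have := memv_line v; rewrite (nilW _ vV) memv0 (negbTE v0).
Qed.

Section TwistedCoadjoint.
Variables (k : closedFieldType) (n : nat).
Local Notation A := 'M[k]_n.+1.
(** R S K reads: S is an endomorphism of the fixed restriction and K describes its action on the
    loops. S determines K only up to R 0, which by [R_skew] and [R_perp] is exactly the trace
    orthogonal of all admissible S. *)
Variable R : A -> A -> Prop.
Hypothesis R_lin : forall c S K T L, R S K -> R T L -> R (c *: S + T) (c *: K + L).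
Hypothesis R_one : R 1 0.
Hypothesis R_mul : forall S K T L, R S K -> R T L -> R (S * T) (S * L + K * T).
Hypothesis R_skew : forall S K T L, R S K -> R T L -> \tr (K * T) + \tr (L * S) = 0.
Hypothesis R_perp : forall X, (forall S K, R S K -> \tr (X * S) = 0) -> R 0 X.

Definition alg_hom (a a' S : A) : Prop := exists2 K, R S K & S * a + K = a' * S.

Definition alg_brick (a : A) : Prop := forall S, alg_hom a a S -> exists c, S = c *: 1.

Lemma R_zero : R 0 0.
Proof. by have := R_lin (-1) R_one R_one; rewrite !scaleN1r !addNr. Qed.

Lemma R_add S K T L : R S K -> R T L -> R (S + T) (K + L).
Proof. by move=> RS RT; have := R_lin 1 RS RT; rewrite !scale1r. Qed.

Lemma R_sub S K T L : R S K -> R T L -> R (S - T) (K - L).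
Proof. by move=> RS RT; have := R_lin (-1) RT RS; rewrite !scaleN1r ![- _ + _]addrC. Qed.

Lemma R_zero_perp X T L : R 0 X -> R T L -> \tr (X * T) = 0.
Proof. by move=> R0 RT; have := R_skew R0 RT; rewrite mulr0 mxtrace0 addr0. Qed.

Lemma alg_hom_lin a a' c S T :
  alg_hom a a' S -> alg_hom a a' T -> alg_hom a a' (c *: S + T).
Proof.
move=> [K RS E] [L RT F]; exists (c *: K + L); first exact: R_lin.
by rewrite mulrDl mulrDr -scalerAl -scalerAr -E -F scalerDr addrACA.
Qed.

Lemma alg_hom_comp a b c S T : alg_hom a b S -> alg_hom b c T -> alg_hom a c (T * S).
Proof.
move=> [K RS E] [L RT F]; exists (T * K + L * S); first exact: R_mul.
by rewrite -!mulrA addrA -mulrDr E !mulrA -mulrDl F.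
Qed.

Lemma alg_hom1 a : alg_hom a a 1.
Proof. by exists 0 => //; rewrite mul1r mulr1 addr0. Qed.

Lemma alg_hom_shift a b d T : T \is a GRing.unit ->
  alg_hom a b T -> alg_hom (a + d) (b + T * d * T^-1) T.
Proof.
move=> Tu [K RT E]; exists K => //.
by rewrite mulrDr mulrDl divrK // -E addrAC.
Qed.

Lemma alg_dom_exists :
  exists H : {vspace A}, forall S, S \in H <-> exists K, R S K.
Proof.
apply: vspace_of_pred => [|c S T [K RS] [L RT]]; first by exists 0; apply: R_zero.
by eexists; apply: R_lin RS RT.
Qed.

Lemma alg_section_exists :
  exists kappa : 'End(A), forall S K, R S K -> R S (kappa S).
Proof.
have [G GP] : exists G : {vspace (A * A)%type}, forall p, p \in G <-> R p.1 p.2.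
  by apply: vspace_of_pred => [|c p q]; [apply: R_zero | apply: R_lin].
pose p1 : 'Hom((A * A)%type, A) := linfun fst; pose p2 : 'Hom((A * A)%type, A) := linfun snd.
pose f := (p1 \o projv G)%VF.
exists (p2 \o projv G \o f^-1)%VF => S K RS.
have Sf : S \in limg f.
  apply/memv_imgP; exists (S, K); first exact: memvf.
  by rewrite comp_lfunE projv_id ?lfunE // GP.
have := (GP (projv G (f^-1%VF S))).1 (memv_proj _ _).
have := limg_lfunVK Sf; rewrite [f _]comp_lfunE lfunE /= => ->.
by rewrite !comp_lfunE lfunE.
Qed.

(** The admissible matrices form a finite dimensional algebra, so some L satisfies R T^-1 L. An
    element of R 0 corrects L to - T^-1 K T^-1, the derivation rule for an inverse. *)
Lemma alg_hom_inv a b T : T \is a GRing.unit -> alg_hom a b T -> alg_hom b a T^-1.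
Proof.
move=> Tu [K RT E]; have [H HP] := alg_dom_exists.
have [L RV] : exists L, R T^-1 L.
  apply/HP/vspace_memV; [by apply/HP; exists 0 | | by apply/HP; exists K].
  by move=> x y /HP[K1 R1] /HP[K2 R2]; apply/HP; eexists; apply: R_mul R1 R2.
have R0 : R 0 (T * L + K * T^-1).
  by have := R_sub (R_mul RT RV) R_one; rewrite divrr // subrr subr0.
have := R_sub RV (R_mul RV R0).
rewrite !mulr0 addr0 subr0 mulrDr mulKr // opprD addNKr.
move=> RV'; exists (- (T^-1 * (K * T^-1))) => //.
by rewrite -[b](mulrK Tu) -E mulrDl mulrDr addrK -mulrA mulKr.
Qed.

Variables (a1 : A) (H : {vspace A}) (kappa : 'End(A)).
Hypothesis a1_brick : alg_brick a1.
Hypothesis HP : forall S, S \in H <-> exists K, R S K.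
Hypothesis kappaP : forall S K, R S K -> R S (kappa S).

Lemma H_kappa S : S \in H -> R S (kappa S).
Proof. by move=> /HP[K]; apply: kappaP. Qed.

Lemma H1 : 1 \in H. Proof. by apply/HP; exists 0. Qed.

Lemma HM S T : S \in H -> T \in H -> S * T \in H.
Proof. by move=> /HP[K RS] /HP[L RT]; apply/HP; eexists; apply: R_mul RS RT. Qed.

(* The infinitesimal action of S on the loops a. *)
Definition beta (a : A) : 'End(A) := (amulr a - amull a + kappa)%VF.

Lemma betaE a S : beta a S = S * a - a * S + kappa S.
Proof. by rewrite !add_lfunE opp_lfunE !lfunE. Qed.

Definition form a S T := \tr (beta a S * T).

Lemma formE a S T : form a S T = \tr (kappa S * T) + \tr (a * (T * S)) - \tr (a * (S * T)).
Proof.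
rewrite /form betaE mulrDl mulrBl mxtraceD raddfB /= addrC addrA -!mulrA; congr (_ + _ - _).
by rewrite trC -mulrA.
Qed.

Lemma formDl a S S' T : form a (S + S') T = form a S T + form a S' T.
Proof. by rewrite /form linearD mulrDl mxtraceD. Qed.

Lemma formBl a S S' T : form a (S - S') T = form a S T - form a S' T.
Proof. by rewrite /form linearB mulrBl raddfB. Qed.

Lemma formZl a c S T : form a (c *: S) T = c * form a S T.
Proof. by rewrite /form linearZ -scalerAl mxtraceZ. Qed.

Lemma formDr a S T T' : form a S (T + T') = form a S T + form a S T'.
Proof. by rewrite /form mulrDr mxtraceD. Qed.

Lemma formZr a c S T : form a S (c *: T) = c * form a S T.
Proof. by rewrite /form -scalerAr mxtraceZ. Qed.

Lemma form_skew a S T : S \in H -> T \in H -> form a S T = - form a T S.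
Proof.
move=> /H_kappa RS /H_kappa RT; apply/eqP; rewrite -addr_eq0 !formE.
have E := R_skew RS RT; rewrite -[X in _ == X]E; apply/eqP; ring.
Qed.

(** The section kappa is a derivation only up to R 0, but R 0 is orthogonal to H and disappears
    under the trace. *)
Lemma kappa_diff S T U : S \in H -> T \in H -> U \in H ->
  \tr (kappa (S * T) * U) = \tr (kappa T * (U * S)) + \tr (kappa S * (T * U)).
Proof.
move=> SH TH /H_kappa RU.
have R0 := R_sub (H_kappa (HM SH TH)) (R_mul (H_kappa SH) (H_kappa TH)).
rewrite subrr in R0; have := R_zero_perp R0 RU.
rewrite mulrBl raddfB /= => /eqP; rewrite subr_eq0 => /eqP ->.
by rewrite mulrDl mxtraceD -!mulrA [in X in X + _]trC -!mulrA.
Qed.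

(** The derivation property of [beta a], read through the form. It makes the orthogonal of an
    Hp-bimodule closed under multiplication, and it turns the form on a matrix quotient into a
    derivation. *)
Lemma form_cocycle a S T U : S \in H -> T \in H -> U \in H ->
  form a (S * T) U = form a S (T * U) + form a T (U * S).
Proof.
move=> SH TH UH; rewrite !formE kappa_diff // !mulrA.
by ring.
Qed.

(** The freedom in K absorbs exactly the defects that no T in H detects, since R 0 is the orthogonal
    of H. Morphisms become linear equations in S alone. *)
Lemma alg_homP a a' S : alg_hom a a' S <->
  S \in H /\ forall T, T \in H -> \tr ((S * a + kappa S - a' * S) * T) = 0.
Proof.
split=> [[K RS E]|[SH perp]].
  have SH : S \in H by apply/HP; exists K.
  split=> // T TH; rewrite -E opprD addrACA subrr add0r.
  have R0 := R_sub (H_kappa SH) RS; rewrite subrr in R0.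
  exact: R_zero_perp R0 (H_kappa TH).
have R0 : R 0 (S * a + kappa S - a' * S).
  by apply: R_perp => T K RT; apply: perp; apply/HP; exists K.
have := R_sub (H_kappa SH) R0; rewrite subr0 => RS'; eexists; first exact: RS'.
by rewrite addrA subKr.
Qed.

Lemma twistE a b T y : \tr ((T * a + kappa T - b * T) * y) =
  \tr (kappa T * y) + \tr (a * (y * T)) - \tr (b * (T * y)).
Proof.
rewrite mulrBl mulrDl raddfB /= mxtraceD -!mulrA; congr (_ - _).
by rewrite addrC; congr (_ + _); rewrite trC -mulrA.
Qed.

Lemma alg_brick_iso a b T : T \is a GRing.unit ->
  alg_hom a b T -> alg_brick a -> alg_brick b.
Proof.
move=> Tu hT ba S hS.
have [c E] := ba _ (alg_hom_comp hT (alg_hom_comp hS (alg_hom_inv Tu hT))).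
exists c; rewrite -[S](mulrK Tu) -[S * T](mulVKr Tu) [T^-1 * _]mulrA E.
by rewrite -scalerAr mulr1 -scalerAl divrr.
Qed.

Lemma form_one a y : y \in H -> form a 1 y = 0.
Proof.
move=> /H_kappa Ry; rewrite formE mul1r mulr1 addrK.
have R0 := R_sub (H_kappa H1) R_one; rewrite subrr subr0 in R0.
exact: R_zero_perp R0 Ry.
Qed.

Definition agree (P : {vspace A}) (a b : A) := forall y, y \in P -> \tr (a * y) = \tr (b * y).

(* Up to isomorphism the loops can be assumed to agree with a1 on P; the morphisms
   between such loops then lie in Hp, the orthogonal of P. The construction ends
   when Hp is reduced to the scalars modulo P. *)
Record stage (P Hp : {vspace A}) : Prop := Stage {
  stage_sub : forall x, x \in P -> x \in H;
  stage_proper : 1 \notin P;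
  stage_perp : forall z, z \in Hp <-> z \in H /\ forall y, y \in P -> form a1 z y = 0;
  stage_mull : forall x y, x \in Hp -> y \in P -> x * y \in P;
  stage_mulr : forall x y, x \in Hp -> y \in P -> y * x \in P;
  stage_nil : forall V : {vspace A}, (V <= V * (P :&: Hp))%VS -> V = 0%VS;
  stage_hom : forall a b T, agree P a a1 -> agree P b a1 -> T \in H ->
    (forall y, y \in P -> \tr ((T * a + kappa T - b * T) * y) = 0) -> T \in Hp;
  stage_rigid : forall a y, agree P a a1 -> y \in P -> y \in Hp -> alg_hom a a y -> y = 0;
  stage_iso : forall a b, agree P a a1 -> agree P b a1 -> agree Hp a b ->
    exists2 T, T \is a GRing.unit & alg_hom a b T;
  stage_reach : forall a, alg_brick a -> exists2 b, agree P b a1 &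
    exists2 T, T \is a GRing.unit & alg_hom a b T }.

(** Nothing is frozen yet. Loops that agree on all of H differ by an element of R 0, so the identity
    matrix is already a morphism between them. *)
Lemma stage0 : stage 0%VS H.
Proof.
split.
- by move=> x; rewrite memv0 => /eqP ->; apply: mem0v.
- by rewrite memv0 oner_eq0.
- move=> z; split=> [zH|[]//]; split=> // y; rewrite memv0 => /eqP ->.
  by rewrite /form mulr0 mxtrace0.
- by move=> x y _; rewrite !memv0 => /eqP ->; rewrite mulr0.
- by move=> x y _; rewrite !memv0 => /eqP ->; rewrite mul0r.
- by move=> V; rewrite cap0v prodv0 subv0 => /eqP.
- by [].
- by move=> a y _; rewrite memv0 => /eqP ->.
- move=> a b _ _ ab; exists 1; first exact: unitr1.
  exists (b - a); last by rewrite mul1r mulr1 addrC subrK.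
  have R0 : R 0 (b - a).
    apply: R_perp => S K RS; have SH : S \in H by apply/HP; exists K.
    rewrite mulrBl raddfB /= (ab _ SH) subrr //.
  by have := R_add R_one R0; rewrite addr0 add0r.
- move=> a _; exists a; first by move=> y; rewrite memv0 => /eqP ->; rewrite !mulr0.
  by exists 1; [exact: unitr1 | exact: alg_hom1].
Qed.

(** * The algebra Hp of a stage and its form *)

Section Stage.
Variables (P Hp : {vspace A}).
Hypothesis st : stage P Hp.

Lemma HpH x : x \in Hp -> x \in H. Proof. by case/(stage_perp st). Qed.

Lemma Hp1 : 1 \in Hp.
Proof.
by apply/(stage_perp st); split=> [|y /(stage_sub st)]; [exact: H1 | exact: form_one].
Qed.

Lemma HpM x y : x \in Hp -> y \in Hp -> x * y \in Hp.
Proof.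
move=> xH yH; have [xH' x0] := (stage_perp st x).1 xH; have [yH' y0] := (stage_perp st y).1 yH.
apply/(stage_perp st); split=> [|u uP]; first exact: HM.
have uH := stage_sub st uP.
by rewrite form_cocycle // x0 ?y0 ?addr0 //; [apply: stage_mulr st _ _ xH uP | apply: stage_mull st _ _ yH uP].
Qed.

Lemma HpV x : x \in Hp -> x^-1 \in Hp.
Proof. by apply: vspace_memV; [exact: Hp1 | exact: HpM]. Qed.

Lemma form_agree a T y : agree P a a1 -> T \in Hp -> y \in P -> form a T y = 0.
Proof.
move=> aP TH yP; rewrite formE aP ?(stage_mulr st) // aP ?(stage_mull st) // -formE.
by have [_] := (stage_perp st T).1 TH; apply.
Qed.

(** The equations of the morphism are tested at T^-1 y, again in P because Hp contains T^-1. There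
    they compare b at y with a at T^-1 y T, and the difference from a1 at y is a value of the form
    between Hp and P, which is zero. *)
Lemma act_agree a b T : agree P a a1 -> T \in Hp -> T \is a GRing.unit ->
  alg_hom a b T -> agree P b a1.
Proof.
move=> aP TH Tu /alg_homP[_ hT] y yP; pose y' := T^-1 * y.
have y'P : y' \in P by apply: (stage_mull st) => //; apply: HpV.
have yE : y = T * y' by rewrite mulrA divrr // mul1r.
have := hT y' (stage_sub st y'P); rewrite twistE -yE.
have := form_agree (fun _ _ => erefl) TH y'P; rewrite formE -yE.
rewrite (aP _ (stage_mulr st TH y'P)) => /eqP; rewrite subr_eq0 => /eqP ->.
by move/eqP; rewrite subr_eq0 => /eqP ->.
Qed.

(** The radical of the form on Hp lies in the scalars plus P: if z is orthogonal to Hp,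
    [form_separation] gives y in P with the same pairing as z against all of H. Then z - y is an
    endomorphism of the brick a. *)
Lemma double_perp a z : alg_brick a -> agree P a a1 -> z \in Hp ->
  (forall u, u \in Hp -> form a z u = 0) -> exists2 c, z - c *: 1 \in P & z - c *: 1 \in Hp.
Proof.
move=> ba aP zHp zperp.
have [|y yP yE] := @form_separation _ _ (beta a) (beta a z) P H.
  move=> u uH u0; apply: zperp; apply: (stage_hom st aP aP uH) => y yP.
  rewrite twistE -formE (form_skew _ uH (stage_sub st yP)).
  by rewrite /form (u0 y yP) oppr0.
have /ba[c zy] : alg_hom a a (z - y).
  apply/alg_homP; split; first by apply: memvB; [exact: HpH | exact: (stage_sub st)].
  move=> T TH; rewrite twistE -formE formBl; apply/eqP; rewrite subr_eq0; apply/eqP.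
  exact: yE.
have E : z - c *: 1 = y by rewrite -zy subKr.
by exists c; rewrite ?E // -E memvB ?memvZ ?Hp1.
Qed.

(** * Enlarging P by an ideal of Hp *)

Section Ideal.
Variable J : {vspace A}.
Hypothesis JHp : forall x, x \in J -> x \in Hp.
Hypothesis Jmull : forall x y, x \in Hp -> y \in J -> x * y \in J.
Hypothesis Jmulr : forall x y, x \in Hp -> y \in J -> y * x \in J.
Hypothesis capJ : forall x, x \in P -> x \in Hp -> x \in J.
Hypothesis J1 : 1 \notin J.

Lemma shift_in_J c z : z \in J -> z - c *: 1 \in P -> z - c *: 1 \in Hp -> z \in P.
Proof.
move=> zJ zP zHp; have zJ' := capJ zP zHp.
have c0 : c = 0.
  apply: contraNeq J1 => c0; rewrite -[1](scalerK c0) memvZ //.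
  by rewrite -[_ *: 1](subKr z) memvB.
by move: zP; rewrite c0 scale0r subr0.
Qed.

(** At t = 0 the matrix T = 1 solves the equations, and by [double_perp] the map T -> form a T is
    onto the dual of a complement C of the part of J inside P. By [polynomial_kernel_extension] an
    invertible solution then persists for all but finitely many t. *)
Lemma stage_line a b : alg_brick a -> agree P a a1 -> agree P b a1 ->
  exists2 p : {poly k}, p != 0 & forall t, p.[t] != 0 -> exists2 T, T \in Hp &
    T \is a GRing.unit /\ forall y, y \in J ->
    \tr (kappa T * y) + \tr (a * (y * T)) - \tr ((a + t *: (b - a)) * (T * y)) = 0.
Proof.
move=> ba aP bP.
(* Test elements from K impose no condition, because a and b agree on P. Only a complement of K in J
   carries equations. *)
pose K := (P :&: Hp)%VS; pose C := (J :\: K)%VS.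
have KJ : (K <= J)%VS by apply/subvP => x /memv_capP[xP xH]; apply: capJ.
have JKC x : x \in J -> exists2 y, y \in K & exists2 z, z \in C & x = y + z.
  move=> xJ; have: x \in (C + (J :&: K))%VS by rewrite addv_diff_cap.
  by rewrite (capv_idPr KJ) => /memv_addP[z zC [y yK ->]]; exists y => //; exists z; rewrite // addrC.
have CJ x : x \in C -> x \in J by move/(subvP (diffvSl _ _)).
have KC0 : (C :&: K = 0)%VS by apply: capv_diff.
pose j := vbasis C; pose h := vbasis Hp.
have dual (l : 'I_(\dim C)) : exists2 T, T \in Hp &
    forall m, form a T (tnth j m) = (l == m)%:R.
  have [X XE] := functional_mxtrace
    (linfun (coord j l : {linear A -> k^o}) \o daddv_pi C K)%VF.
  have [|T TH TE] := @form_separation _ _ (beta a) X Hp J.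
    move=> z zJ zperp; rewrite -XE comp_lfunE.
    have [u uH|c zP zHp] := double_perp ba aP (JHp zJ).
      by rewrite (form_skew _ (HpH (JHp zJ)) (HpH uH)) /form (zperp _ uH) oppr0.
    have zK : z \in K by rewrite memv_cap (shift_in_J zJ zP zHp) JHp.
    by rewrite (daddv_pi0 KC0 zK) linear0.
  exists T => // m; have jC : tnth j m \in C by rewrite vbasis_mem ?mem_tnth.
  transitivity (\tr (X *m tnth j m)); first by rewrite (TE _ (CJ _ jC)).
  rewrite -XE comp_lfunE daddv_pi_id // (lfunE (coord j l : {linear A -> k^o})) /=.
  by rewrite (tnth_nth 0) (coord_free _ _ (basis_free (vbasisP C))) eq_sym.
have [T TH TE] := fin_all_exists2 dual.
(* Rows stand for a basis of Hp, columns for the equations at a basis of C. The matrix [s] of the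
   dual vectors T satisfies s F = 1 at t = 0. *)
pose F : 'M[{poly k}]_(\dim Hp, \dim C) := \matrix_(i, l)
  ((form a (tnth h i) (tnth j l))%:P - (\tr ((b - a) * (tnth h i * tnth j l)))%:P * 'X).
pose s : 'M[k]_(\dim C, \dim Hp) := \matrix_(l, i) coord h i (T l).
pose u0 : 'rV[k]_(\dim Hp) := \row_i coord h i 1.
pose iota := (vec_mx \o mulmxr (\matrix_i mxvec (tnth h i)) : {linear 'rV[k]_(\dim Hp) -> A}).
have iotaE u : iota u = \sum_i u 0 i *: tnth h i.
  rewrite /iota /= mulmx_sum_row linear_sum; apply: eq_bigr => i _.
  by rewrite linearZ /= rowK mxvecK.
have iota_Hp u : iota u \in Hp.
  by rewrite iotaE memv_suml // => i _; rewrite memvZ ?vbasis_mem ?mem_tnth.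
have iota_coord x : x \in Hp -> iota (\row_i coord h i x) = x.
  move=> xH; rewrite iotaE [RHS](coord_vbasis xH); apply: eq_bigr => i _.
  by rewrite mxE (tnth_nth 0).
have FE t u l : (u *m map_mx (horner_eval t) F) 0 l =
    form a (iota u) (tnth j l) - t * \tr ((b - a) * (iota u * tnth j l)).
  rewrite mxE iotaE /form linear_sum !mulr_suml mulr_sumr !raddf_sum mulr_sumr -sumrB.
  apply: eq_bigr => i _; rewrite !mxE /horner_eval !hornerE.
  rewrite linearZ /= -!(scalerAl, scalerAr) !mxtraceZ /form; ring.
have [|||p p0 pP] := @polynomial_kernel_extension k _ _ _ F s 0 u0 iota; last 1 first.
- exists p => [|t pt]; first by apply: contraNneq p0 => ->; rewrite horner0.
  have [u uF uD] := pP t pt; exists (iota u) => //; split.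
    by rewrite -[_ \is a _]/(iota u \in unitmx) unitmxE unitfE.
  have form0 y : y \in J ->
      form a (iota u) y - t * \tr ((b - a) * (iota u * y)) = 0.
    move=> /JKC[z /memv_capP[zP zHp] [w wC ->]].
    have -> : form a (iota u) (z + w) = form a (iota u) w.
      by rewrite formDr (form_agree aP) // add0r.
    have zab : \tr ((b - a) * (iota u * z)) = 0.
      have yP : iota u * z \in P by apply: (stage_mull st).
      by rewrite mulrBl raddfB /= (aP _ yP) (bP _ yP) subrr.
    rewrite !mulrDr mxtraceD zab add0r.
    have F0 l : form a (iota u) (tnth j l) - t * \tr ((b - a) * (iota u * tnth j l)) = 0.
      by rewrite -FE uF mxE.
    have [Z ZP] : exists Z : {vspace A}, forall x, x \in Z <->
        form a (iota u) x - t * \tr ((b - a) * (iota u * x)) = 0.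
      apply: vspace_of_pred => [|c x x2 Ex Ey].
        by rewrite /form !mulr0 !mxtrace0 mulr0 subr0.
      rewrite formDr formZr !mulrDr mxtraceD -!scalerAr mxtraceZ.
      transitivity (c * 0 + 0 : k); last by rewrite mulr0 addr0.
      by rewrite -{1}Ex -Ey; ring.
    apply/ZP; apply: (subvP _ w wC); rewrite -(span_basis (vbasisP C)).
    by apply/span_subvP => x /tnthP[l ->]; apply/ZP.
  move=> y yJ; rewrite -(form0 y yJ) formE mulrDl mxtraceD -scalerAl mxtraceZ.
  ring.
- apply/row_matrixP => l; rewrite row_mul; apply/rowP => m; rewrite FE.
  have -> : row l s = \row_i coord h i (T l) by apply/rowP => i; rewrite !mxE.
  by rewrite iota_coord // mul0r subr0 TE !mxE.
- apply/rowP => l; rewrite FE mul0r subr0 iota_coord ?Hp1 // form_one ?mxE //.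
  by rewrite HpH ?JHp ?CJ ?vbasis_mem ?mem_tnth.
- by rewrite iota_coord ?Hp1 // det1 oner_neq0.
Qed.

Lemma act_hom a T : T \in H -> T \is a GRing.unit ->
  alg_hom a ((T * a + kappa T) * T^-1) T.
Proof. by move=> TH Tu; exists (kappa T); [exact: H_kappa | rewrite divrK]. Qed.

Lemma act_agree_J a b c T : T \in Hp -> T \is a GRing.unit -> alg_hom a b T ->
  (forall y, y \in J -> \tr (kappa T * y) + \tr (a * (y * T)) - \tr (c * (T * y)) = 0) ->
  agree J b c.
Proof.
move=> TH Tu /alg_homP[_ hT] cT y yJ.
have y'J : T^-1 * y \in J by apply: Jmull => //; apply: HpV.
have := cT _ y'J; rewrite mulVKr // => /eqP; rewrite subr_eq0 => /eqP <-.
have := hT _ (HpH (JHp y'J)); rewrite twistE mulVKr // => /eqP.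
by rewrite subr_eq0 => /eqP ->.
Qed.

Lemma agree_shrink (U V : {vspace A}) a b : (U <= V)%VS -> agree V a b -> agree U a b.
Proof. by move=> /subvP UV ab y /UV; apply: ab. Qed.

Lemma agree_add (U V : {vspace A}) a b : agree U a b -> agree V a b -> agree (U + V) a b.
Proof.
by move=> aU aV y /memv_addP[u uU [v vV ->]]; rewrite !mulrDr !mxtraceD aU // aV.
Qed.

Lemma form_agree_J a x u : agree J a a1 -> x \in J -> u \in Hp -> form a x u = form a1 x u.
Proof.
by move=> aJ xJ uH; rewrite !formE (aJ _ (Jmull uH xJ)) (aJ _ (Jmulr uH xJ)).
Qed.

(** A generic point of the line from a1 to b is reached from both ends, as seen by J: T1 moves a1 to
    a', T2 moves b to b', and both agree on J with that point. Then T1^-1 carries b' to a loop that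
    differs from a1 by a conjugate of b' - a', and conjugation by units of Hp preserves J. *)
Lemma stage_step_reach a : alg_brick a -> exists2 b, agree (P + J) b a1 &
  exists2 T, T \is a GRing.unit & alg_hom a b T.
Proof.
move=> ba; have [b bP [T Tu hT]] := stage_reach st ba.
have bb := alg_brick_iso Tu hT ba.
have refl : agree P a1 a1 by [].
have [p p0 pP] := stage_line a1_brick refl bP.
have [q q0 qP] := stage_line bb bP refl.
(* The second line starts at b, where the same point has parameter 1 - t. *)
have [|t] := @closed_field_avoid_roots k (p * (q \Po (1 - 'X))).
  rewrite mulf_neq0 // comp_poly_eq0 // -opprB size_polyN.
  by rewrite -polyC1 size_XsubC.
rewrite hornerM horner_comp mulf_eq0 negb_or !hornerE => /andP[/pP[T1 T1H [T1u T1E]]].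
move=> /qP[T2 T2H [T2u T2E]].
have h1 := act_hom a1 (HpH T1H) T1u; have h2 := act_hom b (HpH T2H) T2u.
move: (_ * _^-1) (_ * _^-1) h1 h2 => b' a' h1 h2.
have a'J := act_agree_J T1H T1u h1 T1E; have b'J := act_agree_J T2H T2u h2 T2E.
have tE : b + (1 - t) *: (a1 - b) = a1 + t *: (b - a1).
  by rewrite scalerBl scale1r [b + _]addrA subrKC -scalerN opprB.
rewrite tE in b'J; have b'P := act_agree bP T2H T2u h2.
have Vu : T1^-1 \is a GRing.unit by rewrite unitrV.
have h3 := alg_hom_shift (b' - a') Vu (alg_hom_inv T1u h1).
rewrite invrK subrKC in h3.
exists (a1 + T1^-1 * (b' - a') * T1).
  apply: agree_add; first exact: act_agree b'P (HpV T1H) Vu h3.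
  move=> y yJ; rewrite mulrDl mxtraceD -!mulrA [X in _ + X]trC -!mulrA mulrBl.
  have zJ : T1 * (y * T1^-1) \in J by rewrite Jmull ?Jmulr // HpV.
  by rewrite raddfB /= (a'J _ zJ) (b'J _ zJ) subrr addr0.
exists (T1^-1 * (T2 * T)); first by rewrite unitrMr // unitrMl.
by apply: alg_hom_comp h3; apply: alg_hom_comp h2; apply: hT.
Qed.

Lemma stage_step : exists Hp', stage (P + J) Hp'.
Proof.
have [Hp' HpP'] : exists Hp' : {vspace A}, forall z, z \in Hp' <->
    z \in Hp /\ forall y, y \in J -> form a1 z y = 0.
  apply: vspace_of_pred => [|c x y [xH x0] [yH y0]].
    by split=> [|y _]; [exact: mem0v | rewrite /form linear0 mul0r mxtrace0].
  split=> [|z zJ]; first by rewrite memvD ?memvZ.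
  by rewrite formDl formZl x0 // y0 // mulr0 addr0.
have Hp'P z : z \in Hp' <-> z \in H /\ forall y, y \in (P + J)%VS -> form a1 z y = 0.
  split=> [/HpP'[zHp zJ]|[zH z0]].
    have [zH zP] := (stage_perp st z).1 zHp; split=> // y /memv_addP[u uP [v vJ ->]].
    by rewrite formDr zP // zJ // addr0.
  apply/HpP'; split=> [|y yJ]; last by apply: z0; rewrite memvE (subv_trans _ (addvSr _ _)).
  apply/(stage_perp st); split=> // y yP; apply: z0.
  by rewrite memvE (subv_trans _ (addvSl _ _)).
have capJ' x : x \in (P + J)%VS -> x \in Hp' -> x \in J.
  move=> /memv_addP[u uP [v vJ ->]] /HpP'[xH _]; rewrite memvD // capJ //.
  by rewrite -[u](addrK v) memvB // JHp.
have refl : agree P a1 a1 by [].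
(* For x, y in J orthogonal to J the cocycle identity makes x y orthogonal to Hp, so x y falls back
   into P. The square of the new nilpotent part lies in the old one. *)
have mulK x y : x \in J -> x \in Hp' -> y \in J -> y \in Hp' -> x * y \in (P :&: Hp)%VS.
  move=> xJ /HpP'[xHp x0] yJ /HpP'[yHp y0].
  have xyJ : x * y \in J by apply: Jmull.
  rewrite memv_cap (JHp xyJ) andbT.
  have [u uH|c cP cHp] := double_perp a1_brick refl (JHp xyJ).
    by rewrite form_cocycle ?HpH // x0 ?y0 ?addr0 //; [apply: Jmull | apply: Jmulr].
  exact: shift_in_J xyJ cP cHp.
have nil' (V : {vspace A}) : (V <= V * ((P + J) :&: Hp'))%VS -> V = 0%VS.
  move=> VK; apply: (stage_nil st); apply: (subv_trans VK).
  apply: (subv_trans (prodvSl _ VK)); rewrite -prodvA; apply: prodvSr.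
  apply/prodvP => x y /memv_capP[xP xH] /memv_capP[yP yH].
  by apply: mulK => //; apply: capJ'.
have sP : (P <= P + J)%VS := addvSl _ _.
have sJ : (J <= P + J)%VS := addvSr _ _.
exists Hp'; split.
- move=> x /memv_addP[u uP [v vJ ->]]; by apply: memvD; [exact: (stage_sub st) | exact/HpH/JHp].
- apply/negP => /memv_addP[u uP [v vJ E]].
  have uE : u = 1 - v by rewrite E addrK.
  case/negP: J1; rewrite E memvD // capJ // uE memvB ?Hp1 // JHp //.
- exact: Hp'P.
- move=> x y /HpP'[xH _] /memv_addP[u uP [v vJ ->]]; rewrite mulrDr.
  by apply: memv_add; [apply: (stage_mull st) | apply: Jmull].
- move=> x y /HpP'[xH _] /memv_addP[u uP [v vJ ->]]; rewrite mulrDl.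
  by apply: memv_add; [apply: (stage_mulr st) | apply: Jmulr].
- exact: nil'.
- move=> a b T aP bP TH T0.
  have THp : T \in Hp.
    apply: (stage_hom st (agree_shrink sP aP) (agree_shrink sP bP) TH) => y yP.
    by apply: T0; apply: (subvP sP).
  apply/HpP'; split=> // y yJ; rewrite -(T0 _ (subvP sJ _ yJ)) twistE formE.
  by rewrite (agree_shrink sJ aP (Jmulr THp yJ)) (agree_shrink sJ bP (Jmull THp yJ)).
- move=> a y aP yPJ yHp' hy; have yJ := capJ' _ yPJ yHp'.
  apply: (stage_rigid st (agree_shrink sP aP)) => //; last exact: JHp.
  have [u uH|c cP cHp] := double_perp a1_brick refl (JHp yJ); last exact: shift_in_J cP cHp.
  rewrite -(form_agree_J (agree_shrink sJ aP) yJ uH) formE -twistE.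
  by have [_] := (alg_homP _ _ _).1 hy; apply; apply: HpH.
- move=> a b aPJ bPJ abH.
  have aP := agree_shrink sP aPJ; have bP := agree_shrink sP bPJ.
  have aJ := agree_shrink sJ aPJ; have bJ := agree_shrink sJ bPJ.
  (* On Hp', the orthogonal of P + J, the difference b - a vanishes. So it is represented on H by
     some u + x with u in P and x in J, and u does not contribute on Hp. *)
  have [|y /memv_addP[u uP [x xJ ->]] E] := @form_separation _ _ (beta a1) (b - a) (P + J) H.
    move=> z zH z0; have /abH E : z \in Hp'.
      apply/Hp'P; split=> // y yPJ; have yH : y \in H.
        case/memv_addP: yPJ => u uP [v vJ ->].
        by apply: memvD; [exact: (stage_sub st) | exact/HpH/JHp].
      by rewrite form_skew // /form (z0 y yPJ) oppr0.
    by rewrite -[_ *m _]/(_ * _) mulrBl raddfB /= E subrr.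
  have {}E z : z \in Hp -> \tr ((b - a) * z) = form a1 x z.
    move=> zH; rewrite [LHS](E z (HpH zH)) -[LHS]/(form a1 (u + x) z) formDl.
    by rewrite (form_skew _ (stage_sub st uP) (HpH zH)) (form_agree refl zH uP) oppr0 add0r.
  have abJ z : z \in J -> \tr ((b - a) * z) = 0.
    by move=> zJ; rewrite mulrBl raddfB /= (aJ _ zJ) (bJ _ zJ) subrr.
  (* As a and b agree on J, x is orthogonal to J and belongs to the nilpotent part, so 1 + x is
     invertible. It moves a to a loop that agrees with b on all of Hp, where the old stage
     applies. *)
  have xHp' : x \in Hp'.
    by apply/HpP'; split=> [|z zJ]; [exact: JHp | rewrite -(E z (JHp zJ)) abJ].
  have Tu : 1 + x \is a GRing.unit.
    by apply: (nilpotent_unit nil'); rewrite memv_cap xHp' (subvP sJ).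
  set T := 1 + x in Tu.
  have TH : T \in Hp by rewrite memvD ?Hp1 ?JHp.
  have hT := act_hom a (HpH TH) Tu; move: (_ * T^-1) hT => c hT.
  have cP := act_agree aP TH Tu hT.
  have cb : agree Hp c b.
    move=> z zH; have z'H : T^-1 * z \in Hp by rewrite HpM ?HpV.
    have := ((alg_homP _ _ _).1 hT).2 _ (HpH z'H).
    rewrite twistE mulVKr // => /eqP; rewrite subr_eq0 => /eqP <-.
    rewrite -[in RHS](mulVKr Tu z); move: (T^-1 * z) z'H => z' z'H.
    have := E _ z'H; rewrite -(form_agree_J aJ xJ z'H) formE mulrBl raddfB /= => E1.
    have := abJ _ (Jmulr z'H xJ : x * z' \in J); rewrite mulrBl raddfB /= => E2.
    have := form_one a (HpH z'H); rewrite formE mul1r mulr1 addrK => E3.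
    rewrite /T linearD /= !mulrDl !mulrDr !mul1r mulr1 !mxtraceD E3 add0r.
    move/eqP: E2; rewrite subr_eq0 => /eqP E2.
    by rewrite E2; move/eqP: E1; rewrite subr_eq => /eqP ->; ring.
  have [T2 T2u hT2] := stage_iso st cP bP cb.
  by exists (T2 * T); [rewrite unitrMr | apply: alg_hom_comp hT hT2].
- exact: stage_step_reach.
Qed.
End Ideal.

Lemma minimal_right_module : exists V : {vspace A}, [/\ V != 0%VS,
  forall v x, v \in V -> x \in Hp -> v * x \in V &
  forall W : {vspace A}, (W <= V)%VS -> W != 0%VS ->
    (forall v x, v \in W -> x \in Hp -> v * x \in W) -> W = V].
Proof.
suff: forall m (V : {vspace A}), (\dim V <= m)%N -> V != 0%VS ->
    (forall v x, v \in V -> x \in Hp -> v * x \in V) -> exists V : {vspace A},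
    [/\ V != 0%VS, forall v x, v \in V -> x \in Hp -> v * x \in V &
    forall W : {vspace A}, (W <= V)%VS -> W != 0%VS ->
    (forall v x, v \in W -> x \in Hp -> v * x \in W) -> W = V].
  move=> /(_ _ fullv (leqnn _)); apply.
    by apply/eqP => F0; have := memvf (1 : A); rewrite F0 memv0 oner_eq0.
  by move=> *; rewrite memvf.
elim=> [|m IHm] V Vm V0 VH; first by rewrite -dimv_eq0 -leqn0 Vm in V0.
have [[W [WV W0 WH WnV]]|nW] := classic (exists W : {vspace A}, [/\ (W <= V)%VS, W != 0%VS,
    forall v x, v \in W -> x \in Hp -> v * x \in W & W <> V]).
  apply: (IHm W) => //; rewrite -ltnS (leq_trans _ Vm) // ltnNge.
  by apply/negP => le; apply/WnV/eqP; rewrite eqEdim WV.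
exists V; split=> // W WV W0 WH; apply: NNPP => WnV.
by apply: nW; exists W.
Qed.

(** J is the annihilator in Hp of a simple right module V. If J is not inside P, it is the next
    ideal. Otherwise Hp modulo P acts faithfully on V, hence is a full matrix algebra M_r by
    [burnside], and the form descends to M_r because P is orthogonal to Hp; this forces r = 1. *)
Lemma stage_dichotomy :
  (forall x, x \in Hp -> exists2 c, x - c *: 1 \in P & x - c *: 1 \in Hp) \/
  exists J : {vspace A}, [/\ forall x, x \in J -> x \in Hp,
    forall x y, x \in Hp -> y \in J -> x * y \in J,
    forall x y, x \in Hp -> y \in J -> y * x \in J,
    forall x, x \in P -> x \in Hp -> x \in J &
    1 \notin J /\ exists2 x, x \in J & x \notin P].
Proof.
have [V [V0 VH Vmin]] := minimal_right_module.
have [J JP] : exists J : {vspace A}, forall z, z \in J <->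
    z \in Hp /\ forall v, v \in V -> v * z = 0.
  apply: vspace_of_pred => [|c x y [xH x0] [yH y0]].
    by split=> [|v _]; [exact: mem0v | rewrite mulr0].
  split=> [|v vV]; first by rewrite memvD ?memvZ.
  by rewrite mulrDr -scalerAr x0 // y0 // scaler0 addr0.
have JHp x : x \in J -> x \in Hp by case/JP.
have capJ x : x \in P -> x \in Hp -> x \in J.
  move=> xP xH; apply/JP; split=> // v vV.
  have xK : x \in (P :&: Hp)%VS by rewrite memv_cap xP.
  apply/eqP; rewrite -memv0.
  (* V times the intersection of P and Hp is a submodule. If it were nonzero it would be V by
     minimality, against [stage_nil]. *)
  have [<-|VK0] := eqVneq (V * (P :&: Hp))%VS 0%VS; first exact: memv_mul.
  have sVK : (V * (P :&: Hp) <= V)%VS.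
    by apply/prodvP => u y uV /memv_capP[_ yH]; apply: VH.
  case/negP: V0; apply/eqP/(stage_nil st); rewrite (Vmin _ sVK VK0) // => u y.
  suff /prodvP : (V * (P :&: Hp) * Hp <= V * (P :&: Hp))%VS by apply.
  rewrite -prodvA prodvSr //; apply/prodvP => p z /memv_capP[pP pH] zH.
  by rewrite memv_cap (stage_mulr st) //= HpM.
have [[x xJ xP]|nJ] := classic (exists2 x, x \in J & x \notin P).
  right; exists J; split=> //.
  - move=> z y zH /JP[yH y0]; apply/JP; split=> [|v vV]; first exact: HpM.
    by rewrite mulrA y0 // VH.
  - move=> z y zH /JP[yH y0]; apply/JP; split=> [|v vV]; first exact: HpM.
    by rewrite mulrA y0 // mul0r.
  - split; last by exists x.
    apply/negP => /JP[_ /(_ _ (memv_pick V))]; rewrite mulr1 => /eqP.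
    by rewrite vpick0 (negbTE V0).
left.
have JPs x : x \in J -> x \in P by move=> xJ; apply/negPn/negP => xP; apply: nJ; exists x.
pose b := vbasis V; pose r := \dim V.
pose vec (w : 'rV[k]_r) : A := vec_mx (w *m \matrix_i mxvec (tnth b i : A)).
have vecE w : vec w = \sum_i w 0 i *: (tnth b i : A).
  rewrite /vec mulmx_sum_row linear_sum; apply: eq_bigr => i _.
  by rewrite linearZ /= rowK mxvecK.
have vecV w : vec w \in V.
  by rewrite vecE memv_suml // => i _; rewrite memvZ ?vbasis_mem ?mem_tnth.
have coord_vec w j : coord b j (vec w) = w 0 j.
  rewrite vecE -[RHS](coord_sum_free (fun i => w 0 i) j (basis_free (vbasisP V))).
  by congr (coord b j _); apply: eq_bigr => i _; rewrite (tnth_nth 0).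
have vec_coord v : v \in V -> vec (\row_j coord b j v) = v.
  move=> vV; rewrite vecE [RHS](coord_vbasis vV); apply: eq_bigr => i _.
  by rewrite mxE (tnth_nth 0).
have [rho rhoE] : exists rho : 'Hom(A, 'M[k]_r), forall x,
    rho x = \matrix_(i, j) coord b j ((tnth b i : A) * x).
  apply: lfun_of_linear => c x y; apply/matrixP => i j.
  by rewrite !mxE mulrDr -scalerAr linearD linearZ.
have vecM w x : x \in Hp -> vec w * x = vec (w *m rho x).
  move=> xH; rewrite vecE mulr_suml /vec -mulmxA mulmx_sum_row linear_sum.
  apply: eq_bigr => i _; rewrite linearZ /= -scalerAl; congr (_ *: _).
  rewrite row_mul -[vec_mx _]/(vec (row i (rho x))) -[LHS]vec_coord; last first.
    by apply: VH => //; rewrite vbasis_mem ?mem_tnth.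
  by congr vec; apply/rowP => j; rewrite rhoE !mxE.
have vec_inj w w' : vec w = vec w' -> w = w'.
  by move=> E; apply/rowP => j; rewrite -!coord_vec E.
have rhoM x y : x \in Hp -> y \in Hp -> rho (x * y) = rho x *m rho y.
  move=> xH yH; apply/row_matrixP => i; rewrite !rowE; apply: vec_inj.
  by rewrite mulmxA -!vecM ?HpM // mulrA.
have [Q QP] : exists Q : {vspace 'M[k]_r}, forall m, m \in Q <-> exists2 x, x \in Hp & m = rho x.
  apply: vspace_of_pred => [|c _ _ [x xH ->] [y yH ->]].
    by exists 0; rewrite ?mem0v // linear0.
  by exists (c *: x + y); rewrite ?linearP // memvD ?memvZ.
have fullQ m : m \in Q.
  apply: burnside => [_ _ /QP[x xH ->] /QP[y yH ->]|w w' w0].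
    by apply/QP; exists (x * y); rewrite ?HpM ?rhoM.
  pose z := vec w; pose W := (amull z @: Hp)%VS.
  have zW : z \in W.
    by apply/memv_imgP; exists 1; rewrite ?Hp1 // lfunE /= mulr1.
  have WV : W = V.
    apply: Vmin; first by apply/subvP => _ /memv_imgP[x xH ->]; rewrite lfunE /= VH ?vecV.
      apply: contra_neq w0 => W0; apply: vec_inj; rewrite -/z.
      move: zW; rewrite W0 memv0 => /eqP ->.
      by rewrite /vec mul0mx linear0.
    move=> _ x /memv_imgP[y yH ->] xH; rewrite lfunE /= -mulrA.
    by apply/memv_imgP; exists (y * x); rewrite ?HpM // lfunE.
  have := vecV w'; rewrite -WV => /memv_imgP[x xH]; rewrite lfunE /= vecM // => E.
  by exists (rho x); [apply/QP; exists x | apply: vec_inj].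
have kerP x : x \in Hp -> rho x = 0 -> x \in P.
  move=> xH x0; apply: JPs; apply/JP; split=> // v /vec_coord <-.
  by rewrite vecM // x0 mulmx0 /vec mul0mx linear0.
have rhoP x : x \in P -> x \in Hp -> rho x = 0.
  move=> xP xH; have [_ Vx0] := (JP x).1 (capJ _ xP xH).
  by apply/matrixP => i j; rewrite rhoE !mxE Vx0 ?linear0 // vbasis_mem ?mem_tnth.
have rho1 : rho 1 = 1%:M.
  apply/row_matrixP => i; rewrite !rowE; apply: vec_inj.
  by rewrite mulmx1 -vecM ?Hp1 // mulr1.
have rhoc c : rho (c *: 1) = c%:M by rewrite linearZ /= rho1 scalemx1.
(* sigma is a linear section of rho with values in Hp. It is multiplicative up to the kernel of rho,
   which the form does not see. *)
pose f := (rho \o projv Hp)%VF; pose sigma := (projv Hp \o f^-1)%VF.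
have sigmaH m : sigma m \in Hp by rewrite comp_lfunE memv_proj.
have rho_sigma m : rho (sigma m) = m.
  have mf : m \in limg f.
    have /QP[x xH ->] := fullQ m; apply/memv_imgP; exists x; rewrite ?memvf //.
    by rewrite comp_lfunE projv_id.
  by have := limg_lfunVK mf; rewrite [f _]comp_lfunE comp_lfunE.
pose B m m' := form a1 (sigma m) (sigma m').
(* D represents the descended form: tr(D m m') = B m m'. The cocycle identity makes D a derivation,
   and [double_perp] makes its kernel scalar. *)
have [D DE] : exists D : 'End('M[k]_r), forall m,
    D m = \matrix_(i, j) B m (delta_mx j i).
  apply: lfun_of_linear => c x y; apply/matrixP => i j.
  by rewrite !mxE /B linearP formDl formZl.
have DB m m' : \tr (D m *m m') = B m m'.
  rewrite [in RHS](matrix_sum_delta m') /B !linear_sum /= /form mulr_sumr raddf_sum.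
  rewrite /mxtrace; under eq_bigr => i _ do rewrite mxE.
  rewrite exchange_big; apply: eq_bigr => i _ /=; rewrite linear_sum mulr_sumr raddf_sum.
  by apply: eq_bigr => j _ /=; rewrite linearZ /= -scalerAr mxtraceZ DE mxE mulrC.
have refl : agree P a1 a1 by [].
have form0l x y : x \in Hp -> rho x = 0 -> y \in Hp -> form a1 x y = 0.
  move=> xH x0 yH; have xP := kerP x xH x0.
  by rewrite form_skew ?HpH // (form_agree refl yH xP) oppr0.
have form0r x y : x \in Hp -> rho x = 0 -> y \in Hp -> form a1 y x = 0.
  by move=> xH x0 yH; apply: form_agree => //; apply: kerP.
have sM m m' : exists2 x, x \in Hp & sigma (m *m m') = sigma m * sigma m' + x /\ rho x = 0.
  exists (sigma (m *m m') - sigma m * sigma m'); first by rewrite memvB ?HpM.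
  by rewrite addrC subrK; split=> //; rewrite linearB /= rhoM // !rho_sigma subrr.
have r0 : (0 < r)%N by rewrite lt0n /r dimv_eq0.
have [Dder Dker] : (forall x y, D (x *m y) = D x *m y + x *m D y) /\
    forall x, D x = 0 -> exists c, x = c%:M.
  split=> [m m'|m Dm].
    apply/eqP; rewrite -subr_eq0; apply/eqP/mxtrace_nondegenerate => u.
    rewrite mulmxBl raddfB /= mulmxDl mxtraceD -!mulmxA [X in _ - (_ + X)]mxtrace_mulC.
    rewrite -mulmxA !DB /B.
    have [x xH [-> x0]] := sM m m'; have [y yH [-> y0]] := sM m' u.
    have [z zH [-> z0]] := sM u m.
    rewrite formDl !formDr (form0l x) // (form0r y) // (form0r z) //.
    by rewrite form_cocycle ?HpH // !addr0 subrr.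
  have [u uH|c cP cH] := double_perp a1_brick refl (sigmaH m).
    rewrite -[u](subrK (sigma (rho u))) formDr.
    rewrite (form0r (u - _)) ?memvB // ?linearB /= ?rho_sigma ?subrr // add0r.
    by rewrite -/(B m (rho u)) -DB Dm mul0mx mxtrace0.
  exists c; rewrite -[LHS]rho_sigma -[sigma m](subrK (c *: 1)) linearD /=.
  by rewrite rhoc rhoP // add0r.
move=> x xH; have [c xE] := mx_derivation_dim r0 Dder Dker (rho x).
have cH : x - c *: 1 \in Hp by rewrite memvB ?memvZ ?Hp1.
exists c => //; apply: kerP => //.
by rewrite linearB /= rhoc xE subrr.
Qed.
End Stage.

Lemma stage_terminal P Hp : stage P Hp -> exists P' Hp', stage P' Hp' /\
  forall x, x \in Hp' -> exists2 c, x - c *: 1 \in P' & x - c *: 1 \in Hp'.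
Proof.
have [m] := ubnP (\dim {: A} - \dim P); elim: m P Hp => // m IHm P Hp Pm st.
have [T|[J [JHp Jl Jr capJ [J1 [x xJ xP]]]]] := stage_dichotomy st; first by exists P, Hp.
have [Hp' st'] := stage_step st JHp Jl Jr capJ J1.
apply: IHm st'; rewrite -ltnS; apply: leq_trans Pm; rewrite ltnS.
have lt : (\dim P < \dim (P + J))%N.
  rewrite ltnNge; apply/negP => le.
  have /eqP E : P == (P + J)%VS by rewrite eqEdim addvSl.
  by case/negP: xP; rewrite E (subvP (addvSr _ _)).
by rewrite ltn_sub2l // (leq_trans lt) // dimvS // subvf.
Qed.

Lemma alg_brick_family_aux : exists e : A,
  [/\ forall c, alg_brick (a1 + c *: e),
      forall c c' T, T \is a GRing.unit -> alg_hom (a1 + c *: e) (a1 + c' *: e) T -> c = c' &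
      forall a, alg_brick a -> exists c, exists2 T, T \is a GRing.unit &
        alg_hom a (a1 + c *: e) T].
Proof.
have [P [Hp [st term]]] := stage_terminal stage0.
(* The direction of the family is dual to the identity modulo P: tr e = 1 and tr(e y) = 0 on P, so
   every a1 + c e agrees with a1 on P. *)
have [e [e1 eP]] := mxtrace_separation (stage_proper st).
have agP c : agree P (a1 + c *: e) a1.
  move=> y yP; rewrite mulrDl mxtraceD -scalerAl mxtraceZ.
  by rewrite [X in _ + _ * X](eP y yP) mulr0 addr0.
have homHp c c' T : alg_hom (a1 + c *: e) (a1 + c' *: e) T -> T \in Hp.
  move=> /alg_homP[TH T0]; apply: (stage_hom st (agP c) (agP c') TH) => y yP.
  by apply: T0; apply: (stage_sub st).
exists e; split.
- move=> c S hS; have [d SP SH] := term _ (homHp _ _ _ hS); exists d.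
  apply/eqP; rewrite -subr_eq0; apply/eqP; apply: (stage_rigid st (agP c) SP SH).
  by rewrite [S - _]addrC -scaleNr; apply: (alg_hom_lin _ (alg_hom1 _) hS).
- move=> c c' T Tu hT; have [d TP TH] := term _ (homHp _ _ _ hT).
  (* With d = 0 the unit T would lie in the nilpotent part. *)
  have d0 : d != 0.
    apply/eqP => d0; rewrite d0 scale0r subr0 in TP TH.
    have: fullv = 0%VS :> {vspace A}.
      apply: (stage_nil st); apply/subvP => v _; rewrite -[v](divrK Tu).
      by rewrite memv_mul ?memvf // memv_cap TP.
    by move=> F0; have := memvf (1 : A); rewrite F0 memv0 oner_eq0.
  (* Testing at the identity kills kappa T, by skewness against the pair (1, 0), and leaves c d = c'
     d. *)
  have := ((alg_homP _ _ _).1 hT).2 1 H1; rewrite twistE mul1r !mulr1.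
  have RT : R T (kappa T) by apply: H_kappa; case/alg_homP: hT.
  have := R_skew RT R_one; rewrite mul0r mxtrace0 addr0 mulr1 => ->.
  rewrite add0r !mulrDl !mxtraceD opprD addrACA subrr add0r -!scalerAl !mxtraceZ.
  have -> : \tr (e * T) = d.
    rewrite -[T](subrK (d *: 1)) mulrDr mxtraceD -scalerAr mxtraceZ.
    by rewrite [X in X + _](eP _ TP) [X in _ * X]e1 mulr1 add0r.
  by rewrite -mulrBl => /eqP; rewrite mulf_eq0 (negbTE d0) orbF subr_eq0 => /eqP.
- move=> a ba; have [b bP [T Tu hT]] := stage_reach st ba.
  (* The parameter is forced by tr e = 1. *)
  pose c := \tr b - \tr a1; exists c.
  have bc : agree Hp b (a1 + c *: e).
    move=> z zH; have [d zP _] := term _ zH.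
    rewrite -[z](subrK (d *: 1)); move: (z - _) zP => w wP.
    rewrite !mulrDr !mxtraceD (bP w wP) (agP c w wP) -!scalerAr !mxtraceZ; congr (_ + _ * _).
    by move: e1; rewrite !mulmx1 !mulr1 mxtraceD mxtraceZ => ->; rewrite mulr1 /c; ring.
  have [T2 T2u hT2] := stage_iso st bP (agP c) bc.
  by exists (T2 * T); [rewrite unitrMr | apply: alg_hom_comp hT hT2].
Qed.
End TwistedCoadjoint.

Theorem alg_brick_family (k : closedFieldType) n (R : 'M[k]_n.+1 -> 'M[k]_n.+1 -> Prop)
    (R_lin : forall c S K T L, R S K -> R T L -> R (c *: S + T) (c *: K + L))
    (R_one : R 1 0)
    (R_mul : forall S K T L, R S K -> R T L -> R (S * T) (S * L + K * T))
    (R_skew : forall S K T L, R S K -> R T L -> \tr (K * T) + \tr (L * S) = 0)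
    (R_perp : forall X, (forall S K, R S K -> \tr (X * S) = 0) -> R 0 X) a1 :
  alg_brick R a1 -> exists e,
  [/\ forall c, alg_brick R (a1 + c *: e),
      forall c c' T, T \is a GRing.unit ->
        alg_hom R (a1 + c *: e) (a1 + c' *: e) T -> c = c' &
      forall a, alg_brick R a -> exists c, exists2 T, T \is a GRing.unit &
        alg_hom R a (a1 + c *: e) T].
Proof.
move=> ba1; have [H HP] := alg_dom_exists R_lin R_one.
have [kappa kP] := alg_section_exists R_lin R_one.
exact: (alg_brick_family_aux R_lin R_one R_mul R_skew R_perp ba1 HP kP).
Qed.

(** * Path category and differential *)

Section PathAlgebra.
Variables (k : fieldType) (I : finType) (Q : biquiver I).
Implicit Types (V : lmodType k) (j i l : I).

Lemma klift_wide V j i (f : qpath Q j i -> V) (x : {malg k[qpath Q j i]}) (d : {fset qpath Q j i}) :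
  (msupp x `<=` d)%fset -> klift f x = \sum_(p <- d) x@_p *: f p.
Proof.
move=> sxd; rewrite /klift (big_fset_incl _ sxd) // => p _ /mcoeff_outdom ->.
by rewrite scale0r.
Qed.

Lemma klift_linear V j i (f : qpath Q j i -> V) : linear (klift f).
Proof.
move=> c x y; have s1 : (msupp (c *: x + y) `<=` msupp x `|` msupp y)%fset.
  by apply: fsubset_trans (msuppD_le _ _) _; apply: fsetSU; apply: msuppZ_le.
rewrite (klift_wide f s1) (klift_wide f (fsubsetUl _ (msupp y))).
rewrite (klift_wide f (fsubsetUr (msupp x) _)) scaler_sumr -big_split /=.
by apply: eq_bigr => p _; rewrite mcoeffD mcoeffZ scalerDl scalerA.
Qed.

HB.instance Definition _ V j i (f : qpath Q j i -> V) :=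
  GRing.isLinear.Build k {malg k[qpath Q j i]} V *:%R (klift f) (klift_linear f).

Lemma klift_kpath V j i (f : qpath Q j i -> V) p : klift f (kpath k p) = f p.
Proof.
by rewrite /klift /kpath msuppU oner_eq0 big_seq_fset1 mcoeffUU scale1r.
Qed.

Lemma eq_klift V j i (f g : qpath Q j i -> V) (x : {malg k[qpath Q j i]}) :
  (forall p, p \in msupp x -> f p = g p) -> klift f x = klift g x.
Proof. by move=> fg; apply: eq_big_seq => p /fg ->. Qed.

Lemma kpathE j i (x : {malg k[qpath Q j i]}) : x = \sum_(p <- msupp x) x@_p *: kpath k p.
Proof.
rewrite {1}[x]monalgE; apply: eq_bigr => p _; apply/malgP => q.
by rewrite mcoeffZ !mcoeffU mulrnAr mulr1.
Qed.

Lemma linear_klift V j i (f : {linear {malg k[qpath Q j i]} -> V}) x :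
  f x = klift (fun p => f (kpath k p)) x.
Proof.
by rewrite {1}[x]kpathE linear_sum; apply: eq_bigr => p _; rewrite linearZ.
Qed.

Lemma kcompE j i l (x : {malg k[qpath Q i l]}) (y : {malg k[qpath Q j i]}) :
  kcomp x y = klift (fun p => klift (fun q => kpath k (qcomp p q)) y) x.
Proof.
rewrite /kcomp /klift; apply: eq_bigr => p _; rewrite scaler_sumr.
by apply: eq_bigr => q _; rewrite scalerA.
Qed.

Lemma klift_lfun (V V' : lmodType k) (f : {linear V -> V'}) j i
    (g : qpath Q j i -> V) (x : {malg k[qpath Q j i]}) :
  f (klift g x) = klift (fun p => f (g p)) x.
Proof. by rewrite /klift linear_sum; apply: eq_bigr => p _; rewrite linearZ. Qed.

Lemma klift_kcomp V j i l (f : qpath Q j l -> V) (x : {malg k[qpath Q i l]})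
    (y : {malg k[qpath Q j i]}) :
  klift f (kcomp x y) = klift (fun p => klift (fun q => f (qcomp p q)) y) x.
Proof.
rewrite kcompE (klift_lfun (klift f)); apply: eq_klift => p _.
by rewrite (klift_lfun (klift f)); apply: eq_klift => q _; apply: klift_kpath.
Qed.

Lemma kcomp_kpath j i l (p : qpath Q i l) (q : qpath Q j i) :
  kcomp (kpath k p) (kpath k q) = kpath k (qcomp p q).
Proof. by rewrite kcompE !klift_kpath. Qed.

Lemma qword_comp j i l (p : qpath Q i l) (q : qpath Q j i) :
  qword (qcomp p q) = qword p ++ qword q.
Proof. by elim: p q => //= a p IHp q; rewrite IHp. Qed.

Lemma homogeneous_kpath j i (p : qpath Q j i) : homogeneous (qdeg p) (kpath k p).
Proof. by move=> q; rewrite /kpath msuppU oner_eq0 inE => /eqP ->. Qed.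

(** Functions of words instead of paths: a word carries no endpoints, so concatenation, comparison
    and evaluation in square matrices need no casts. *)
Definition wlift V j i (phi : seq (solid Q + dotted Q) -> V) (x : {malg k[qpath Q j i]}) : V :=
  klift (fun p => phi (qword p)) x.

Lemma wlift_linear V j i (phi : seq (solid Q + dotted Q) -> V) : linear (@wlift V j i phi).
Proof. exact: klift_linear. Qed.

HB.instance Definition _ V j i (phi : seq (solid Q + dotted Q) -> V) :=
  GRing.isLinear.Build k {malg k[qpath Q j i]} V *:%R (wlift phi) (@wlift_linear V j i phi).

Lemma wlift_kcomp V j i l (phi : seq (solid Q + dotted Q) -> V)
    (x : {malg k[qpath Q i l]}) (y : {malg k[qpath Q j i]}) :
  wlift phi (kcomp x y) = wlift (fun w => wlift (fun w' => phi (w ++ w')) y) x.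
Proof.
rewrite /wlift klift_kcomp; apply: eq_klift => p _.
by apply: eq_klift => q _; rewrite qword_comp.
Qed.

Lemma wlift_kpath V j i (phi : seq (solid Q + dotted Q) -> V) (p : qpath Q j i) :
  wlift phi (kpath k p) = phi (qword p).
Proof. exact: klift_kpath. Qed.

Lemma eq_wlift V j i (phi psi : seq (solid Q + dotted Q) -> V) (x : {malg k[qpath Q j i]}) :
  phi =1 psi -> wlift phi x = wlift psi x.
Proof. by move=> E; apply: eq_klift => p _. Qed.

Lemma wliftD V j i (phi psi : seq (solid Q + dotted Q) -> V) (x : {malg k[qpath Q j i]}) :
  wlift (fun w => phi w + psi w) x = wlift phi x + wlift psi x.
Proof.
by rewrite /wlift /klift -big_split; apply: eq_bigr => p _; rewrite scalerDr.
Qed.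

Lemma wliftZ V j i c (phi : seq (solid Q + dotted Q) -> V) (x : {malg k[qpath Q j i]}) :
  wlift (fun w => c *: phi w) x = c *: wlift phi x.
Proof.
rewrite /wlift /klift scaler_sumr; apply: eq_bigr => p _.
by rewrite !scalerA mulrC.
Qed.

Lemma wliftN V j i (phi : seq (solid Q + dotted Q) -> V) (x : {malg k[qpath Q j i]}) :
  wlift (fun w => - phi w) x = - wlift phi x.
Proof. by rewrite -scaleN1r -wliftZ; apply: eq_wlift => w; rewrite scaleN1r. Qed.

Lemma wlift_eq0 V j i (phi : seq (solid Q + dotted Q) -> V) (x : {malg k[qpath Q j i]}) :
  (forall w, phi w = 0) -> wlift phi x = 0.
Proof. by move=> E; rewrite /wlift /klift big1 // => p _; rewrite E scaler0. Qed.

Lemma kwordE j i j' i' (p : qpath Q j' i') : j' = j -> i' = i ->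
  exists2 q : qpath Q j i, kword k j i (qword p) = kpath k q & qword q = qword p.
Proof. by move=> ej ei; subst j' i'; exists p; rewrite // /kword qwordK. Qed.

Lemma wlift_kword V (phi : seq (solid Q + dotted Q) -> V) j i j' i' (p : qpath Q j' i') s :
  j' = j -> i' = i -> qword p = s -> wlift phi (kword k j i s) = phi s.
Proof.
by move=> ej ei <-; have [q -> <-] := kwordE p ej ei; rewrite wlift_kpath.
Qed.

Lemma wlift_coef j i (x : {malg k[qpath Q j i]}) p :
  wlift (fun w => (w == qword p)%:R : k^o) x = x@_p.
Proof.
rewrite [in RHS](kpathE x) raddf_sum; apply: eq_bigr => q _ /=.
rewrite mcoeffZ [X in _ = _ * X]mcoeffU -(inj_eq (pcan_inj (@qwordK _ _ j i))).
by [].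
Qed.
End PathAlgebra.

Arguments homogeneous_kpath {k I Q j i} p _ _.

Section Differential.
Variables (k : fieldType) (I : finType) (D : diff_biquiver k I).
Local Notation letter := (solid D + dotted D)%type.
Implicit Types (V : lmodType k) (j i l : I).

Lemma qcomp_qid j i (p : qpath D j i) : qcomp p (qid j) = p.
Proof. by elim: p => //= a p ->. Qed.

Lemma kcomp1r j i (x : {malg k[qpath D j i]}) : kcomp x (kpath k (qid j)) = x.
Proof.
rewrite kcompE [RHS]kpathE; apply: eq_bigr => p _.
by rewrite klift_kpath qcomp_qid.
Qed.

Lemma kcomp1l j i (x : {malg k[qpath D j i]}) : kcomp (kpath k (qid i)) x = x.
Proof. by rewrite kcompE klift_kpath [RHS]kpathE. Qed.

Lemma dif_qid i : dif D (kpath k (@qid _ D i)) = 0.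
Proof.
have := @dif_comp _ _ D 0 i i i (kpath k (qid i)) (kpath k (qid i)) (homogeneous_kpath (qid i)).
rewrite expr0 scale1r !kcomp1r kcomp1l => /eqP.
by rewrite -subr_eq0 opprD addNKr oppr_eq0 => /eqP.
Qed.

Lemma wlift_dif_sol V (phi : seq letter -> V) j a (p : qpath D j (ssrc a)) :
  wlift phi (dif D (kpath k (qsol a p))) =
  wlift (fun w => phi (w ++ qword p)) (dsolid a) +
  wlift (fun w => phi (inl a :: w)) (dif D (kpath k p)).
Proof.
rewrite -[qsol a p]/(qcomp (sarrow a) p) -kcomp_kpath.
rewrite (dif_comp _ (homogeneous_kpath (sarrow a))) scale1r linearD /= !wlift_kcomp.
congr (_ + _); first by apply: eq_wlift => w; rewrite wlift_kpath.
by rewrite wlift_kpath.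
Qed.

Lemma wlift_dif_dot V (phi : seq letter -> V) j v (p : qpath D j (dsrc v)) :
  wlift phi (dif D (kpath k (qdot v p))) =
  wlift (fun w => phi (w ++ qword p)) (ddotted v) -
  wlift (fun w => phi (inr v :: w)) (dif D (kpath k p)).
Proof.
rewrite -[qdot v p]/(qcomp (darrow v) p) -kcomp_kpath.
rewrite (dif_comp _ (homogeneous_kpath (darrow v))) scaleN1r linearB /= !wlift_kcomp.
congr (_ - _); first by apply: eq_wlift => w; rewrite wlift_kpath.
by rewrite wlift_kpath.
Qed.

(* The Leibniz rule on words: [wlift phi (dif p) = dif_word phi (qword p)]. *)
Fixpoint dif_word V (phi : seq letter -> V) (s : seq letter) : V :=
  match s with
  | [::] => 0
  | inl a :: s' => wlift (fun w => phi (w ++ s')) (dsolid a) +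
                   dif_word (fun w => phi (inl a :: w)) s'
  | inr v :: s' => wlift (fun w => phi (w ++ s')) (ddotted v) -
                   dif_word (fun w => phi (inr v :: w)) s'
  end.

Lemma wlift_dif_kpath V (phi : seq letter -> V) j i (p : qpath D j i) :
  wlift phi (dif D (kpath k p)) = dif_word phi (qword p).
Proof.
elim: p phi => [|a p IHp|v p IHp] phi /=; first by rewrite dif_qid linear0.
  by rewrite wlift_dif_sol IHp.
by rewrite wlift_dif_dot IHp.
Qed.

Lemma wlift_dif V (phi : seq letter -> V) j i (x : {malg k[qpath D j i]}) :
  wlift phi (dif D x) = wlift (dif_word phi) x.
Proof.
rewrite (linear_klift (dif D)) (klift_lfun (wlift phi)); apply: eq_klift => p _.
exact: wlift_dif_kpath.
Qed.

Lemma dsolid_homogeneous (a : solid D) p : p \in msupp (dsolid a) -> qdeg p = 1%N.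
Proof. exact: (dif_deg (homogeneous_kpath (sarrow a))). Qed.

Lemma wlift_kword1 V (phi : seq letter -> V) j i (a : solid D) : ssrc a = j -> stgt a = i ->
  wlift phi (dif D (kword k j i [:: inl a])) = wlift phi (dsolid a).
Proof. by move=> ej ei; subst j i; rewrite /kword -[[:: _]]/(qword (sarrow a)) qwordK. Qed.

Lemma qpath_of2 (x : solid D) (v : dotted D) j i : dsrc v = j -> dtgt v = ssrc x -> stgt x = i ->
  exists p : qpath D j i, qword p = [:: inl x; inr v].
Proof.
move=> <- exv <-; have [p pE] : exists p : qpath D (dsrc v) (ssrc x), qword p = [:: inr v].
  by rewrite -exv; exists (darrow v).
by exists (qsol x p); rewrite /= pE.
Qed.

Lemma qpath_of2' (x : solid D) (v : dotted D) j i : ssrc x = j -> stgt x = dsrc v -> dtgt v = i ->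
  exists p : qpath D j i, qword p = [:: inr v; inl x].
Proof.
move=> <- exv <-; have [p pE] : exists p : qpath D (ssrc x) (dsrc v), qword p = [:: inl x].
  by rewrite -exv; exists (sarrow x).
by exists (qdot v p); rewrite /= pE.
Qed.

(** * Letters in the differential of a BT-box *)

Section BT.
Variables (al : I -> solid D) (tld : {x : solid D | x \notin codom al} -> dotted D).
Local Notation bb := {x : solid D | x \notin codom al}.
Hypothesis al_loop : forall i, ssrc (al i) = i /\ stgt (al i) = i.
Hypothesis tld_inj : injective tld.
Hypothesis tld_dual : forall x, dsrc (tld x) = stgt (val x) /\ dtgt (tld x) = ssrc (val x).
Hypothesis dif_al : forall i, dif D (kword k i i [:: inl (al i)]) =
            \sum_(x | stgt (val x) == i) kword k i i [:: inl (val x); inr (tld x)]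
          - \sum_(x | dtgt (tld x) == i) kword k i i [:: inr (tld x); inl (val x)].

Lemma wlift_dif_alE V (phi : seq letter -> V) i :
  wlift phi (dif D (kword k i i [:: inl (al i)])) =
  \sum_(x : bb | stgt (val x) == i) phi [:: inl (val x); inr (tld x)] -
  \sum_(x : bb | ssrc (val x) == i) phi [:: inr (tld x); inl (val x)].
Proof.
rewrite dif_al linearB /=; congr (_ - _); rewrite linear_sum /=.
  apply: eq_bigr => x /eqP xi; have [ds dt] := tld_dual x.
  have [p pE] := @qpath_of2 (val x) (tld x) i i (etrans ds xi) dt xi.
  exact: wlift_kword pE.
apply: eq_big => [x|x /eqP xi]; first by rewrite (tld_dual x).2.
have [ds dt] := tld_dual x; have xi' : ssrc (val x) = i by rewrite -dt.
have [p pE] := @qpath_of2' (val x) (tld x) i i xi' (esym ds) xi.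
exact: wlift_kword pE.
Qed.

Lemma wlift_dsolid_al V (phi : seq letter -> V) i :
  wlift phi (dsolid (al i)) =
  \sum_(x : bb | stgt (val x) == i) phi [:: inl (val x); inr (tld x)] -
  \sum_(x : bb | ssrc (val x) == i) phi [:: inr (tld x); inl (val x)].
Proof.
by rewrite -wlift_dif_alE; have [e1 e2] := al_loop i; rewrite (wlift_kword1 _ e1 e2).
Qed.

(** The vanishing of dif (dif (al i)), expanded by the Leibniz rule. Applied to indicator functions
    of words it controls the letters of the differentials; applied to traces of matrix products it
    gives skewness. *)
Lemma dif_dif_al V (phi : seq letter -> V) i :
  \sum_(x : bb | stgt (val x) == i)
    (wlift (fun w => phi (w ++ [:: inr (tld x)])) (dsolid (val x)) +
     wlift (fun w => phi (inl (val x) :: w)) (ddotted (tld x))) =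
  \sum_(x : bb | ssrc (val x) == i)
    (wlift (fun w => phi (w ++ [:: inl (val x)])) (ddotted (tld x)) -
     wlift (fun w => phi (inr (tld x) :: w)) (dsolid (val x))).
Proof.
apply/eqP; rewrite -subr_eq0; apply/eqP.
have := congr1 (wlift phi) (dif_dif (kword k i i [:: inl (al i)])).
rewrite wlift_dif wlift_dif_alE linear0 => E; rewrite -[RHS]E; congr (_ - _).
  apply: eq_bigr => x _ /=; rewrite subr0; congr (_ + _).
  by apply: eq_wlift => w; rewrite cats0.
apply: eq_bigr => x _ /=; rewrite addr0; congr (_ - _).
by apply: eq_wlift => w; rewrite cats0.
Qed.

Definition good_letter (c : letter) : bool :=
  match c with inl a => a \notin codom al | inr v => v \in codom tld end.

Local Notation coef x w := (wlift (fun w' => (w' == w)%:R : k^o) x).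

(** Compare coefficients of the word c w followed by [tld x], respectively by x. Among the terms
    that end in an undifferentiated letter only the wanted coefficient survives, by injectivity of
    [tld]; the terms that begin with one vanish by hypothesis. *)
Lemma bad_word_step c w (x : bb) :
  (forall z (y : bb),
     wlift (fun u => (inl (val y) :: u == c :: w ++ [:: z])%:R : k^o) (ddotted (tld y)) = 0 /\
     wlift (fun u => (inr (tld y) :: u == c :: w ++ [:: z])%:R : k^o) (dsolid (val y)) = 0) ->
  coef (dsolid (val x)) (c :: w) = 0 /\ coef (ddotted (tld x)) (c :: w) = 0.
Proof.
move=> term0; split.
  have := dif_dif_al (fun u => (u == (c :: w) ++ [:: inr (tld x)])%:R : k^o) (stgt (val x)).
  rewrite [X in _ = X]big1 => [|y _]; last first.
    rewrite (term0 _ y).2 subr0; apply: wlift_eq0 => u.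
    by rewrite !cats1 eqseq_rcons andbF.
  rewrite (bigD1 x) //= (term0 _ x).1 addr0 big1 ?addr0 => [<-|y /andP[_ yx]].
    by apply: eq_wlift => u; rewrite !cats1 -rcons_cons eqseq_rcons eqxx andbT.
  rewrite (term0 _ y).1 addr0; apply: wlift_eq0 => u.
  rewrite !cats1 -rcons_cons eqseq_rcons; case: eqP => //= _.
  by case: eqP => // -[/tld_inj E]; rewrite E eqxx in yx.
have := dif_dif_al (fun u => (u == (c :: w) ++ [:: inl (val x)])%:R : k^o) (ssrc (val x)).
rewrite [X in X = _]big1 => [|y _]; last first.
  rewrite (term0 _ y).1 addr0; apply: wlift_eq0 => u.
  by rewrite !cats1 eqseq_rcons andbF.
rewrite (bigD1 x) //= (term0 _ x).2 subr0 big1 ?addr0 => [->|y /andP[_ yx]].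
  by apply: eq_wlift => u; rewrite !cats1 -rcons_cons eqseq_rcons eqxx andbT.
rewrite (term0 _ y).2 subr0; apply: wlift_eq0 => u.
rewrite !cats1 -rcons_cons eqseq_rcons; case: eqP => //= _.
by case: eqP => // -[/val_inj E]; rewrite E eqxx in yx.
Qed.

(* In the cyclic words w x~ the relation dif (dif (al i)) = 0 transports the
   coefficient of w in dif x to the neighbouring letter, until a letter is met
   that has no dual. *)
Lemma bad_word_coef z0 n (w : seq letter) x : (n < size w)%N ->
  ~~ good_letter (nth z0 w n) ->
  coef (dsolid (val x)) w = 0 /\ coef (ddotted (tld x)) w = 0.
Proof.
elim: n w x => [|n IHn] [//|c w] x /= nw bad.
  have term0 z (y : bb) :
      wlift (fun u => (inl (val y) :: u == c :: w ++ [:: z])%:R : k^o) (ddotted (tld y)) = 0 /\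
      wlift (fun u => (inr (tld y) :: u == c :: w ++ [:: z])%:R : k^o) (dsolid (val y)) = 0.
    split; apply: wlift_eq0 => u; rewrite eqseq_cons.
      case: eqP => //= E; move: bad; rewrite -E /=; case/negP; exact: (valP y).
    by case: eqP => //= E; move: bad; rewrite -E /= codom_f.
  by apply: bad_word_step; apply: term0.
apply: bad_word_step => z y.
have [||E1 E2] := IHn (w ++ [:: z]) y.
- by rewrite size_cat ltn_addr.
- by rewrite nth_cat (leq_trans (leqnn _) nw : (n < size w)%N).
split.
  have [E|ne] := eqVneq (inl (val y) : letter) c.
    by rewrite -[RHS]E2; apply: eq_wlift => u; rewrite E eqseq_cons eqxx.
  by apply: wlift_eq0 => u; rewrite eqseq_cons (negbTE ne).
have [E|ne] := eqVneq (inr (tld y) : letter) c.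
  by rewrite -[RHS]E1; apply: eq_wlift => u; rewrite E eqseq_cons eqxx.
by apply: wlift_eq0 => u; rewrite eqseq_cons (negbTE ne).
Qed.

(** The differential of an arrow of [frakb] involves neither distinguished loops nor dotted arrows
    without a dual. Hence restrictions to [frakb] and their morphisms can be studied without the
    loops. *)
Lemma dsolid_good_letters (x : bb) p : p \in msupp (dsolid (val x)) -> all good_letter (qword p).
Proof.
rewrite -mcoeff_neq0 => p0; apply/(all_nthP (inr (tld x))) => n np.
apply: contraNT p0 => bad; have [E _] := bad_word_coef x np bad.
by rewrite -wlift_coef E.
Qed.

End BT.
End Differential.

(** * Modules as matrices *)

Section Evaluation.
Variables (k : fieldType) (I : finType) (D : diff_biquiver k I) (n : nat).
Local Notation letter := (solid D + dotted D)%type.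
Local Notation A := 'M[k]_n.+1.
Implicit Types (X Y Z : solid D -> A) (s t : dotted D -> A) (w u : seq letter).

(** All spaces of a module are put into one space k^(n+1) and all maps into square matrices, so a
    word is evaluated as a product without tracking vertices. The suffix counts dotted letters;
    words with another number of them give 0. *)
Fixpoint eval0 X w : A :=
  match w with
  | [::] => 1
  | inl a :: w' => X a * eval0 X w'
  | inr _ :: _ => 0
  end.

Fixpoint eval1 X Y s w : A :=
  match w with
  | [::] => 0
  | inl a :: w' => Y a * eval1 X Y s w'
  | inr v :: w' => s v * eval0 X w'
  end.

Fixpoint eval2 X Y Z s t w : A :=
  match w with
  | [::] => 0
  | inl a :: w' => Z a * eval2 X Y Z s t w'
  | inr v :: w' => t v * eval1 X Y s w'
  end.

Definition is_dotted (c : letter) := if c is inr _ then true else false.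
Definition wdeg w := count is_dotted w.

Lemma qdegE j i (p : qpath D j i) : qdeg p = wdeg (qword p).
Proof. by elim: p => //= v p ->. Qed.

Lemma eval0_deg X w : (0 < wdeg w)%N -> eval0 X w = 0.
Proof. by elim: w => //= -[a|v] w IHw //= /IHw ->; rewrite mulr0. Qed.

Lemma eval1_deg X Y s w : wdeg w != 1%N -> eval1 X Y s w = 0.
Proof.
elim: w => //= -[a|v] w IHw /=; first by rewrite add0n => /IHw ->; rewrite mulr0.
by rewrite eqSS -lt0n => /eval0_deg ->; rewrite mulr0.
Qed.

Lemma eval2_deg X Y Z s t w : wdeg w != 2 -> eval2 X Y Z s t w = 0.
Proof.
elim: w => //= -[a|v] w IHw /=; first by rewrite add0n => /IHw ->; rewrite mulr0.
by rewrite eqSS => /eval1_deg ->; rewrite mulr0.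
Qed.

Lemma eval0_cat X w u : eval0 X (w ++ u) = eval0 X w * eval0 X u.
Proof.
by elim: w => [|[a|v] w IHw] /=; rewrite ?mul1r ?mul0r // IHw mulrA.
Qed.

Lemma eval1_cat X Y s w u :
  eval1 X Y s (w ++ u) = eval1 X Y s w * eval0 X u + eval0 Y w * eval1 X Y s u.
Proof.
elim: w => [|[a|v] w IHw] /=; first by rewrite mul0r mul1r add0r.
  by rewrite IHw mulrDr !mulrA.
by rewrite eval0_cat mul0r addr0 mulrA.
Qed.

Lemma eval2_cat X Y Z s t w u : eval2 X Y Z s t (w ++ u) =
  eval2 X Y Z s t w * eval0 X u + eval1 Y Z t w * eval1 X Y s u + eval0 Z w * eval2 X Y Z s t u.
Proof.
elim: w => [|[a|v] w IHw] /=; first by rewrite !mul0r mul1r !add0r.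
  by rewrite IHw !mulrDr !mulrA.
by rewrite eval1_cat mulrDr !mulrA mul0r addr0.
Qed.

Lemma wliftMl j i (x : {malg k[qpath D j i]}) (phi : seq letter -> A) (g : A) :
  wlift (fun w => g * phi w) x = g * wlift phi x.
Proof.
rewrite /wlift /klift mulr_sumr; apply: eq_bigr => p _.
by rewrite scalerAr.
Qed.

Lemma wliftMr j i (x : {malg k[qpath D j i]}) (phi : seq letter -> A) (g : A) :
  wlift (fun w => phi w * g) x = wlift phi x * g.
Proof.
rewrite /wlift /klift mulr_suml; apply: eq_bigr => p _.
by rewrite scalerAl.
Qed.

Lemma dif_wordMl (phi : seq letter -> A) (g : A) w :
  dif_word (fun u => g * phi u) w = g * dif_word phi w.
Proof.
elim: w phi => [|[a|v] w IHw] phi /=; first by rewrite mulr0.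
  by rewrite IHw wliftMl mulrDr.
by rewrite IHw wliftMl mulrBr.
Qed.

Variable S : pred (solid D).

Definition solids_in w := all (fun c => if c is inl a then S a else true) w.

(** S is either the set of all solid arrows or [frakb]; the latter gives morphisms of
    restrictions. *)
Definition intertwines X Y (g : A) s : Prop := forall a, S a ->
  g * X a - Y a * g = wlift (eval1 X Y s) (dsolid a).

Lemma dif_word_eval1 X Y g s w : intertwines X Y g s -> solids_in w -> wdeg w = 0%N ->
  dif_word (eval1 X Y s) w = g * eval0 X w - eval0 Y w * g.
Proof.
move=> hg; elim: w => [|[a|v] w IHw] //=; first by rewrite mul1r mulr1 subrr.
move=> /andP[Sa Sw] dw; rewrite add0n in dw.
rewrite (eq_wlift _ (fun u => eval1_cat X Y s u w)).
rewrite (eq_wlift (psi := fun u => eval1 X Y s u * eval0 X w)); last first.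
  by move=> u; rewrite (eval1_deg _ _ _ (w := w)) ?dw // mulr0 addr0.
rewrite wliftMr -hg // (dif_wordMl (eval1 X Y s)) IHw //.
by rewrite mulrBl mulrBr !mulrA addrA subrK.
Qed.

Definition comp_dot X Y Z (g : A) s (h : A) t (v : dotted D) : A :=
  h * s v + t v * g - wlift (eval2 X Y Z s t) (ddotted v).

(** The last term of [comp_dot] is made for this identity: on a word of degree 1 the composite
    differs from the two naive terms by the Leibniz expansion of [eval2]. Summed over the words of
    dif a, this expansion is [eval2] at dif (dif a), which vanishes. *)
Lemma eval1_comp X Y Z g s h t w : intertwines X Y g s -> intertwines Y Z h t ->
  solids_in w -> wdeg w = 1%N ->
  eval1 X Z (comp_dot X Y Z g s h t) w =
  h * eval1 X Y s w + eval1 Y Z t w * g - dif_word (eval2 X Y Z s t) w.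
Proof.
move=> hg hh; elim: w => [|[a|v] w IHw] //=.
  move=> /andP[Sa Sw] dw; rewrite add0n in dw; rewrite IHw //.
  rewrite (eq_wlift _ (fun u => eval2_cat X Y Z s t u w)).
  rewrite (eq_wlift (psi := fun u => eval1 Y Z t u * eval1 X Y s w)); last first.
    by move=> u; rewrite (eval0_deg _ (w := w)) ?dw // (eval2_deg _ _ _ _ _ (w := w)) ?dw // !mulr0 add0r addr0.
  rewrite wliftMr -hh // (dif_wordMl (eval2 X Y Z s t)).
  have zid (P T U W : A) : T + U - (T - P + W) = P + U - W.
    by rewrite opprD opprB addrA [T + U]addrC -[U + T + _]addrA subrKC [U + P]addrC.
  by rewrite !mulrBr mulrBl !mulrDr !mulrA zid.
move=> Sw [dw]; rewrite add0n in dw.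
rewrite (eq_wlift _ (fun u => eval2_cat X Y Z s t u w)).
rewrite (eq_wlift (psi := fun u => eval2 X Y Z s t u * eval0 X w)); last first.
  by move=> u; rewrite (eval1_deg _ _ _ (w := w)) ?dw // (eval2_deg _ _ _ _ _ (w := w)) ?dw // !mulr0 !addr0.
rewrite wliftMr (dif_wordMl (eval1 X Y s)) (dif_word_eval1 hg) // /comp_dot.
have zid (P U W T : A) : P + U - (W - (T - U)) = P + T - W.
  by rewrite opprB addrA addrACA subrr addr0.
by rewrite mulrBr mulrBl !mulrDl !mulrA zid.
Qed.

Lemma intertwines_comp X Y Z g s h t :
  (forall a p, S a -> p \in msupp (dsolid a) -> solids_in (qword p)) ->
  intertwines X Y g s -> intertwines Y Z h t ->
  intertwines X Z (h * g) (comp_dot X Y Z g s h t).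
Proof.
move=> Scl hg hh a Sa.
rewrite /wlift (@eq_klift _ _ _ _ _ _ _ (fun p => (h * eval1 X Y s (qword p) +
  eval1 Y Z t (qword p) * g) - dif_word (eval2 X Y Z s t) (qword p))); last first.
  move=> p pa; apply: eval1_comp => //; first exact: Scl pa.
  by rewrite -qdegE (dsolid_homogeneous pa).
rewrite -[RHS]/(wlift (fun w => (h * eval1 X Y s w + eval1 Y Z t w * g) -
  dif_word (eval2 X Y Z s t) w) _).
rewrite wliftD wliftN -wlift_dif dif_dif linear0 subr0 wliftD wliftMl wliftMr.
by rewrite -hg // -hh // mulrBr mulrBl !mulrA addrA subrK.
Qed.
End Evaluation.

(** * Block decomposition by vertices *)

Section Blocks.
Variables (k : fieldType) (I : finType) (n : nat) (nu : 'I_n.+1 -> I).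
Local Notation A := 'M[k]_n.+1.

(* The vector space k^(n+1) is graded by I: the basis vector q lies in degree nu q. *)
Definition bproj (i : I) : A := \matrix_(p, q) ((p == q) && (nu p == i))%:R.

Definition in_block (i j : I) (M : A) : Prop := bproj i * M * bproj j = M.

Lemma bprojMl i (M : A) p q : (bproj i * M) p q = (nu p == i)%:R * M p q.
Proof.
rewrite mxE (bigD1 p) //= big1 ?addr0 ?mxE ?eqxx // => r rp.
by rewrite mxE eq_sym (negbTE rp) mul0r.
Qed.

Lemma bprojMr i (M : A) p q : (M * bproj i) p q = (nu q == i)%:R * M p q.
Proof.
rewrite mxE (bigD1 q) //= big1 ?addr0 => [|r rq]; last first.
  by rewrite mxE (negbTE rq) mulr0.
by rewrite mxE eqxx mulrC.
Qed.

Lemma bproj_idem i : bproj i * bproj i = bproj i.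
Proof.
apply/matrixP => p q; rewrite bprojMl mxE.
by case: (nu p == i); rewrite ?andbT ?andbF ?mul1r ?mul0r.
Qed.

Lemma bproj_orth i j : i != j -> bproj i * bproj j = 0.
Proof.
move=> ij; apply/matrixP => p q; rewrite bprojMl !mxE.
by case: eqP => [->|_]; rewrite ?mul0r // (negbTE ij) andbF mulr0.
Qed.

Lemma sum_bproj : \sum_i bproj i = 1.
Proof.
apply/matrixP => p q; rewrite summxE (bigD1 (nu p)) //= big1 ?addr0.
  by rewrite !mxE eqxx andbT.
by move=> i ip; rewrite mxE [nu p == i]eq_sym (negbTE ip) andbF.
Qed.

Lemma in_blockl i j M : in_block i j M -> bproj i * M = M.
Proof. by move=> <-; rewrite !mulrA bproj_idem. Qed.

Lemma in_blockr i j M : in_block i j M -> M * bproj j = M.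
Proof. by move=> <-; rewrite -!mulrA bproj_idem. Qed.

Lemma in_block_bproj i j M : in_block i j (bproj i * M * bproj j).
Proof. by rewrite /in_block !mulrA bproj_idem -!mulrA bproj_idem. Qed.

Lemma in_block0 i j : in_block i j 0.
Proof. by rewrite /in_block mulr0 mul0r. Qed.

Lemma in_blockD i j M N : in_block i j M -> in_block i j N -> in_block i j (M + N).
Proof. by rewrite /in_block mulrDr mulrDl => -> ->. Qed.

Lemma in_blockZ i j c M : in_block i j M -> in_block i j (c *: M).
Proof. by rewrite /in_block -scalerAr -scalerAl => ->. Qed.

Lemma in_blockB i j M N : in_block i j M -> in_block i j N -> in_block i j (M - N).
Proof. by move=> hM hN; rewrite -scaleN1r; apply/in_blockD/in_blockZ. Qed.

Definition bdiag (g : A) : Prop := forall i, bproj i * g = g * bproj i.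

Lemma bdiag1 : bdiag 1. Proof. by move=> i; rewrite mulr1 mul1r. Qed.

Lemma bdiag_lin c g h : bdiag g -> bdiag h -> bdiag (c *: g + h).
Proof. by move=> hg hh i; rewrite mulrDr mulrDl hh -scalerAr -scalerAl hg. Qed.

Lemma bdiagM g h : bdiag g -> bdiag h -> bdiag (g * h).
Proof. by move=> hg hh i; rewrite mulrA hg -mulrA hh mulrA. Qed.

Lemma bdiag_sum (M : A) : bdiag (\sum_i bproj i * M * bproj i).
Proof.
move=> j; rewrite mulr_sumr mulr_suml; apply: eq_bigr => i _.
have [->|ij] := eqVneq i j; first by rewrite !mulrA bproj_idem -!mulrA bproj_idem.
by rewrite -!mulrA bproj_orth // !mulrA bproj_orth 1?eq_sym // !mul0r mulr0.
Qed.

Lemma in_block_diagMl i j g M : bdiag g -> in_block i j M -> in_block i j (g * M).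
Proof.
by move=> hg hM; rewrite /in_block mulrA hg -!mulrA (in_blockr hM) (in_blockl hM).
Qed.

Lemma in_block_diagMr i j g M : bdiag g -> in_block i j M -> in_block i j (M * g).
Proof.
by move=> hg hM; rewrite /in_block -!mulrA -hg mulrA (in_blockl hM) mulrA (in_blockr hM).
Qed.

Lemma in_blockM i j l M N : in_block i j M -> in_block j l N -> in_block i l (M * N).
Proof.
by move=> hM hN; rewrite /in_block mulrA (in_blockl hM) -mulrA (in_blockr hN).
Qed.

Lemma mxtrace_diag (M g : A) : bdiag g ->
  \tr (M * g) = \sum_i \tr (bproj i * M * bproj i * g).
Proof.
move=> hg; rewrite -[in LHS](mul1r M) -sum_bproj !mulr_suml raddf_sum.
apply: eq_bigr => i _ /=; transitivity (\tr (bproj i * (M * g) * bproj i)).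
  by rewrite [RHS]trC mulrA bproj_idem mulrA.
by rewrite -!mulrA hg.
Qed.

Lemma mxtrace_diag_sum (M g : A) : bdiag g ->
  \tr (M * g) = \tr ((\sum_i bproj i * M * bproj i) * g).
Proof. by move=> hg; rewrite (mxtrace_diag _ hg) mulr_suml raddf_sum. Qed.

Lemma diag_block i g : bdiag g -> in_block i i (bproj i * g).
Proof. by move=> hg; rewrite /in_block mulrA bproj_idem -mulrA -hg mulrA bproj_idem. Qed.
End Blocks.

Section MatrixModules.
Variables (k : fieldType) (I : finType) (D : diff_biquiver k I).
Variables (n : nat) (nu : 'I_n.+1 -> I).
Local Notation letter := (solid D + dotted D)%type.
Local Notation A := 'M[k]_n.+1.
Local Notation e := (bproj k nu).
Implicit Types (X Y Z : solid D -> A) (s t : dotted D -> A).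

Definition solid_shape X := forall a, in_block nu (stgt a) (ssrc a) (X a).
Definition dotted_shape s := forall v, in_block nu (dtgt v) (dsrc v) (s v).

Lemma eval0_bproj X j i (p : qpath D j i) : solid_shape X ->
  eval0 X (qword p) * e j = e i * eval0 X (qword p).
Proof.
move=> hX; elim: p => [|a p IHp|v p IHp] /=; first by rewrite mul1r mulr1.
  by rewrite -mulrA IHp !mulrA (in_blockr (hX a)) (in_blockl (hX a)).
by rewrite mulr0 mul0r.
Qed.

Lemma eval1_block X Y s j i (p : qpath D j i) : solid_shape X -> solid_shape Y ->
  dotted_shape s -> in_block nu i j (eval1 X Y s (qword p)).
Proof.
move=> hX hY hs; elim: p => [|a p IHp|v p IHp] /=; first exact: in_block0.
  exact: in_blockM (hY a) IHp.
by rewrite /in_block -!mulrA eval0_bproj // !mulrA [X in X * _](hs v).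
Qed.

Lemma eval2_block X Y Z s t j i (p : qpath D j i) : solid_shape X -> solid_shape Y ->
  solid_shape Z -> dotted_shape s -> dotted_shape t ->
  in_block nu i j (eval2 X Y Z s t (qword p)).
Proof.
move=> hX hY hZ hs ht; elim: p => [|a p IHp|v p IHp] /=; first exact: in_block0.
  exact: in_blockM (hZ a) IHp.
by apply: in_blockM (ht v) _; apply: eval1_block.
Qed.

Lemma klift_block j i (f : qpath D j i -> A) (x : {malg k[qpath D j i]}) :
  (forall p, in_block nu i j (f p)) -> in_block nu i j (klift f x).
Proof.
move=> hf; rewrite /klift; elim/big_ind: _ => [|M N|p _]; first exact: in_block0.
  exact: in_blockD.
exact: in_blockZ.
Qed.

Lemma wlift_eval1_block X Y s j i (x : {malg k[qpath D j i]}) : solid_shape X ->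
  solid_shape Y -> dotted_shape s -> in_block nu i j (wlift (eval1 X Y s) x).
Proof. by move=> hX hY hs; apply: klift_block => p; apply: eval1_block. Qed.

Lemma wlift_eval2_block X Y Z s t j i (x : {malg k[qpath D j i]}) : solid_shape X ->
  solid_shape Y -> solid_shape Z -> dotted_shape s -> dotted_shape t ->
  in_block nu i j (wlift (eval2 X Y Z s t) x).
Proof. by move=> hX hY hZ hs ht; apply: klift_block => p; apply: eval2_block. Qed.

Lemma comp_dot_shape X Y Z g s h t : solid_shape X -> solid_shape Y -> solid_shape Z ->
  dotted_shape s -> dotted_shape t -> bdiag nu g -> bdiag nu h ->
  dotted_shape (comp_dot X Y Z g s h t).
Proof.
move=> hX hY hZ hs ht hg hh v; apply: in_blockB; last exact: wlift_eval2_block.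
by apply: in_blockD; [apply: in_block_diagMl | apply: in_block_diagMr].
Qed.

Lemma eval1_lin X Y c s t w :
  eval1 X Y (fun v => c *: s v + t v) w = c *: eval1 X Y s w + eval1 X Y t w.
Proof.
elim: w => [|[a|v] w IHw] /=; first by rewrite scaler0 addr0.
  by rewrite IHw mulrDr -scalerAr.
by rewrite mulrDl -scalerAl.
Qed.

Lemma wlift_eval1_lin X Y c s t j i (x : {malg k[qpath D j i]}) :
  wlift (eval1 X Y (fun v => c *: s v + t v)) x =
  c *: wlift (eval1 X Y s) x + wlift (eval1 X Y t) x.
Proof. by rewrite (eq_wlift _ (eval1_lin X Y c s t)) wliftD wliftZ. Qed.

Lemma wlift_eval1_0 X Y j i (x : {malg k[qpath D j i]}) : wlift (eval1 X Y (fun=> 0)) x = 0.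
Proof.
apply: wlift_eq0; elim=> [|[a|v] w IHw] //=; first by rewrite IHw mulr0.
by rewrite mul0r.
Qed.

Lemma intertwines_lin (S : pred (solid D)) X Y c g s h t :
  intertwines S X Y g s -> intertwines S X Y h t ->
  intertwines S X Y (c *: g + h) (fun v => c *: s v + t v).
Proof.
move=> hg hh a Sa; rewrite wlift_eval1_lin -hg // -hh //.
by rewrite mulrDl mulrDr -scalerAl -scalerAr opprD addrACA -scalerBr.
Qed.

Lemma intertwines1 (S : pred (solid D)) X : intertwines S X X 1 (fun=> 0).
Proof. by move=> a _; rewrite mul1r mulr1 subrr wlift_eval1_0. Qed.

Section BTModules.
Variables (al : I -> solid D) (tld : {x : solid D | x \notin codom al} -> dotted D).
Local Notation bb := {x : solid D | x \notin codom al}.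
Hypothesis al_loop : forall i, ssrc (al i) = i /\ stgt (al i) = i.
Hypothesis tld_inj : injective tld.
Hypothesis tld_dual : forall x, dsrc (tld x) = stgt (val x) /\ dtgt (tld x) = ssrc (val x).
Hypothesis dif_al : forall i, dif D (kword k i i [:: inl (al i)]) =
            \sum_(x | stgt (val x) == i) kword k i i [:: inl (val x); inr (tld x)]
          - \sum_(x | dtgt (tld x) == i) kword k i i [:: inr (tld x); inl (val x)].

Definition frakb : pred (solid D) := fun a => a \notin codom al.

Lemma solid_cases (P : solid D -> Prop) :
  (forall x : bb, P (val x)) -> (forall i, P (al i)) -> forall a, P a.
Proof.
move=> Pb Pa a; have [/codomP[i ->]//|ab] := boolP (a \in codom al).
exact: (Pb (Sub a ab)).
Qed.

Lemma al_inj : injective al.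
Proof. by move=> i j E; rewrite -(al_loop i).1 E (al_loop j).1. Qed.

Lemma al_shape X i : solid_shape X -> in_block nu i i (X (al i)).
Proof. by move=> /(_ (al i)); rewrite (al_loop i).1 (al_loop i).2. Qed.

Definition dual_dotted (sg : bb -> A) (v : dotted D) : A :=
  if [pick x | tld x == v] is Some x then sg x else 0.

Lemma dual_dotted_tld sg x : dual_dotted sg (tld x) = sg x.
Proof.
rewrite /dual_dotted; case: pickP => [y /eqP/tld_inj -> //|/(_ x)].
by rewrite eqxx.
Qed.

Lemma dual_dotted_shape sg :
  (forall x, in_block nu (ssrc (val x)) (stgt (val x)) (sg x)) -> dotted_shape (dual_dotted sg).
Proof.
move=> h v; rewrite /dual_dotted; case: pickP => [x /eqP <-|_]; last exact: in_block0.
by rewrite (tld_dual x).1 (tld_dual x).2; apply: h.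
Qed.

Lemma frakb_closed a p : frakb a -> p \in msupp (dsolid a) -> solids_in frakb (qword p).
Proof.
move=> ab pa; have := dsolid_good_letters tld_inj tld_dual dif_al (x := Sub a ab) pa.
by apply: sub_all => -[].
Qed.

(** Apply [dif_dif_al] to the trace of [eval2] and sum over all vertices. The terms with the
    differentials of the arrows [tld x] occur on both sides and agree by cyclicity of the trace; the
    remaining terms give the antisymmetry. *)
Lemma eval_antisym X s t :
  \sum_x (\tr (wlift (eval1 X X t) (dsolid (val x)) * s (tld x)) +
          \tr (t (tld x) * wlift (eval1 X X s) (dsolid (val x)))) = 0.
Proof.
pose phi w : k^o := \tr (eval2 X X X s t w).
have trw j i (x : {malg k[qpath D j i]}) (f : seq letter -> A) :
    wlift (fun w => \tr (f w) : k^o) x = \tr (wlift f x).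
  by rewrite /wlift /klift raddf_sum; apply: eq_bigr => p _; rewrite /= mxtraceZ.
have eqw := @eq_wlift k I D (k^o : lmodType k).
pose P x := \tr (wlift (eval1 X X t) (dsolid (val x)) * s (tld x)).
pose Q x := \tr (X (val x) * wlift (eval2 X X X s t) (ddotted (tld x))).
pose T x := \tr (t (tld x) * wlift (eval1 X X s) (dsolid (val x))).
have E i : \sum_(x : bb | stgt (val x) == i) (P x + Q x) =
           \sum_(x : bb | ssrc (val x) == i) (Q x - T x).
  transitivity (\sum_(x : bb | stgt (val x) == i)
    (wlift (fun w => phi (w ++ [:: inr (tld x)])) (dsolid (val x)) +
     wlift (fun w => phi (inl (val x) :: w)) (ddotted (tld x)))).
    apply: eq_bigr => x _; rewrite /P -wliftMr -trw /Q -wliftMl -trw.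
    congr (_ + _); apply: eqw => w; rewrite /phi ?eval2_cat //=.
    by rewrite !mulr0 mulr1 add0r addr0.
  rewrite dif_dif_al //; apply: eq_bigr => x _; rewrite /T -wliftMl -trw /Q trC -wliftMr -trw.
  congr (_ - _); apply: eqw => w; rewrite /phi ?eval2_cat //=.
  by rewrite !mulr0 mulr1 !addr0.
have sumE (F : bb -> k) (f : bb -> I) : \sum_x F x = \sum_i \sum_(x | f x == i) F x.
  exact: (partition_big f predT).
have: \sum_x (P x + Q x) = \sum_x (Q x - T x).
  rewrite (sumE _ (fun x => stgt (val x))) [RHS](sumE _ (fun x => ssrc (val x))).
  by apply: eq_bigr => i _.
rewrite sumrB !big_split /= => E2.
rewrite -[X in X + _]/(\sum_x P x) -[X in _ + X]/(\sum_x T x).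
have -> : \sum_x P x + \sum_x T x =
    (\sum_x P x + \sum_x Q x) - (\sum_x Q x - \sum_x T x) by ring.
by rewrite E2 subrr.
Qed.

Lemma wlift_eval1_al X Y t i : wlift (eval1 X Y t) (dsolid (al i)) =
  \sum_(x : bb | stgt (val x) == i) Y (val x) * t (tld x) -
  \sum_(x : bb | ssrc (val x) == i) t (tld x) * X (val x).
Proof.
rewrite (wlift_dsolid_al al_loop tld_dual dif_al).
by congr (_ - _); apply: eq_bigr => x _; rewrite /= !mulr1.
Qed.

(** The commutator shape of dif (al i) makes the two actions adjoint: pairing the effect of t on the
    loops with g is pairing t with the commutators of g and X. *)
Lemma sum_mxtrace_al X t g : \sum_i \tr (wlift (eval1 X X t) (dsolid (al i)) * g) =
  \sum_(x : bb) \tr (t (tld x) * (g * X (val x) - X (val x) * g)).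
Proof.
have sumE (F : bb -> k) (f : bb -> I) : \sum_x F x = \sum_i \sum_(x | f x == i) F x.
  exact: (partition_big f predT).
transitivity (\sum_x \tr (t (tld x) * (g * X (val x))) -
              \sum_x \tr (t (tld x) * (X (val x) * g))); last first.
  by rewrite -sumrB; apply: eq_bigr => x _; rewrite mulrBr raddfB.
rewrite (sumE _ (fun x => stgt (val x))) [X in _ - X](sumE _ (fun x => ssrc (val x))) -sumrB.
apply: eq_bigr => i _; rewrite wlift_eval1_al mulrBl raddfB /=.
congr (_ - _); rewrite mulr_suml raddf_sum; apply: eq_bigr => x _ /=; last by rewrite -mulrA.
by rewrite -mulrA trC -mulrA trC -mulrA.
Qed.

Lemma ffun_functional (phi : 'Hom({ffun bb -> A}, k^o)) :
  exists psi : bb -> A, forall f, phi f = \sum_x \tr (psi x * f x).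
Proof.
pose inj (x : bb) (N : A) : {ffun bb -> A} := [ffun y => if y == x then N else 0].
have ex x : exists psi, forall N : A, phi (inj x N) = \tr (psi * N).
  have [g gE] : exists g : 'Hom(A, k^o), forall N : A, g N = phi (inj x N).
    apply: lfun_of_linear => c M N; rewrite -linearP; congr (phi _).
    by apply/ffunP => y; rewrite !ffunE; case: eqP => _ //; rewrite scaler0 addr0.
  by have [psi psiE] := functional_mxtrace g; exists psi => N; rewrite -gE psiE.
have [psi psiE] := fin_all_exists ex; exists psi => f.
have -> : f = \sum_x inj x (f x).
  apply/ffunP => y; rewrite sum_ffunE (bigD1 y) //= big1 ?addr0 ?ffunE ?eqxx //.
  by move=> x xy; rewrite ffunE eq_sym (negbTE xy).
rewrite linear_sum; apply: eq_bigr => x _; rewrite /= psiE; congr (\tr (_ * _)).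
rewrite sum_ffunE (bigD1 x) //= big1 ?addr0 ?ffunE ?eqxx //.
by move=> y yx; rewrite ffunE eq_sym (negbTE yx).
Qed.

Lemma mxtrace_block i j (M N : A) : in_block nu i j N -> \tr (e j * M * e i * N) = \tr (M * N).
Proof.
by move=> hN; rewrite -!mulrA (in_blockl hN) trC -mulrA (in_blockr hN).
Qed.

Lemma block_nondegenerate i j (N : A) : in_block nu i j N ->
  (forall M, \tr (e j * M * e i * N) = 0) -> N = 0.
Proof.
move=> hN H; apply: mxtrace_nondegenerate => M.
by rewrite mxtrace_mulC -[RHS](H M) (mxtrace_block _ hN).
Qed.

(** The trace puts x and [tld x] in duality, so a functional on families over [frakb] is a dotted
    family t. If it kills the image of all s, [eval_antisym] transfers the vanishing to t: with the
    zero matrix, t is an endomorphism over [frakb], and its effect on the loops computes phi on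
    commutators. *)
Lemma dual_functional X (phi : 'Hom({ffun bb -> A}, k^o)) : solid_shape X ->
  (forall s, dotted_shape s -> phi [ffun x => wlift (eval1 X X s) (dsolid (val x))] = 0) ->
  exists t, [/\ dotted_shape t, forall x : bb, wlift (eval1 X X t) (dsolid (val x)) = 0,
    forall g, bdiag nu g -> \sum_i \tr (wlift (eval1 X X t) (dsolid (al i)) * g) =
       phi [ffun x => g * X (val x) - X (val x) * g] &
    forall f : {ffun bb -> A}, (forall x, in_block nu (stgt (val x)) (ssrc (val x)) (f x)) ->
      phi f = \sum_x \tr (t (tld x) * f x)].
Proof.
move=> hX phi0; have [psi psiE] := ffun_functional phi.
pose sg (x : bb) := e (ssrc (val x)) * psi x * e (stgt (val x)).
have hsg x : in_block nu (ssrc (val x)) (stgt (val x)) (sg x) by apply: in_block_bproj.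
pose t := dual_dotted sg; have ht : dotted_shape t by apply: dual_dotted_shape.
have phit (f : {ffun bb -> A}) : (forall x, in_block nu (stgt (val x)) (ssrc (val x)) (f x)) ->
    phi f = \sum_x \tr (t (tld x) * f x).
  move=> hf; rewrite psiE; apply: eq_bigr => x _.
  by rewrite /t dual_dotted_tld (mxtrace_block _ (hf x)).
exists t; split=> //.
  move=> x; apply: (block_nondegenerate (wlift_eval1_block _ hX hX ht)) => M.
  (* The test family is concentrated at x, so that antisymmetry isolates a single arrow. *)
  pose rh (y : bb) := if y == x then e (ssrc (val x)) * M * e (stgt (val x)) else 0.
  pose r := dual_dotted rh.
  have hr : dotted_shape r.
    apply: dual_dotted_shape => y; rewrite /rh; case: eqP => [->|_]; last exact: in_block0.
    exact: in_block_bproj.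
  have := eval_antisym X r t; rewrite big_split /= [X in _ + X = 0 -> _](_ : _ = 0).
    rewrite addr0 (bigD1 x) //= big1 ?addr0 => [E|y yx]; last first.
      by rewrite /r dual_dotted_tld /rh (negbTE yx) mulr0 mxtrace0.
    by rewrite trC -[RHS]E /r dual_dotted_tld /rh eqxx.
  rewrite -[RHS](phi0 r hr) phit => [|y]; last by rewrite ffunE; apply: wlift_eval1_block.
  by apply: eq_bigr => y _; rewrite ffunE.
move=> g hg; rewrite sum_mxtrace_al phit => [|x].
  by apply: eq_bigr => x _; rewrite ffunE.
rewrite ffunE; apply: in_blockB; first exact: in_block_diagMl.
exact: in_block_diagMr.
Qed.

End BTModules.
End MatrixModules.

(** * Bricks as matrices *)

Section Bricks.
Variables (k : closedFieldType) (I : finType) (D : diff_biquiver k I).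
Variables (n : nat) (nu : 'I_n.+1 -> I).
Local Notation letter := (solid D + dotted D)%type.
Local Notation A := 'M[k]_n.+1.
Local Notation e := (bproj k nu).
Implicit Types (X Y Z : solid D -> A) (s t : dotted D -> A).
Variables (al : I -> solid D) (tld : {x : solid D | x \notin codom al} -> dotted D).
Local Notation bb := {x : solid D | x \notin codom al}.
Hypothesis al_loop : forall i, ssrc (al i) = i /\ stgt (al i) = i.
Hypothesis tld_inj : injective tld.
Hypothesis tld_dual : forall x, dsrc (tld x) = stgt (val x) /\ dtgt (tld x) = ssrc (val x).
Hypothesis dif_al : forall i, dif D (kword k i i [:: inl (al i)]) =
            \sum_(x | stgt (val x) == i) kword k i i [:: inl (val x); inr (tld x)]
          - \sum_(x | dtgt (tld x) == i) kword k i i [:: inr (tld x); inl (val x)].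
Local Notation solid_shape := (solid_shape nu).
Local Notation dotted_shape := (dotted_shape nu).
Local Notation frakb := (frakb al).

Definition mhom X Y g s := [/\ bdiag nu g, dotted_shape s & intertwines predT X Y g s].
Definition bhom X Y g s := [/\ bdiag nu g, dotted_shape s & intertwines frakb X Y g s].
Definition mbrick X := forall g s, mhom X X g s -> exists2 c, g = c *: 1 & forall v, s v = 0.

Definition eqb X Y := forall x : bb, X (val x) = Y (val x).

Lemma eval0_eqb X Y w : eqb X Y -> solids_in frakb w -> eval0 X w = eval0 Y w.
Proof.
move=> XY; elim: w => [|[a|v] w IHw] //= /andP[ab wb].
by rewrite IHw //; congr (_ * _); apply: (XY (Sub a ab)).
Qed.

Lemma eval1_eqb X Y X' Y' s w : eqb X X' -> eqb Y Y' -> solids_in frakb w ->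
  eval1 X Y s w = eval1 X' Y' s w.
Proof.
move=> XX YY; elim: w => [|[a|v] w IHw] //= => [/andP[ab wb]|wb].
  by rewrite IHw //; congr (_ * _); apply: (YY (Sub a ab)).
by rewrite (eval0_eqb XX).
Qed.

Lemma eq_eval1 X Y X' Y' s w : X =1 X' -> Y =1 Y' -> eval1 X Y s w = eval1 X' Y' s w.
Proof.
move=> XX YY; elim: w => [|[a|v] w IHw] //=; first by rewrite YY IHw.
by congr (_ * _); elim: w {IHw} => [|[a|u] w IHw] //=; rewrite XX IHw.
Qed.

Lemma eq_mhom X Y X' Y' g s : X =1 X' -> Y =1 Y' -> mhom X Y g s -> mhom X' Y' g s.
Proof.
move=> XX YY [hg hs h]; split=> // a _; rewrite -XX -YY h //.
by apply: eq_wlift => w; apply: eq_eval1.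
Qed.

Lemma wlift_eval1_eqb X Y X' Y' s (x : bb) : eqb X X' -> eqb Y Y' ->
  wlift (eval1 X Y s) (dsolid (val x)) = wlift (eval1 X' Y' s) (dsolid (val x)).
Proof.
move=> XX YY; apply: eq_klift => p px; apply: eval1_eqb => //.
exact: (frakb_closed tld_inj tld_dual dif_al (valP x) px).
Qed.

Lemma wlift_eval1_al_eqb X Y X' Y' s i : eqb X X' -> eqb Y Y' ->
  wlift (eval1 X Y s) (dsolid (al i)) = wlift (eval1 X' Y' s) (dsolid (al i)).
Proof.
move=> XX YY; rewrite !(wlift_eval1_al al_loop tld_dual dif_al).
by congr (_ - _); apply: eq_bigr => x _; rewrite ?XX ?YY.
Qed.

Lemma bhom_eqb X Y X' Y' g s : eqb X X' -> eqb Y Y' -> bhom X Y g s -> bhom X' Y' g s.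
Proof.
move=> XX YY [hg hs h]; split=> // a ab.
have := h a ab; rewrite -[a]/(val (Sub a ab : bb)) XX YY => ->.
exact: wlift_eval1_eqb.
Qed.

Lemma mhomP X Y g s : mhom X Y g s <-> bhom X Y g s /\
  forall i, g * X (al i) - Y (al i) * g = wlift (eval1 X Y s) (dsolid (al i)).
Proof.
split=> [[hg hs h]|[[hg hs h] hal]].
  by split=> [|i]; [split=> // a _; apply: h | apply: h].
split=> // a _; elim/(@solid_cases _ _ _ al): a => [x|i]; last exact: hal.
exact: h (valP x).
Qed.

Lemma al_solids i p : p \in msupp (dsolid (al i)) -> solids_in frakb (qword p).
Proof.
rewrite -mcoeff_neq0 => p0; apply: contraNT p0 => nb; apply/eqP.
rewrite -wlift_coef (wlift_dsolid_al al_loop tld_dual dif_al).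
have nx (x : bb) : frakb (val x) by exact: (valP x).
by rewrite !big1 ?subr0 // => x _; case: eqP => // E; move: nb; rewrite -E /= nx.
Qed.

Lemma bhom_comp X Y Z g s h t : solid_shape X -> solid_shape Y -> solid_shape Z ->
  bhom X Y g s -> bhom Y Z h t -> bhom X Z (h * g) (comp_dot X Y Z g s h t).
Proof.
move=> hX hY hZ [hg hs gi] [hh ht hi]; split; first exact: bdiagM.
  exact: comp_dot_shape.
apply: intertwines_comp gi hi => a p ab pa.
exact: (frakb_closed tld_inj tld_dual dif_al ab pa).
Qed.

Lemma mhom_comp X Y Z g s h t : solid_shape X -> solid_shape Y -> solid_shape Z ->
  mhom X Y g s -> mhom Y Z h t -> mhom X Z (h * g) (comp_dot X Y Z g s h t).
Proof.
move=> hX hY hZ [hg hs gi] [hh ht hi]; split; first exact: bdiagM.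
  exact: comp_dot_shape.
apply: intertwines_comp gi hi => a p _ _; apply/allP => -[] //.
Qed.

(** The [eval2] corrections add up to dif (dif (al i)) = 0, which is why the action on the loops is
    a derivation. *)
Lemma wlift_eval1_comp_al X Y Z g s h t i : bhom X Y g s -> bhom Y Z h t ->
  wlift (eval1 X Z (comp_dot X Y Z g s h t)) (dsolid (al i)) =
  h * wlift (eval1 X Y s) (dsolid (al i)) + wlift (eval1 Y Z t) (dsolid (al i)) * g.
Proof.
move=> [hg hs gi] [hh ht hi].
rewrite /wlift (@eq_klift _ _ _ _ _ _ _ (fun p => (h * eval1 X Y s (qword p) +
  eval1 Y Z t (qword p) * g) - dif_word (eval2 X Y Z s t) (qword p))); last first.
  move=> p pa; apply: (eval1_comp gi hi); first exact: al_solids pa.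
  by rewrite -qdegE (dsolid_homogeneous pa).
rewrite -[LHS]/(wlift (fun w => (h * eval1 X Y s w + eval1 Y Z t w * g) -
  dif_word (eval2 X Y Z s t) w) _).
by rewrite wliftD wliftN -wlift_dif dif_dif linear0 subr0 wliftD wliftMl wliftMr.
Qed.

(* Modules with a fixed restriction X to frakb, up to isomorphism, are governed
   by the endomorphisms of X over frakb and their infinitesimal action on the
   distinguished loops. *)
Definition loop_rel X (S K : A) : Prop := exists2 s, bhom X X S s &
  forall i, e i * K * e i = - wlift (eval1 X X s) (dsolid (al i)).

Section LoopRelation.
Variable X : solid D -> A.
Hypothesis hX : solid_shape X.

Lemma loop_rel_lin c S K T L : loop_rel X S K -> loop_rel X T L ->
  loop_rel X (c *: S + T) (c *: K + L).
Proof.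
move=> [s [hS hs Si] sK] [t [hT ht Ti] tL]; exists (fun v => c *: s v + t v).
  split; first exact: bdiag_lin; last exact: intertwines_lin.
  by move=> v; apply: in_blockD; first exact: in_blockZ.
move=> i; rewrite wlift_eval1_lin mulrDr mulrDl tL opprD; congr (_ + _).
by rewrite -scalerAr -scalerAl sK scalerN.
Qed.

Lemma loop_rel_one : loop_rel X 1 0.
Proof.
exists (fun=> 0); last by move=> i; rewrite mulr0 mul0r wlift_eval1_0 oppr0.
by split; [exact: bdiag1 | move=> v; exact: in_block0 | exact: intertwines1].
Qed.

Lemma loop_rel_mul S K T L : loop_rel X S K -> loop_rel X T L ->
  loop_rel X (S * T) (S * L + K * T).
Proof.
move=> [s hs sK] [t ht tL]; exists (comp_dot X X X T t S s); first exact: bhom_comp.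
have [hS _ _] := hs; have [hT _ _] := ht.
move=> i; rewrite (wlift_eval1_comp_al i ht hs) opprD mulrDr mulrDl -mulrN -mulNr -sK -tL.
congr (_ + _); first by rewrite !mulrA hS.
by rewrite -!mulrA hT.
Qed.

(** By the adjointness [sum_mxtrace_al] both traces become sums over [frakb], and [eval_antisym]
    cancels them. *)
Lemma loop_rel_skew S K T L : loop_rel X S K -> loop_rel X T L ->
  \tr (K * T) + \tr (L * S) = 0.
Proof.
move=> [s hs sK] [t ht tL]; have [hT _ Ti] := ht; have [hS _ Si] := hs.
have E (K' T' : A) s' t' : bhom X X T' t' ->
    (forall i, e i * K' * e i = - wlift (eval1 X X s') (dsolid (al i))) ->
    \tr (K' * T') = - \sum_(x : bb) \tr (s' (tld x) * wlift (eval1 X X t') (dsolid (val x))).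
  move=> [hT' _ Ti'] sK'; rewrite (mxtrace_diag _ hT').
  rewrite (eq_bigr (fun i => - \tr (wlift (eval1 X X s') (dsolid (al i)) * T'))); last first.
    by move=> i _; rewrite sK' mulNr raddfN.
  rewrite sumrN (sum_mxtrace_al al_loop tld_dual dif_al); congr (- _).
  by apply: eq_bigr => x _; rewrite Ti' //; exact: (valP x).
rewrite (E K T s t ht sK) (E L S t s hs tL) -opprD -big_split /=.
rewrite -[RHS]oppr0 -[in RHS](eval_antisym tld_dual dif_al X s t); congr (- _).
by apply: eq_bigr => x _; congr (_ + _); exact: trC.
Qed.

Lemma block_sum (N : I -> A) : (forall i, in_block nu i i (N i)) ->
  bdiag nu (\sum_i N i) /\ forall i, e i * (\sum_i N i) * e i = N i.
Proof.
move=> hN; split=> [|i].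
  have -> : \sum_i N i = \sum_i e i * (\sum_j N j) * e i.
    apply: eq_bigr => i _; rewrite mulr_sumr mulr_suml (bigD1 i) //= big1 ?addr0.
      by rewrite (hN i).
    by move=> j ji; rewrite -(in_blockl (hN j)) mulrA bproj_orth 1?eq_sym // !mul0r.
  exact: bdiag_sum.
rewrite mulr_sumr mulr_suml (bigD1 i) //= big1 ?addr0; first exact: hN.
by move=> j ji; rewrite -(in_blockl (hN j)) mulrA bproj_orth 1?eq_sym // !mul0r.
Qed.

Lemma wlift_al_block Y s i : solid_shape X -> solid_shape Y -> dotted_shape s ->
  in_block nu i i (wlift (eval1 X Y s) (dsolid (al i))).
Proof.
move=> hX' hY hs; have := wlift_eval1_block (dsolid (al i)) hX' hY hs.
by move: (wlift _ _) => M; rewrite (al_loop i).1 (al_loop i).2.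
Qed.

Lemma bhom_image : exists U : {vspace {ffun bb -> A}}, forall f, f \in U <->
  exists2 s, dotted_shape s & forall x, f x = wlift (eval1 X X s) (dsolid (val x)).
Proof.
apply: vspace_of_pred => [|c f f' [s hs fs] [t ht ft]].
  by exists (fun=> 0) => [v|x]; [exact: in_block0 | rewrite ffunE wlift_eval1_0].
exists (fun v => c *: s v + t v) => [v|x]; first by apply: in_blockD; first exact: in_blockZ.
by rewrite !ffunE wlift_eval1_lin fs ft.
Qed.

(** Otherwise some block diagonal g pairs to 1 with M0 and to 0 with every N such that loop_rel X 0
    N. It is not an endomorphism of the restriction, as M0 is orthogonal to those. So its
    commutators with X lie outside the image of the dotted families, and [dual_functional] produces
    an N with nonzero pairing with g. *)
Lemma loop_rel_perp M0 : (forall S K, loop_rel X S K -> \tr (M0 * S) = 0) -> loop_rel X 0 M0.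
Proof.
move=> perp; have [W WP] : exists W : {vspace A}, forall N, N \in W <-> loop_rel X 0 N.
  apply: vspace_of_pred => [|c K L hK hL].
    by have := loop_rel_lin (-1) loop_rel_one loop_rel_one; rewrite scaler0 scaleN1r addNr addr0.
  by have := loop_rel_lin c hK hL; rewrite scaler0 addr0.
apply: NNPP => /WP/negP/mxtrace_separation[N0 [ZY ZW]].
pose g := \sum_i e i * N0 * e i; have hg : bdiag nu g := bdiag_sum nu N0.
have trg N : bdiag nu N -> \tr (N0 * N) = \tr (g * N).
  exact: mxtrace_diag_sum.
pose Md := \sum_i e i * M0 * e i; have hMd : bdiag nu Md := bdiag_sum nu M0.
have Md1 : \tr (g * Md) = 1.
  rewrite -trg // -[RHS]ZY; apply/eqP; rewrite eq_sym -subr_eq0 -raddfB /=.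
  rewrite -mulmxBr; apply/eqP/ZW/WP.
  have h0 : bhom X X 0 (fun=> 0).
    split=> [i|v|a _]; [by rewrite mulr0 mul0r | exact: in_block0 |].
    by rewrite mul0r mulr0 subrr wlift_eval1_0.
  exists (fun=> 0) => // i; rewrite wlift_eval1_0 oppr0 mulrBr mulrBl.
  rewrite /Md (block_sum (fun j => in_block_bproj nu j j M0)).2 //.
  by rewrite subrr.
have [[s hs]|ns] := classic (exists s, bhom X X g s).
  have [_ ss _] := hs; pose N i := - wlift (eval1 X X s) (dsolid (al i)).
  have hN i : in_block nu i i (N i).
    by rewrite /N -scaleN1r; apply/in_blockZ/wlift_al_block.
  have /perp : loop_rel X g (\sum_i N i) by exists s => // i; rewrite (block_sum hN).2.
  rewrite (mxtrace_diag_sum _ hg) -/Md trC Md1 => /eqP.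
  by rewrite oner_eq0.
have [U UP] := bhom_image.
pose f := [ffun x : bb => g * X (val x) - X (val x) * g].
have /vspace_separation[phi [phif phiU]] : f \notin U.
  apply/negP => /UP[s hs fs]; apply: ns; exists s; split=> // a ab.
  by have := fs (Sub a ab); rewrite ffunE.
have [|t [ht t0 tg _]] := @dual_functional _ _ _ _ nu al tld al_loop tld_inj tld_dual dif_al X phi hX.
  by move=> s hs; apply: phiU; apply/UP; exists s => // x; rewrite ffunE.
pose N i := - wlift (eval1 X X t) (dsolid (al i)).
have hN i : in_block nu i i (N i).
  by rewrite /N -scaleN1r; apply/in_blockZ/wlift_al_block.
have : loop_rel X 0 (\sum_i N i).
  exists t; last by move=> i; rewrite (block_sum hN).2.
  split=> [i||a ab]; [by rewrite mulr0 mul0r | exact: ht |].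
  by rewrite mul0r mulr0 subrr -(t0 (Sub a ab)).
move=> /WP/ZW; rewrite -[_ *m _]/(_ * _) (trg _ (block_sum hN).1) trC mulr_suml raddf_sum.
under eq_bigr do rewrite mulNr raddfN.
by rewrite sumrN (tg g hg) phif => /eqP; rewrite oppr_eq0 oner_eq0.
Qed.
End LoopRelation.

(** The loops at all vertices are stored in one matrix a, of which only the diagonal blocks count;
    so the theory of the twisted action can work in the full matrix algebra. *)
Definition with_loops X (a : A) (c : solid D) : A :=
  if [pick i | al i == c] is Some i then e i * a * e i else X c.

Lemma with_loops_al X a i : with_loops X a (al i) = e i * a * e i.
Proof.
rewrite /with_loops; case: pickP => [j /eqP/(al_inj al_loop) -> //|/(_ i)].
by rewrite eqxx.
Qed.

Lemma with_loops_val X a : eqb (with_loops X a) X.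
Proof.
move=> x; rewrite /with_loops; case: pickP => [j /eqP E|//].
by have := valP x; rewrite -E codom_f.
Qed.

Lemma with_loops_shape X a : solid_shape X -> solid_shape (with_loops X a).
Proof.
move=> hX c; rewrite /with_loops; case: pickP => [i /eqP <-|_]; last exact: hX.
by rewrite (al_loop i).1 (al_loop i).2; apply: in_block_bproj.
Qed.

Lemma with_loops_self X : solid_shape X -> with_loops X (\sum_i X (al i)) =1 X.
Proof.
move=> hX; apply: (@solid_cases _ _ _ al) => [x|i]; first exact: with_loops_val.
have hN j : in_block nu j j (X (al j)) := al_shape al_loop j hX.
by rewrite with_loops_al (block_sum hN).2.
Qed.

Lemma mhom_alg_hom X a b g s : mhom (with_loops X a) (with_loops X b) g s ->
  alg_hom (loop_rel X) a b g.
Proof.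
move=> /mhomP[hb hal]; have [hg hs _] := hb.
exists (b * g - g * a); last by rewrite addrC subrK.
exists s; first exact: bhom_eqb (with_loops_val _ _) (with_loops_val _ _) hb.
move=> i; have := hal i; rewrite !with_loops_al (wlift_eval1_al_eqb (X' := X) (Y' := X));
  [|exact: with_loops_val|exact: with_loops_val].
move=> <-; rewrite opprB mulrBr mulrBl !mulrA; congr (_ - _); last by rewrite hg.
by rewrite -!mulrA hg.
Qed.

Lemma alg_hom_mhom X a b g : alg_hom (loop_rel X) a b g ->
  exists s, mhom (with_loops X a) (with_loops X b) g s.
Proof.
move=> [K [s hs sK] E]; exists s; have [hg _ _] := hs; apply/mhomP; split.
  by apply: bhom_eqb hs => x; rewrite with_loops_val.
move=> i; rewrite !with_loops_al (wlift_eval1_al_eqb (X' := X) (Y' := X));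
  [|exact: with_loops_val|exact: with_loops_val].
rewrite -[RHS]opprK -sK; have -> : K = b * g - g * a by rewrite -E addrC addKr.
rewrite mulrBr mulrBl opprB !mulrA; congr (_ - _); first by rewrite hg.
by rewrite -!mulrA hg.
Qed.

(** [alg_brick] sees only the matrices g. The vanishing of the dotted part is a condition on the
    restriction alone, so one brick secures it for all modules with the same restriction. *)
Definition pure_rigid X := forall s, bhom X X 0 s ->
  (forall i, wlift (eval1 X X s) (dsolid (al i)) = 0) -> forall v, s v = 0.

Lemma mbrick_alg_brick X a : mbrick (with_loops X a) -> alg_brick (loop_rel X) a.
Proof.
by move=> hX S /alg_hom_mhom[s /hX[c -> _]]; exists c.
Qed.

Lemma mbrick_pure X : mbrick X -> pure_rigid X.
Proof.
move=> hX s hs hal; have [|//] := hX 0 s.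
by apply/mhomP; split=> // i; rewrite mul0r mulr0 subrr hal.
Qed.

Lemma alg_brick_mbrick X a : pure_rigid X -> alg_brick (loop_rel X) a ->
  mbrick (with_loops X a).
Proof.
move=> pX ba g s h; have [c gE] := ba g (mhom_alg_hom h).
exists c => // v; have /mhomP[hb hal] := h.
have XE := with_loops_val X a.
have [hg hs hi] := bhom_eqb XE XE hb.
pose s' v := - c *: (0 : A) + s v.
have h0 : bhom X X 0 s'.
  split=> [i|u|]; first by rewrite mul0r mulr0.
    by rewrite /s' scaler0 add0r.
  by have := intertwines_lin (- c) (@intertwines1 _ _ D n frakb X) hi; rewrite gE scaleNr addNr.
have al0 i : wlift (eval1 X X s') (dsolid (al i)) = 0.
  rewrite (wlift_eval1_lin X X (- c) (fun=> 0) s) wlift_eval1_0 scaler0 add0r.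
  rewrite -(wlift_eval1_al_eqb _ _ XE XE) -hal gE.
  by rewrite -scalerAl -scalerAr mul1r mulr1 subrr.
by have := pX s' h0 al0 v; rewrite /s' scaler0 add0r.
Qed.

(** Infinitesimal rigidity of the restriction: by [dual_functional], a functional vanishing on the
    image yields an endomorphism of the whole module with zero matrix and dotted part t. For a brick
    t = 0, so the functional vanishes on all families of the right shape. *)
Lemma brick_surjective X (f : {ffun bb -> A}) : solid_shape X -> mbrick X ->
  (forall x, in_block nu (stgt (val x)) (ssrc (val x)) (f x)) ->
  exists g s, [/\ bdiag nu g, dotted_shape s & forall x : bb,
    f x = g * X (val x) - X (val x) * g - wlift (eval1 X X s) (dsolid (val x))].
Proof.
move=> hX bX hf.
have [U UP] : exists U : {vspace {ffun bb -> A}}, forall f, f \in U <->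
    exists g s, [/\ bdiag nu g, dotted_shape s & forall x : bb,
    f x = g * X (val x) - X (val x) * g - wlift (eval1 X X s) (dsolid (val x))].
  apply: vspace_of_pred => [|c f1 f2 [g [s [hg hs E1]]] [h [t [hh ht E2]]]].
    exists 0, (fun=> 0); split=> [i|v|x]; [by rewrite mul0r mulr0 | exact: in_block0 |].
    by rewrite ffunE wlift_eval1_0 mul0r mulr0 !subrr.
  exists (c *: g + h), (fun v => c *: s v + t v); split=> [|v|x]; first exact: bdiag_lin.
    by apply: in_blockD; first exact: in_blockZ.
  rewrite !ffunE E1 E2 wlift_eval1_lin mulrDl mulrDr -scalerAl -scalerAr !scalerBr.
  have zid (a b d a' b' d' : A) : a - b - d + (a' - b' - d') = a + a' - (b + b') - (d + d').
    by rewrite addrACA -opprD; congr (_ - _); rewrite addrACA -opprD.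
  exact: zid.
apply/UP/negPn/negP => /vspace_separation[phi [phif phiU]].
have [|t [ht t0 tg tf]] := @dual_functional _ _ _ _ nu al tld al_loop tld_inj tld_dual dif_al X phi hX.
  move=> s hs; have : [ffun x : bb => - wlift (eval1 X X s) (dsolid (val x))] \in U.
    apply/UP; exists 0, s; split=> // [i|x]; first by rewrite mul0r mulr0.
    by rewrite ffunE mul0r mulr0 subrr sub0r.
  move=> /phiU E; apply/eqP; rewrite -oppr_eq0 -[X in _ == X]E -linearN.
  by apply/eqP; congr (phi _); apply/ffunP => x; rewrite !ffunE.
(* The effect of t on the loop, paired with g, is phi at a commutator of g and X, and commutators
   lie in U. *)
have tal i : wlift (eval1 X X t) (dsolid (al i)) = 0.
  have hw j := wlift_al_block j hX hX ht.
  apply: (block_nondegenerate (hw i)) => M; pose g := e i * M * e i.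
  have hg : bdiag nu g.
    have h1 j : in_block nu j j (if j == i then g else 0).
      case: eqP => [->|_]; first exact: in_block_bproj.
      exact: in_block0.
    have := (block_sum h1).1; rewrite (bigD1 i) //= eqxx big1 ?addr0 // => j.
    by case: eqP.
  rewrite trC; have := tg g hg; rewrite (bigD1 i) //= big1 ?addr0 => [->|j ji].
    apply: phiU; apply/UP; exists g, (fun=> 0); split=> // [v|x]; first exact: in_block0.
    by rewrite ffunE wlift_eval1_0 subr0.
  rewrite -(in_blockr (hw j)) /g -!mulrA (mulrA (e j)) bproj_orth // mul0r.
  by rewrite mulr0 mxtrace0.
have [|c _ tv] := bX 0 t.
  apply/mhomP; split; last by move=> i; rewrite mul0r mulr0 subrr tal.
  split=> [i||a ab]; [by rewrite mul0r mulr0 | exact: ht |].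
  by rewrite mul0r mulr0 subrr -(t0 (Sub a ab)).
have := phif; rewrite tf // big1 => [/eqP|x _]; first by rewrite eq_sym oner_eq0.
by rewrite tv mul0r mxtrace0.
Qed.

(** * Polynomial paths of restrictions *)

Definition polyfun (f : k -> k) := exists p : {poly k}, forall z, f z = p.[z].
Definition polymx (M : k -> A) := forall i j, polyfun (fun z => M z i j).

Lemma polyfun_const c : polyfun (fun=> c).
Proof. by exists c%:P => z; rewrite hornerC. Qed.

Lemma polyfun_add f g : polyfun f -> polyfun g -> polyfun (fun z => f z + g z).
Proof. by move=> [p pE] [q qE]; exists (p + q) => z; rewrite hornerD pE qE. Qed.

Lemma polyfun_mul f g : polyfun f -> polyfun g -> polyfun (fun z => f z * g z).
Proof. by move=> [p pE] [q qE]; exists (p * q) => z; rewrite hornerM pE qE. Qed.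

Lemma polyfun_ext f g : f =1 g -> polyfun f -> polyfun g.
Proof. by move=> fg [p pE]; exists p => z; rewrite -fg. Qed.

Lemma polyfun_sum (J : Type) (r : seq J) (f : J -> k -> k) :
  (forall j, polyfun (f j)) -> polyfun (fun z => \sum_(j <- r) f j z).
Proof.
move=> hf; elim: r => [|j r IHr].
  by apply: polyfun_ext (polyfun_const 0) => z; rewrite big_nil.
by apply: polyfun_ext (polyfun_add (hf j) IHr) => z; rewrite big_cons.
Qed.

Lemma polymx_const M : polymx (fun=> M).
Proof. by move=> i j; apply: polyfun_const. Qed.

Lemma polymx_add M N : polymx M -> polymx N -> polymx (fun z => M z + N z).
Proof.
move=> hM hN i j; apply: polyfun_ext (polyfun_add (hM i j) (hN i j)) => z.
by rewrite mxE.
Qed.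

Lemma polymx_mul M N : polymx M -> polymx N -> polymx (fun z => M z * N z).
Proof.
move=> hM hN i j.
apply: polyfun_ext (polyfun_sum _ (fun l => polyfun_mul (hM i l) (hN l j))) => z.
by rewrite mxE.
Qed.

Lemma polymx_scale f M : polyfun f -> polymx M -> polymx (fun z => f z *: M z).
Proof.
by move=> hf hM i j; apply: polyfun_ext (polyfun_mul hf (hM i j)) => z; rewrite mxE.
Qed.

Lemma polymx_eval1 (P1 P2 : k -> solid D -> A) s w :
  (forall a, polymx (P1^~ a)) -> (forall a, polymx (P2^~ a)) ->
  polymx (fun z => eval1 (P1 z) (P2 z) s w).
Proof.
move=> h1 h2; elim: w => [|[a|v] w IHw] /=; first exact: polymx_const.
  exact: polymx_mul.
apply: polymx_mul; first exact: polymx_const.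
elim: w {IHw} => [|[a|u] w IHw] /=; [exact: polymx_const | exact: polymx_mul | exact: polymx_const].
Qed.

Lemma polymx_wlift_eval1 (P1 P2 : k -> solid D -> A) s j i (x : {malg k[qpath D j i]}) :
  (forall a, polymx (P1^~ a)) -> (forall a, polymx (P2^~ a)) ->
  polymx (fun z => wlift (eval1 (P1 z) (P2 z) s) x).
Proof.
move=> h1 h2 p q; rewrite /wlift /klift.
have h (y : qpath D j i) :
    polyfun (fun z => (x@_y *: eval1 (P1 z) (P2 z) s (qword y)) p q).
  exact: (polymx_scale (polyfun_const _) (polymx_eval1 s (qword y) h1 h2)).
apply: polyfun_ext (polyfun_sum (msupp x) h) => z.
by rewrite summxE.
Qed.

Local Notation hdata := (A * {ffun dotted D -> A})%type.

Lemma defect_lfun X Y : exists d : 'Hom(hdata, {ffun bb -> A}), forall v x,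
  d v x = v.1 * X (val x) - Y (val x) * v.1 - wlift (eval1 X Y v.2) (dsolid (val x)).
Proof.
pose f (v : hdata) : {ffun bb -> A} := [ffun x : bb =>
  v.1 * X (val x) - Y (val x) * v.1 - wlift (eval1 X Y v.2) (dsolid (val x))].
suff lin : linear f.
  by have [d dE] := lfun_of_linear lin; exists d => v x; rewrite dE ffunE.
move=> c u v; apply/ffunP => x; rewrite !ffunE /=.
have -> : wlift (eval1 X Y (c *: u.2 + v.2)) (dsolid (val x)) =
    c *: wlift (eval1 X Y u.2) (dsolid (val x)) + wlift (eval1 X Y v.2) (dsolid (val x)).
  rewrite -wlift_eval1_lin; apply: eq_wlift; elim=> [|[a|w] r IHr] //=; first by rewrite IHr.
  by rewrite !ffunE.
have zid (a b c1 a' b' c' : A) : a - b - c1 + (a' - b' - c') = a + a' - (b + b') - (c1 + c').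
  by rewrite addrACA -opprD; congr (_ - _); rewrite addrACA -opprD.
by rewrite mulrDl mulrDr -scalerAl -scalerAr !scalerBr zid.
Qed.

(** The defect of a pair (g, s) is linear, with coefficients polynomial in z, and at z0 it is onto
    by [brick_surjective]. The solution (1, 0) at z0 therefore continues to almost all z. *)
Lemma brick_line X (P1 P2 : k -> solid D -> A) z0 : solid_shape X -> mbrick X ->
  (forall z, solid_shape (P1 z)) -> (forall z, solid_shape (P2 z)) ->
  (forall a, polymx (P1^~ a)) -> (forall a, polymx (P2^~ a)) ->
  P1 z0 =1 X -> P2 z0 =1 X ->
  exists2 p : {poly k}, p != 0 & forall z, p.[z] != 0 ->
    exists g s, g \is a GRing.unit /\ bhom (P1 z) (P2 z) g s.
Proof.
move=> hX bX h1 h2 p1 p2 e1 e2.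
have [G GP] : exists G : {vspace hdata}, forall v, v \in G <->
    bdiag nu v.1 /\ dotted_shape v.2.
  apply: vspace_of_pred => [|c u v [hu hu'] [hv hv']].
    by split=> [i|v]; rewrite ?ffunE /=; [rewrite mul0r mulr0 | exact: in_block0].
  split=> [|w]; first exact: bdiag_lin.
  by rewrite /= !ffunE; apply: in_blockD; first exact: in_blockZ.
have [W WP] : exists W : {vspace {ffun bb -> A}}, forall f, f \in W <->
    forall x, in_block nu (stgt (val x)) (ssrc (val x)) (f x).
  apply: vspace_of_pred => [x|c f g hf hg x]; first by rewrite ffunE; exact: in_block0.
  by rewrite !ffunE; apply: in_blockD; first exact: in_blockZ.
pose dd z v : {ffun bb -> A} := [ffun x : bb => v.1 * P1 z (val x) - P2 z (val x) * v.1 -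
  wlift (eval1 (P1 z) (P2 z) (v.2 : {ffun dotted D -> A})) (dsolid (val x))].
have dlin z : exists d : 'Hom(hdata, {ffun bb -> A}), forall v, d v = dd z v.
  have [d dE] := defect_lfun (P1 z) (P2 z); exists d => v.
  by apply/ffunP => x; rewrite dE ffunE.
have ddW z v : v \in G -> dd z v \in W.
  move=> /GP[hv hv']; apply/WP => x; rewrite ffunE; apply: in_blockB.
    apply: in_blockB; first exact: in_block_diagMl hv (h1 z _).
    exact: in_block_diagMr hv (h2 z _).
  exact: wlift_eval1_block (h1 z) (h2 z) hv'.
pose h := vbasis G; pose w := vbasis W.
have hG i : tnth h i \in G by rewrite vbasis_mem ?mem_tnth.
have polyF (c : 'I_(\dim G) * 'I_(\dim W)) : exists q : {poly k}, forall z,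
    coord w c.2 (dd z (tnth h c.1)) = q.[z].
  have [psi psiE] := ffun_functional (linfun (coord w c.2 : {linear {ffun bb -> A} -> k^o})).
  suff: polyfun (fun z => \sum_x \tr (psi x * dd z (tnth h c.1) x)).
    by move=> [q qE]; exists q => z; rewrite -qE -psiE lfunE.
  apply: polyfun_sum => x; apply: polyfun_sum => i.
  apply: (@polymx_mul (fun=> psi x) (fun z => dd z (tnth h c.1) x)).
    exact: polymx_const.
  move=> p q; apply: (@polyfun_ext (fun z => ((tnth h c.1).1 * P1 z (val x) +
    (-1) *: (P2 z (val x) * (tnth h c.1).1) +
    (-1) *: wlift (eval1 (P1 z) (P2 z) (tnth h c.1).2) (dsolid (val x))) p q)).
    by move=> z; rewrite ffunE !scaleN1r.
  apply: polymx_add; first apply: polymx_add.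
  - by apply: polymx_mul => //; apply: polymx_const.
  - apply: polymx_scale; first exact: polyfun_const.
    by apply: polymx_mul => //; apply: polymx_const.
  - apply: polymx_scale; first exact: polyfun_const.
    exact: polymx_wlift_eval1.
have [Fq FqE] := fin_all_exists polyF.
pose F : 'M[{poly k}]_(\dim G, \dim W) := \matrix_(i, l) Fq (i, l).
pose vec (u : 'rV[k]_(\dim G)) : hdata := \sum_i u 0 i *: tnth h i.
have vecG u : vec u \in G by rewrite memv_suml // => i _; rewrite memvZ.
have vec_coord v : v \in G -> vec (\row_i coord h i v) = v.
  move=> vG; rewrite [RHS](coord_vbasis vG); apply: eq_bigr => i _.
  by rewrite mxE (tnth_nth 0).
have FE z u l : (u *m map_mx (horner_eval z) F) 0 l = coord w l (dd z (vec u)).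
  have [d dE] := dlin z; rewrite mxE -dE /vec !linear_sum; apply: eq_bigr => i _.
  by rewrite !mxE /horner_eval -FqE linearZ /= linearZ /= dE.
have dd0 v : dd z0 v = [ffun x : bb => v.1 * X (val x) - X (val x) * v.1 -
    wlift (eval1 X X (v.2 : {ffun dotted D -> A})) (dsolid (val x))].
  apply/ffunP => x; rewrite !ffunE e1 e2; congr (_ - _).
  by apply: eq_wlift => r; apply: eq_eval1.
have surj l : exists2 v, v \in G & dd z0 v = tnth w l.
  have /WP hw : tnth w l \in W by rewrite vbasis_mem ?mem_tnth.
  have [g [s [hg hs E]]] := brick_surjective hX bX hw.
  exists (g, [ffun v => s v]); first by apply/GP; split=> // v; rewrite ffunE.
  rewrite dd0; apply/ffunP => x; rewrite E ffunE /=; congr (_ - _).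
  by apply: eq_wlift; elim=> [|[a|y] r IHr] //=; rewrite ?IHr ?ffunE.
have [v vG vE] := fin_all_exists2 surj.
pose s : 'M[k]_(\dim W, \dim G) := \matrix_(l, i) coord h i (v l).
pose one : hdata := (1, 0).
have oneG : one \in G.
  by apply/GP; split=> [|y]; [exact: bdiag1 | rewrite ffunE; exact: in_block0].
pose iota := (vec_mx \o mulmxr (\matrix_i mxvec (tnth h i).1) : {linear 'rV[k]_(\dim G) -> A}).
have iotaE u : iota u = (vec u).1.
  rewrite /vec (raddf_sum (fst : {additive hdata -> A})) /iota /= mulmx_sum_row linear_sum.
  by apply: eq_bigr => i _; rewrite linearZ /= rowK mxvecK.
have [|||p p0 pP] := @polynomial_kernel_extension k _ _ _ F s z0 (\row_i coord h i one) iota.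
- apply/row_matrixP => l; rewrite row_mul; apply/rowP => m; rewrite FE.
  have -> : row l s = \row_i coord h i (v l) by apply/rowP => i; rewrite !mxE.
  rewrite vec_coord // vE (tnth_nth 0) !mxE (coord_free _ _ (basis_free (vbasisP W))).
  by rewrite eq_sym.
- apply/rowP => l; rewrite FE vec_coord // mxE dd0.
  have -> : [ffun x : bb => one.1 * X (val x) - X (val x) * one.1 -
      wlift (eval1 X X (one.2 : {ffun dotted D -> A})) (dsolid (val x))] = 0.
    apply/ffunP => x; rewrite !ffunE mul1r mulr1 subrr sub0r.
    apply/eqP; rewrite oppr_eq0 -(wlift_eval1_0 X X (dsolid (val x))); apply/eqP.
    by apply: eq_wlift; elim=> [|[a|y] r IHr] //=; rewrite ?IHr ?ffunE.
  by rewrite linear0.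
- by rewrite iotaE vec_coord // det1 oner_neq0.
exists p; first by apply: contraNneq p0 => ->; rewrite horner0.
move=> z /pP[u uF uD]; have /GP[hg hs] := vecG u.
exists (vec u).1, (vec u).2; split.
  by rewrite -[_ \is a _]/((vec u).1 \in unitmx) unitmxE unitfE -iotaE.
have d0 : dd z (vec u) = 0.
  rewrite [LHS](coord_vbasis (ddW z _ (vecG u))) big1 // => l _.
  by rewrite -FE uF mxE scale0r.
split=> // a ab; have := congr1 (fun f : {ffun bb -> A} => f (Sub a ab)) d0.
by rewrite !ffunE => /eqP; rewrite subr_eq0 => /eqP.
Qed.
Lemma bhom_line X Y Z z0 : solid_shape X -> solid_shape Y -> solid_shape Z -> mbrick X ->
  (forall a, Y a + z0 *: Z a = X a) ->
  exists2 p : {poly k}, p != 0 & forall z, p.[z] != 0 ->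
    (exists g s, g \is a GRing.unit /\ bhom X (fun a => Y a + z *: Z a) g s) /\
    (exists g s, g \is a GRing.unit /\ bhom (fun a => Y a + z *: Z a) X g s).
Proof.
move=> hX hY hZ bX P0; pose P z a := Y a + z *: Z a.
have hP z : solid_shape (P z) by move=> a; apply: in_blockD => //; apply/in_blockZ.
have pP a : polymx (P^~ a).
  apply: (@polymx_add (fun=> Y a)); first exact: polymx_const.
  apply: polymx_scale; last exact: polymx_const.
  by exists 'X => z; rewrite !hornerE.
have pX (a : solid D) : polymx (fun=> X a) by exact: polymx_const.
have [p p0 pE] := @brick_line X (fun=> X) P z0 hX bX (fun=> hX) hP pX pP (frefl _) P0.
have [q q0 qE] := @brick_line X P (fun=> X) z0 hX bX hP (fun=> hX) pP pX P0 (frefl _).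
exists (p * q); first by rewrite mulf_neq0.
by move=> z; rewrite hornerM mulf_eq0 negb_or => /andP[/pE ? /qE].
Qed.

Lemma bhom_bricks X Y : solid_shape X -> solid_shape Y -> mbrick X -> mbrick Y ->
  exists g s, g \is a GRing.unit /\ bhom X Y g s.
Proof.
move=> hX hY bX bY; pose Z a := Y a - X a.
have hZ : solid_shape Z by move=> a; apply: in_blockB.
have [|p p0 pE] := @bhom_line X X Z 0 hX hX hZ bX; first by move=> a; rewrite scale0r addr0.
have [|q q0 qE] := @bhom_line Y X Z 1 hY hX hZ bY.
  by move=> a; rewrite scale1r addrC subrK.
have [z] := closed_field_avoid_roots (mulf_neq0 p0 q0).
rewrite hornerM mulf_eq0 negb_or => /andP[/pE[[g [s [gu hg]]] _] /qE[_ [h [t [hu hh]]]]].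
exists (h * g), (comp_dot X (fun a => X a + z *: Z a) Y g s h t); split.
  by rewrite unitrMl.
by apply: bhom_comp hg hh => // a; apply: in_blockD => //; apply: in_blockZ.
Qed.

Lemma bdiagV (g : A) : g \is a GRing.unit -> bdiag nu g -> bdiag nu g^-1.
Proof. by move=> gu hg i; apply: (mulrI gu); rewrite !mulrA -hg divrr // -mulrA divrr // mulr1 mul1r. Qed.

(* The loops of the target can be adjusted so that an invertible morphism over
   frakb becomes a morphism. *)
Lemma bhom_push X Y g s : solid_shape X -> solid_shape Y -> g \is a GRing.unit ->
  bhom X Y g s -> exists a, mhom X (with_loops Y a) g s.
Proof.
move=> hX hY gu hb; have [hg hs _] := hb.
pose N i := (g * X (al i) - wlift (eval1 X Y s) (dsolid (al i))) * g^-1.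
have hN i : in_block nu i i (N i).
  apply: in_block_diagMr; first exact: bdiagV.
  apply: in_blockB; last exact: wlift_al_block.
  apply: in_block_diagMl => //; exact: (al_shape al_loop _ hX).
exists (\sum_i N i); apply/mhomP; split.
  by apply: bhom_eqb hb => // x; rewrite with_loops_val.
move=> i; rewrite with_loops_al (block_sum hN).2 /N -mulrA mulVr // mulr1.
rewrite opprB addrC subrK; apply: wlift_eval1_al_eqb => // x.
by rewrite with_loops_val.
Qed.

Lemma mhom_inv Y a b g s : solid_shape Y -> g \is a GRing.unit ->
  mhom (with_loops Y a) (with_loops Y b) g s ->
  exists t, mhom (with_loops Y b) (with_loops Y a) g^-1 t.
Proof.
move=> hY gu /mhom_alg_hom h; apply: alg_hom_mhom.
exact: (alg_hom_inv (@loop_rel_lin Y) (loop_rel_one Y) (loop_rel_mul hY) gu h).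
Qed.

(** [mhom_inv] inverts morphisms only between modules with the same restriction. Hence a second
    morphism h back to the restriction of Y is chosen, the composite h g is inverted there, and (h
    g)^-1 h leads back to Y. *)
Lemma brick_transfer X Y : solid_shape X -> solid_shape Y -> mbrick X -> mbrick Y ->
  exists a, [/\ alg_brick (loop_rel X) a,
    exists g s, g \is a GRing.unit /\ mhom Y (with_loops X a) g s &
    exists g s, g \is a GRing.unit /\ mhom (with_loops X a) Y g s].
Proof.
move=> hX hY bX bY; have [g [s [gu hg]]] := bhom_bricks hY hX bY bX.
have [a ha] := bhom_push hY hX gu hg; exists a.
have hXa := with_loops_shape a hX.
have [h [t [hu hh]]] := bhom_bricks hX hY bX bY.
have {}hh : bhom (with_loops X a) Y h t.
  by apply: bhom_eqb hh => // x; rewrite with_loops_val.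
have [b hb] := bhom_push hXa hY hu hh.
have [r [u [ru hr]]] : exists r u, r \is a GRing.unit /\ mhom (with_loops X a) Y r u.
  have hYb := with_loops_shape b hY.
  have := mhom_comp hY hXa hYb ha hb; set u := comp_dot _ _ _ _ _ _ _ => hc.
  have hc' := eq_mhom (fun c => esym (with_loops_self hY c)) (frefl _) hc.
  have [|v hv] := mhom_inv hY _ hc'; first by rewrite unitrMl.
  have {}hv := eq_mhom (frefl _) (with_loops_self hY) hv.
  exists ((h * g)^-1 * h), (comp_dot (with_loops X a) (with_loops Y b) Y h t (h * g)^-1 v).
  split; first by rewrite unitrMl // unitrV unitrMl.
  by apply: mhom_comp hb hv.
split; [|by exists g, s | by exists r, u].
(* r S g and r g are endomorphisms of the brick Y, hence scalar, while r and g are invertible. *)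
move=> S /alg_hom_mhom[v hv].
have [c cE _] := bY _ _ (mhom_comp hY hXa hY (mhom_comp hY hXa hXa ha hv) hr).
have [d dE _] := bY _ _ (mhom_comp hY hXa hY ha hr).
have d0 : d != 0.
  have : r * g \is a GRing.unit by rewrite unitrMl.
  by rewrite dE; apply: contraTneq => ->; rewrite scale0r unitr0.
exists (c / d); apply: (mulrI ru); apply: (mulIr gu); rewrite -mulrA cE.
by rewrite -scalerAr -scalerAl mulr1 dE scalerA divfK.
Qed.

Theorem matrix_brick_family X : solid_shape X -> mbrick X -> exists E : A,
  let X_ c := with_loops X (\sum_i X (al i) + c *: E) in
  [/\ forall c, mbrick (X_ c),
      forall c c' g s, g \is a GRing.unit -> mhom (X_ c) (X_ c') g s -> c = c' &
      forall Y, solid_shape Y -> mbrick Y -> exists c,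
        (exists g s, g \is a GRing.unit /\ mhom Y (X_ c) g s) /\
        (exists g s, g \is a GRing.unit /\ mhom (X_ c) Y g s)].
Proof.
move=> hX bX; set a1 := \sum_i _.
have ba1 : alg_brick (loop_rel X) a1.
  apply: mbrick_alg_brick => g s h.
  exact: bX (eq_mhom (with_loops_self hX) (with_loops_self hX) h).
have [E [E1 E2 E3]] := alg_brick_family (@loop_rel_lin X) (loop_rel_one X) (loop_rel_mul hX)
  (@loop_rel_skew X) (loop_rel_perp hX) ba1.
exists E; split=> [c|c c' g s gu /mhom_alg_hom|Y hY bY].
- exact: alg_brick_mbrick (mbrick_pure bX) (E1 c).
- exact: E2.
have [a [ba [g [s [gu hg]]] [h [t [hu hh]]]]] := brick_transfer hX hY bX bY.
have [c [T Tu hT]] := E3 a ba; exists c.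
have [u hu'] := alg_hom_mhom hT; have [v hv] := mhom_inv hX Tu hu'.
have h1 := with_loops_shape a hX; have h2 := with_loops_shape (a1 + c *: E) hX.
split.
  exists (T * g), (comp_dot Y (with_loops X a) (with_loops X (a1 + c *: E)) g s T u).
  by split; [rewrite unitrMl | exact: mhom_comp].
exists (h * T^-1), (comp_dot (with_loops X (a1 + c *: E)) (with_loops X a) Y T^-1 v h t).
by split; [rewrite unitrMl ?unitrV | exact: mhom_comp].
Qed.

End Bricks.

(** * Tensor products with free functors *)

Section RestrictScalars.
Variables (k : fieldType) (La : algType k) (L : lmodType La).

(** L viewed over k through the scalars of La. The tensor product is a k-space, and its universal
    property speaks of targets over k. *)
Definition kres : Type := L.
HB.instance Definition _ := GRing.Zmodule.copy kres L.

Definition kscale (c : k) (x : kres) : kres := (c%:A : La) *: (x : L).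

Fact kscaleA a b x : kscale a (kscale b x) = kscale (a * b) x.
Proof. by rewrite /kscale scalerA -scalerAl mul1r scalerA. Qed.
Fact kscale1 : left_id 1 kscale.
Proof. by move=> x; rewrite /kscale !scale1r. Qed.
Fact kscaleDr : right_distributive kscale +%R.
Proof. by move=> c x y; apply: scalerDr. Qed.
Fact kscaleDl x : {morph kscale^~ x : a b / a + b}.
Proof. by move=> a b; rewrite /kscale !scalerDl. Qed.
HB.instance Definition _ := GRing.Zmodule_isLmodule.Build k kres
  kscaleA kscale1 kscaleDr kscaleDl.
End RestrictScalars.

Section FreeFunctor.
Variables (k : fieldType) (I : finType) (Q : biquiver I) (La : algType k).
Variables (Q0 : finType) (nu : Q0 -> I) (G : solid Q -> Q0 -> Q0 -> La).

Definition fdim l := #|[pred q | nu q == l]|.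
Definition fidx l (p : 'I_(fdim l)) : Q0 := enum_val p.

Lemma fidx_inj l : injective (@fidx l). Proof. exact: enum_val_inj. Qed.
Lemma nu_fidx l p : nu (@fidx l p) = l. Proof. by have /eqP := enum_valP p. Qed.
Lemma fidx_onto l q : nu q = l -> exists p, @fidx l p = q.
Proof.
move=> ql; have qA : q \in [pred q | nu q == l] by rewrite inE ql.
by exists (enum_rank_in qA q); apply: enum_rankK_in.
Qed.

Fact free_projective (l : I) : fg_projective ('rV[La^c]_(fdim l)).
Proof. by exists (fdim l), idfun, idfun. Qed.

(** A row vector over La^c multiplied on the right is a column over La multiplied on the left, hence
    the transposed indices. *)
Definition free_matrix (a : solid Q) : 'M[La^c]_(fdim (ssrc a), fdim (stgt a)) :=
  \matrix_(q, p) (G a (fidx p) (fidx q) : La^c).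

(* The functor sending l to the free right La-module on the fibre of nu over l,
   where a acts by left multiplication with the matrix G a. *)
Definition free_functor : proj_functor Q La :=
  ProjFunctor free_projective (fun a => mulmxr (free_matrix a)).

(** The tensor product in coordinates: N l is a sum of copies of L over the fibre of nu at l. The
    maps are indexed by all of Q0 and vanish outside the fibre, which keeps the index type
    independent of l. *)
Record frame (L : lmodType La) (N : rep k Q) (j : forall l, Q0 -> L -> N l)
    (pi : forall l, Q0 -> N l -> L) : Prop := Frame {
  frame_inj : forall l q c x y, j l q (c%:A *: x + y) = c *: j l q x + j l q y;
  frame_proj : forall l q c y z, pi l q (c *: y + z) = c%:A *: pi l q y + pi l q z;
  frame_orth : forall l p q x, pi l p (j l q x) = if (p == q) && (nu q == l) then x else 0;
  frame_sum : forall l y, \sum_q j l q (pi l q y) = y;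
  frame_map : forall a q x, nu q = ssrc a ->
    rep_map N a (j (ssrc a) q x) = \sum_p j (stgt a) p (G a p q *: x) }.

Lemma sum_fidx (V : nmodType) l (F : Q0 -> V) : (forall q, nu q != l -> F q = 0) ->
  \sum_q F q = \sum_(p : 'I_(fdim l)) F (fidx p).
Proof.
move=> F0; rewrite (bigID (fun q => nu q == l)) /= [X in _ + X]big1 ?addr0; last exact: F0.
exact: (big_enum_val (A := [pred q | nu q == l])).
Qed.

Lemma induced_frame L N : is_induced free_functor L N -> exists j pi, @frame L N j pi.
Proof.
move=> [tau [htau hN]].
pose dl l p : 'rV[La^c]_(fdim l) := delta_mx 0 p.
have hb l (p : 'I_(fdim l)) : @balanced k La 'rV[La^c]_(fdim l) L (kres L)
    (fun v x => (v 0 p : La) *: x).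
  split=> [v w x|v x y|v r x|c v x]; rewrite ?mxE ?scalerDl ?scalerDr //.
    by rewrite [RHS]scalerA.
  rewrite -[RHS]/(c%:A *: ((v 0 p : La) *: x)) !scalerA; congr (_ *: x).
  by rewrite -scalerAl mul1r -scalerAr mulr1.
have [pi piE] : exists pi : forall l, 'I_(fdim l) -> N l -> L, forall l p,
    (forall c y z, pi l p (c *: y + z) = c%:A *: pi l p y + pi l p z) /\
    forall v x, pi l p (tau l v x) = (v 0 p : La) *: x.
  have H l : exists f : 'I_(fdim l) -> N l -> L, forall p,
      (forall c y z, f p (c *: y + z) = c%:A *: f p y + f p z) /\
      forall v x, f p (tau l v x) = (v 0 p : La) *: x.
    suff H p : exists f : N l -> L,
      (forall c y z, f (c *: y + z) = c%:A *: f y + f z) /\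
      forall v x, f (tau l v x) = (v 0 p : La) *: x by exact: fin_all_exists H.
    have [f [fE _]] := (htau l).2 _ _ (hb l p).
    by exists f; split=> // c y z; rewrite linearP.
  exact: fin_all_exists H.
have tauD l v w x : tau l (v + w) x = tau l v x + tau l w x by case: (htau l).1.
have tauDr l v x y : tau l v (x + y) = tau l v x + tau l v y by case: (htau l).1.
have tauZ l v (r : La) x : tau l ((r : La^c) *: v) x = tau l v (r *: x).
  by case: (htau l).1.
have tauZr l v c x : tau l v (c%:A *: x) = c *: tau l v x by case: (htau l).1.
have tau0r l v : tau l v 0 = 0.
  by apply: (addIr (tau l v 0)); rewrite add0r -tauDr addr0.
have tau0 l x : tau l 0 x = 0.
  by apply: (addIr (tau l 0 x)); rewrite add0r -tauD addr0.
have tau_sum l x (v : 'rV[La^c]_(fdim l)) :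
    tau l v x = \sum_p tau l (dl l p) ((v 0 p : La) *: x).
  rewrite {1}[v]row_sum_delta (big_morph (tau l ^~ x) (fun v w => tauD l v w x) (tau0 l x)).
  by apply: eq_bigr => p _; rewrite tauZ.
have tau_sumr l v (J : finType) (F : J -> L) :
    tau l v (\sum_i F i) = \sum_i tau l v (F i).
  exact: (big_morph (tau l v) (tauDr l v) (tau0r l v)).
pose j l q x := \sum_(p : 'I_(fdim l) | fidx p == q) tau l (dl l p) x.
pose pj l q y := \sum_(p : 'I_(fdim l) | fidx p == q) pi l p y.
have j_fidx l p x : j l (@fidx l p) x = tau l (dl l p) x.
  by rewrite /j (eq_bigl (pred1 p)) ?big_pred1_eq // => p'; apply/eqP/eqP => [/fidx_inj|->].
have pj_fidx l p x : pj l (@fidx l p) x = pi l p x.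
  by rewrite /pj (eq_bigl (pred1 p)) ?big_pred1_eq // => p'; apply/eqP/eqP => [/fidx_inj|->].
have j0 l q x : nu q != l -> j l q x = 0.
  by move=> ql; rewrite /j big_pred0 // => p; apply: contra_neqF ql => /eqP <-; apply: nu_fidx.
have pj0 l q x : nu q != l -> pj l q x = 0.
  by move=> ql; rewrite /pj big_pred0 // => p; apply: contra_neqF ql => /eqP <-; apply: nu_fidx.
have piD l p x y : pi l p (x + y) = pi l p x + pi l p y.
  by have := (piE l p).1 1 x y; rewrite !scale1r.
have pi0 l p : pi l p 0 = 0.
  by apply: (addIr (pi l p 0)); rewrite add0r -piD addr0.
exists j, pj; split.
- move=> l q c x y; rewrite /j scaler_sumr -big_split; apply: eq_bigr => p _ /=.
  by rewrite tauDr tauZr.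
- move=> l q c x y; rewrite /pj scaler_sumr -big_split; apply: eq_bigr => p _ /=.
  by rewrite (piE l p).1.
- move=> l p q x; case: (eqVneq (nu q) l) => [ql|nq]; last first.
    rewrite andbF j0 // /pj big1 // => p' _; exact: pi0.
  rewrite andbT; have [q' <-] := fidx_onto ql; rewrite j_fidx.
  case: (eqVneq (nu p) l) => [pl|np]; last first.
    by rewrite pj0 //; case: eqP => // E; move: np; rewrite E nu_fidx eqxx.
  have [p' <-] := fidx_onto pl; rewrite pj_fidx (piE l p').2 mxE eqxx /= (inj_eq (@fidx_inj l)).
  by rewrite eq_sym; case: eqP => _; rewrite ?scale1r ?scale0r // eq_sym.
- move=> l y; rewrite (@sum_fidx _ l) => [|q ql]; last by rewrite j0.
  under eq_bigr => p _ do rewrite j_fidx pj_fidx.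
  (* The sum of the composites of projections and injections agrees with the identity on pure
     tensors; uniqueness in the universal property makes them equal. *)
  have tb : balanced (tau l) := (htau l).1.
  have [f [fE fU]] := (htau l).2 _ _ tb.
  have lin : linear (fun z => \sum_p tau l (dl l p) (pi l p z)).
    move=> c z z'; rewrite scaler_sumr -big_split; apply: eq_bigr => p _ /=.
    by rewrite (piE l p).1 tauDr tauZr.
  pose g := GRing.isLinear.Build k (N l) (N l) _ _ lin.
  pose gl : {linear N l -> N l} := HB.pack (fun z => \sum_p tau l (dl l p) (pi l p z)) g.
  have E1 : gl y = f y.
    apply: fU => v x; rewrite [RHS]tau_sum /gl /=; apply: eq_bigr => p _.
    by rewrite (piE l p).2.
  have E2 : y = f y by exact: (fU idfun).
  by rewrite [LHS]E1 -E2.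
- move=> a q x qa; have [q' <-] := fidx_onto qa; rewrite j_fidx hN tau_sum.
  rewrite (@sum_fidx _ (stgt a)) => [|p np]; last by rewrite j0.
  apply: eq_bigr => p _; rewrite j_fidx; congr (tau _ _ (_ *: _)).
  rewrite /= /dl -rowE !mxE; congr (G a _ _).
Qed.

Section Frame.
Variables (L : lmodType La) (N : rep k Q).
Variables (j : forall l, Q0 -> L -> N l) (pi : forall l, Q0 -> N l -> L).
Arguments j {l}.
Arguments pi {l}.
Hypothesis fr : frame (@j) (@pi).

Lemma frame_injD l q x y : j q (x + y) = j q x + j q y :> N l.
Proof. by have := frame_inj fr l q 1 x y; rewrite !scale1r. Qed.

Lemma frame_inj0 l q : j q 0 = 0 :> N l.
Proof. by apply: (addIr (j q 0)); rewrite add0r -frame_injD addr0. Qed.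

Lemma frame_injZ l q c x : j q (c%:A *: x) = c *: j q x :> N l.
Proof. by have := frame_inj fr l q c x 0; rewrite frame_inj0 !addr0. Qed.

Lemma frame_projD l q (x y : N l) : pi q (x + y) = pi q x + pi q y.
Proof. by have := frame_proj fr q 1 x y; rewrite !scale1r. Qed.

Lemma frame_proj0 l q : pi q (0 : N l) = 0.
Proof. by apply: (addIr (pi q (0 : N l))); rewrite add0r -frame_projD addr0. Qed.

Lemma frame_projZ l q c (x : N l) : pi q (c *: x) = c%:A *: pi q x.
Proof. by have := frame_proj fr q c x 0; rewrite frame_proj0 !addr0. Qed.

Lemma frame_inj_sum l q (J : finType) (F : J -> L) :
  j q (\sum_i F i) = \sum_i j q (F i) :> N l.
Proof. exact: (big_morph _ (frame_injD l q) (frame_inj0 l q)). Qed.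

Lemma frame_proj_sum l q (J : finType) (F : J -> N l) :
  pi q (\sum_i F i) = \sum_i pi q (F i).
Proof. exact: (big_morph _ (@frame_projD l q) (frame_proj0 l q)). Qed.

Lemma frame_inj_out l q x : nu q != l -> j q x = 0 :> N l.
Proof.
move=> /negbTE ql; rewrite -[LHS](frame_sum fr) big1 // => p _.
by rewrite (frame_orth fr) ql andbF frame_inj0.
Qed.

Lemma frame_proj_inj l q x : nu q = l -> pi q (j q x : N l) = x.
Proof. by move=> ql; rewrite (frame_orth fr) ql !eqxx. Qed.

Lemma frame_proj_out l q (y : N l) : nu q != l -> pi q y = 0.
Proof.
move=> /negbTE ql; rewrite -[y](frame_sum fr) frame_proj_sum big1 // => p _.
rewrite (frame_orth fr); case: eqP => [<-|//]; by rewrite ql.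
Qed.

Lemma frame_map_gen a q x : rep_map N a (j q x) =
  if nu q == ssrc a then \sum_p j p (G a p q *: x) else 0.
Proof.
case: eqP => [/(frame_map fr) -> //|/eqP nq].
by rewrite frame_inj_out // linear0.
Qed.

Lemma frame_induced : is_induced free_functor L N.
Proof.
exists (fun l (v : 'rV[La^c]_(fdim l)) x => \sum_p j (fidx p) ((v 0 p : La) *: x)); split=> [l|a v x]; last first.
  rewrite linear_sum /=.
  under eq_bigr => p _ do rewrite frame_map_gen nu_fidx eqxx.
  rewrite exchange_big (@sum_fidx _ (stgt a)) => [|q nq]; last first.
    by rewrite big1 // => p _; rewrite frame_inj_out.
  apply: eq_bigr => q _; rewrite -frame_inj_sum; congr (j _ _).
  rewrite mxE scaler_suml; apply: eq_bigr => p _.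
  by rewrite scalerA mxE.
split; first split.
- move=> v w x; rewrite -big_split; apply: eq_bigr => p _ /=.
  by rewrite mxE scalerDl frame_injD.
- by move=> v x y; rewrite -big_split; apply: eq_bigr => p _ /=; rewrite scalerDr frame_injD.
- by move=> v r x; apply: eq_bigr => p _; rewrite mxE [in RHS]scalerA.
- move=> c v x; rewrite scaler_sumr; apply: eq_bigr => p _.
  rewrite -frame_injZ !scalerA; congr (j _ (_ *: _)).
  by rewrite -scalerAl mul1r -scalerAr mulr1.
move=> W b [bD bDr bZ bZr].
have b0 x : b 0 x = 0 by apply: (addIr (b 0 x)); rewrite add0r -bD addr0.
have b_sum x (v : 'rV[La^c]_(fdim l)) :
    b v x = \sum_p b (delta_mx 0 p) ((v 0 p : La) *: x).
  rewrite {1}[v]row_sum_delta (big_morph (b ^~ x) (fun v w => bD v w x) (b0 x)).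
  by apply: eq_bigr => p _; rewrite bZ.
pose f0 (y : N l) := \sum_p b (delta_mx 0 p) (pi (fidx p) y).
have lin : linear f0.
  move=> c z z'; rewrite scaler_sumr -big_split; apply: eq_bigr => p _ /=.
  by rewrite (frame_proj fr) bDr bZr.
pose f : {linear N l -> W} := HB.pack f0 (GRing.isLinear.Build k (N l) W _ f0 lin).
exists f; split=> [v x|g gE y]; rewrite /f /= /f0.
  rewrite [RHS]b_sum; apply: eq_bigr => p _; congr (b _ _).
  rewrite frame_proj_sum (bigD1 p) //= frame_proj_inj ?nu_fidx // big1 ?addr0 // => p' np.
  rewrite (frame_orth fr) (inj_eq (@fidx_inj l)) eq_sym.
  by rewrite (negbTE np).
rewrite -{1}[y](frame_sum fr) linear_sum (@sum_fidx _ l) => [|q nq]; last first.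
  by rewrite frame_inj_out ?linear0.
apply: eq_bigr => p _; rewrite -gE; congr (g _).
rewrite (bigD1 p) //= mxE !eqxx scale1r big1 ?addr0 // => p' np.
by rewrite mxE (negbTE np) andbF scale0r frame_inj0.
Qed.
End Frame.
End FreeFunctor.

(** * Coordinates *)

Section Coordinates.
Variables (k : closedFieldType) (I : finType) (D : diff_biquiver k I).
Variables (n : nat) (nu : 'I_n.+1 -> I).
Local Notation A := 'M[k]_n.+1.
Local Notation col := 'cV[k]_n.+1.
Local Notation e := (bproj k nu).

(** M l is identified with the degree l part of the column space: [cout] embeds it, and [cin]
    projects back. *)
Record coords (M : rep k D) (X : solid D -> A) := Coords {
  cin : forall l, 'Hom(col, M l);
  cout : forall l, 'Hom(M l, col);
  cinK : forall l y, cin l (cout l y) = y;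
  coutK : forall l c, cout l (cin l c) = e l *m c;
  cmap : forall a c, cout (stgt a) (rep_map M a (cin (ssrc a) c)) = X a *m c }.

Definition mxfun (f : 'Hom(col, col)) : A := \matrix_(p, q) f (delta_mx q 0) p 0.

Lemma mxfunE f c : mxfun f *m c = f c.
Proof.
rewrite {2}[c]matrix_sum_delta; apply/colP => p; rewrite linear_sum summxE mxE.
apply: eq_bigr => q _; rewrite big_ord1 linearZ /= !mxE mulrC; congr (_ * _).
Qed.

Lemma mulmx_inj (M N : A) : (forall c : col, M *m c = N *m c) -> M = N.
Proof.
move=> E; apply/matrixP => p q; have := E (delta_mx q 0).
by rewrite -!colE => /colP/(_ p); rewrite !mxE.
Qed.

Section Matrix.
Variables (M N : rep k D) (X Y : solid D -> A) (C : coords M X) (C' : coords N Y).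

Definition mat i j (f : 'Hom(M i, N j)) : A := mxfun (cout C' j \o f \o cin C i)%VF.
Definition unmat i j (B : A) : 'Hom(M i, N j) :=
  (cin C' j \o linfun (mulmx B) \o cout C i)%VF.

Lemma matE i j (f : 'Hom(M i, N j)) c : mat f *m c = cout C' j (f (cin C i c)).
Proof. by rewrite /mat mxfunE !comp_lfunE. Qed.

Lemma mat_out i j (f : 'Hom(M i, N j)) y : mat f *m cout C i y = cout C' j (f y).
Proof. by rewrite matE cinK. Qed.

Lemma mat_inj i j : injective (@mat i j).
Proof.
move=> f g fg; apply/lfunP => y.
by rewrite -[f y](cinK C') -[g y](cinK C') -!mat_out fg.
Qed.

Lemma mat_block i j (f : 'Hom(M i, N j)) : in_block nu j i (mat f).
Proof.
apply: mulmx_inj => c; rewrite -[X in X *m _]/(e j *m mat f *m e i) -!mulmxA.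
by rewrite -(coutK C i) mat_out -(coutK C' j) !cinK matE.
Qed.

Lemma mat_unmat i j B : in_block nu j i B -> mat (unmat i j B) = B.
Proof.
move=> hB; apply: mulmx_inj => c; rewrite matE /unmat !comp_lfunE !coutK lfunE /=.
rewrite !mulmxA; congr (_ *m c); exact: hB.
Qed.

Lemma mat_lin i j c (f g : 'Hom(M i, N j)) : mat (c *: f + g) = c *: mat f + mat g.
Proof.
apply: mulmx_inj => v; rewrite mulmxDl -scalemxAl !matE add_lfunE scale_lfunE.
by rewrite linearP.
Qed.
HB.instance Definition _ i j := GRing.isLinear.Build k _ _ _ (@mat i j) (@mat_lin i j).

Definition hmat (S : hom_data M N) : A := \sum_i mat (hob S i).
Definition dmat (S : hom_data M N) (v : dotted D) : A := mat (hdot S v).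
Definition unhom g (s : dotted D -> A) : hom_data M N :=
  HomData (fun i => unmat i i (e i * g)) (fun v => unmat (dsrc v) (dtgt v) (s v)).

Lemma mat_hob S i : mat (hob S i) = e i * hmat S.
Proof.
rewrite /hmat mulr_sumr (bigD1 i) //= big1 ?addr0; last first.
  by move=> j ji; rewrite -(in_blockl (mat_block (hob S j))) mulrA bproj_orth 1?eq_sym // mul0r.
by rewrite (in_blockl (mat_block (hob S i))).
Qed.

Lemma hmat_bdiag S : bdiag nu (hmat S).
Proof.
move=> i; rewrite -mat_hob /hmat mulr_suml (bigD1 i) //= big1 ?addr0.
  by rewrite (in_blockr (mat_block (hob S i))).
by move=> j ji; rewrite -(in_blockr (mat_block (hob S j))) -mulrA bproj_orth // mulr0.
Qed.

Lemma dmat_shape S : dotted_shape nu (dmat S).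
Proof. by move=> v; exact: mat_block. Qed.

Lemma hmat_unhom g s : bdiag nu g -> hmat (unhom g s) = g.
Proof.
move=> hg; rewrite /hmat (eq_bigr (fun i => e i * g)) => [|i _].
  by rewrite -mulr_suml sum_bproj mul1r.
by rewrite mat_unmat //; exact: diag_block.
Qed.

Lemma dmat_unhom g s v : dotted_shape nu s -> dmat (unhom g s) v = s v.
Proof. by move=> hs; rewrite /dmat mat_unmat. Qed.
End Matrix.

Lemma coords_shape M X (C : coords M X) : solid_shape nu X.
Proof.
have E a : X a = mat C C (rep_map M a).
  by apply: mulmx_inj => c; rewrite matE cmap.
by move=> a; rewrite E; exact: mat_block.
Qed.

Lemma mat_rep_map M X (C : coords M X) a : mat C C (rep_map M a) = X a.
Proof. by apply: mulmx_inj => c; rewrite matE cmap. Qed.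

Lemma mat_comp M N L X Y Z (C : coords M X) (C' : coords N Y) (C'' : coords L Z)
    i j l (f : 'Hom(M i, N j)) (g : 'Hom(N j, L l)) :
  mat C C'' (g \o f)%VF = mat C' C'' g * mat C C' f.
Proof.
by apply: mulmx_inj => c; rewrite -mulmxA !matE comp_lfunE cinK.
Qed.

Lemma mat_id M X (C : coords M X) i : mat C C (\1%VF : 'End(M i)) = e i.
Proof. by apply: mulmx_inj => c; rewrite matE id_lfunE coutK. Qed.

Lemma mat_ev0 M X (C : coords M X) j i (p : qpath D j i) :
  mat C C (ev0 M p) = eval0 X (qword p) * e j.
Proof.
elim: p => [|a p IHp|v p _] /=; first by rewrite mat_id mul1r.
  by rewrite (mat_comp C C C) mat_rep_map IHp mulrA.
by rewrite linear0 mul0r.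
Qed.

Lemma mat_ev1 M N X Y (C : coords M X) (C' : coords N Y) S j i (p : qpath D j i) :
  mat C C' (ev1 S p) = eval1 X Y (dmat C C' S) (qword p).
Proof.
elim: p => [|a p IHp|v p _] /=; first by rewrite linear0.
  by rewrite (mat_comp C C' C') mat_rep_map IHp.
rewrite (mat_comp C C C') mat_ev0 (eval0_bproj p (coords_shape C)) mulrA; congr (_ * _).
exact: (in_blockr (mat_block C C' (hdot S v))).
Qed.

Lemma mat_ev2 M N L X Y Z (C : coords M X) (C' : coords N Y) (C'' : coords L Z)
    S' S j i (p : qpath D j i) :
  mat C C'' (ev2 S' S p) = eval2 X Y Z (dmat C C' S) (dmat C' C'' S') (qword p).
Proof.
elim: p => [|a p IHp|v p _] /=; first by rewrite linear0.
  by rewrite (mat_comp C C'' C'') mat_rep_map IHp.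
by rewrite (mat_comp C C' C'') mat_ev1.
Qed.

Lemma is_hom_mat M N X Y (C : coords M X) (C' : coords N Y) (S : hom_data M N) :
  is_hom S <-> mhom nu X Y (hmat C C' S) (dmat C C' S).
Proof.
have hX := coords_shape C; have hY := coords_shape C'.
have E a : mat C C' ((hob S (stgt a) \o rep_map M a)%VF - (rep_map N a \o hob S (ssrc a))%VF) =
    hmat C C' S * X a - Y a * hmat C C' S.
  rewrite linearB /= (mat_comp C C C') (mat_comp C C' C') !mat_rep_map !mat_hob.
  by rewrite (hmat_bdiag C C' S (stgt a)) -mulrA (in_blockl (hX a)) mulrA (in_blockr (hY a)).
have E' a : mat C C' (klift (@ev1 k I D M N S (ssrc a) (stgt a)) (dsolid a)) =
    wlift (eval1 X Y (dmat C C' S)) (dsolid a).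
  by rewrite klift_lfun; apply: eq_klift => p _; apply: mat_ev1.
split=> [hS|[_ _ hS] a]; last by apply: (@mat_inj _ _ _ _ C C'); rewrite E E'; exact: hS.
split; [exact: hmat_bdiag | exact: dmat_shape |].
by move=> a _; rewrite -E hS E'.
Qed.

Lemma hmat_comp M N L X Y Z (C : coords M X) (C' : coords N Y) (C'' : coords L Z)
    (S' : hom_data N L) (S : hom_data M N) :
  hmat C C'' (hcomp S' S) = hmat C' C'' S' * hmat C C' S.
Proof.
rewrite {1}/hmat (eq_bigr (fun i => mat C' C'' (hob S' i) * hmat C C' S)); last first.
  move=> i _; rewrite /= (mat_comp C C' C'') (mat_hob C C' S) mulrA; congr (_ * _).
  exact: (in_blockr (mat_block _ _ _)).
by rewrite -mulr_suml.
Qed.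

Lemma dmat_comp M N L X Y Z (C : coords M X) (C' : coords N Y) (C'' : coords L Z)
    (S' : hom_data N L) (S : hom_data M N) v :
  dmat C C'' (hcomp S' S) v =
  comp_dot X Y Z (hmat C C' S) (dmat C C' S) (hmat C' C'' S') (dmat C' C'' S') v.
Proof.
rewrite /dmat /= linearB linearD /= !(mat_comp C C' C'') !mat_hob /comp_dot.
rewrite klift_lfun (eq_klift (g := fun p => eval2 X Y Z (dmat C C' S) (dmat C' C'' S') (qword p))).
  congr (_ + _ - _); rewrite ?mulrA; last first.
    by congr (_ * _); exact: (in_blockr (mat_block _ _ _)).
  by rewrite hmat_bdiag -mulrA (in_blockl (mat_block _ _ _)).
by move=> p _; apply: mat_ev2.
Qed.

Lemma is_scalar_mat M X (C : coords M X) c (S : hom_data M M) :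
  is_scalar c S <-> hmat C C S = c *: 1 /\ forall v, dmat C C S v = 0.
Proof.
split=> [[S1 S2]|[S1 S2]]; split.
- rewrite /hmat (eq_bigr (fun i => c *: e i)); last first.
    by move=> i _; rewrite S1 linearZ /= mat_id.
  by rewrite -scaler_sumr sum_bproj.
- by move=> v; rewrite /dmat S2 linear0.
- move=> i; apply: (@mat_inj _ _ _ _ C C); rewrite mat_hob S1 linearZ /= mat_id.
  by rewrite -scalerAr mulr1.
- by move=> v; apply: (@mat_inj _ _ _ _ C C); rewrite linear0; exact: S2.
Qed.

Lemma is_hom_unhom M N X Y (C : coords M X) (C' : coords N Y) g s :
  mhom nu X Y g s -> is_hom (unhom C C' g s).
Proof.
move=> [hg hs h]; apply/(is_hom_mat C C'); rewrite hmat_unhom //.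
split=> [//|v|a _]; first by rewrite dmat_unhom.
rewrite h //; apply: eq_wlift; elim=> [|[b|v] w IHw] //=; first by rewrite IHw.
by rewrite dmat_unhom.
Qed.

Lemma brick_mat M X (C : coords M X) : brick M <-> mbrick nu X.
Proof.
split=> [[_ bM] g s h|bX].
  have [hg hs _] := h.
  have [c /(is_scalar_mat C)[]] := bM _ (is_hom_unhom C C h).
  by rewrite hmat_unhom // => -> s0; exists c => // v; rewrite -(s0 v) dmat_unhom.
split=> [M0|S /(is_hom_mat C C)/bX[c g0 s0]]; last by exists c; apply/(is_scalar_mat C).
have : (1 : A) = 0.
  rewrite -(sum_bproj k nu) big1 // => i _; rewrite -(mat_id C); set f := \1%VF.
  suff -> : f = 0 by rewrite linear0.
  apply/lfunP => y; apply/eqP; move: (M0 i) => /eqP; rewrite dimv_eq0 => /eqP E.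
  by rewrite /f id_lfunE zero_lfunE -memv0 -E memvf.
by move/eqP; rewrite oner_eq0.
Qed.

Lemma rep_iso_mat M N X Y (C : coords M X) (C' : coords N Y) : rep_iso M N ->
  exists g s, g \is a GRing.unit /\ mhom nu X Y g s.
Proof.
move=> [S [S' [hS hS' E _]]]; exists (hmat C C' S), (dmat C C' S); split; last exact/is_hom_mat.
have /(is_scalar_mat C)[] := E; rewrite (hmat_comp C C' C) scale1r => E1 _.
by apply/unitrP; exists (hmat C' C S'); split=> //; apply: mulmx1C.
Qed.
End Coordinates.

Lemma mhom_scale (k : closedFieldType) (I : finType) (D : diff_biquiver k I) n
    (nu : 'I_n.+1 -> I) (X Y : solid D -> 'M[k]_n.+1) c g s :
  mhom nu X Y g s -> exists t, mhom nu X Y (c *: g) t.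
Proof.
move=> [hg hs h]; exists (fun v => c *: s v + 0); split=> [i|v|a _].
- by rewrite -scalerAl -scalerAr hg.
- by rewrite addr0; apply: in_blockZ.
- have := wlift_eval1_lin X Y c s (fun=> 0) (dsolid a) => /= ->.
  by rewrite wlift_eval1_0 addr0 -scalerAl -scalerAr -scalerBr h.
Qed.

Lemma fibres_exist (I : finType) (d : I -> nat) : (0 < \sum_i d i)%N ->
  exists n (nu : 'I_n.+1 -> I), forall i, fdim nu i = d i.
Proof.
move=> d0; pose s := flatten [seq nseq (d i) i | i <- enum I].
have cs i : count_mem i s = d i.
  rewrite count_flatten -map_comp sumnE big_map big_enum /= (bigD1 i) //= big1 ?addn0.
    by rewrite count_nseq /= eqxx mul1n.
  by move=> j ji; rewrite count_nseq /= (negbTE ji).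
case Es: s => [|x s'].
  by move: d0; rewrite big1 // => i _; rewrite -cs Es.
exists (size s'), (tnth (in_tuple (x :: s'))) => i.
rewrite -(cs i) Es -sum1_count big_tnth /fdim -sum1_card.
by apply: eq_bigl => q.
Qed.

Section Exist.
Variables (k : closedFieldType) (I : finType) (D : diff_biquiver k I).
Variables (n : nat) (nu : 'I_n.+1 -> I).
Local Notation A := 'M[k]_n.+1.
Local Notation col := 'cV[k]_n.+1.

Lemma coords_exist (M : rep k D) : (forall i, dimvec M i = fdim nu i) ->
  exists X, inhabited (coords nu M X).
Proof.
move=> dM.
have basis l : exists b : (fdim nu l).-tuple (M l), basis_of fullv b.
  by rewrite -dM /dimvec; exists (vbasis {: M l}); apply: vbasisP.
have [b bP] := fin_all_exists basis.
pose cin0 l (c : col) : M l := \sum_p c (@fidx _ _ nu l p) 0 *: (b l)`_p.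
pose cout0 l (y : M l) : col := \col_q \sum_(p | @fidx _ _ nu l p == q) coord (b l) p y.
have lin1 l : linear (cin0 l).
  move=> c x y; rewrite /cin0 scaler_sumr -big_split; apply: eq_bigr => p _ /=.
  by rewrite !mxE scalerDl scalerA.
have lin2 l : linear (cout0 l).
  move=> c x y; apply/colP => q; rewrite !mxE mulr_sumr -big_split; apply: eq_bigr => p _ /=.
  by rewrite linearP.
have [ci ciE] := fin_all_exists (fun l => lfun_of_linear (lin1 l)).
have [co coE] := fin_all_exists (fun l => lfun_of_linear (lin2 l)).
have coutE l p y : co l y (@fidx _ _ nu l p) 0 = coord (b l) p y.
  rewrite coE mxE (eq_bigl (pred1 p)) ?big_pred1_eq // => p'.
  by rewrite (inj_eq (@fidx_inj _ _ _ _)).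
have cinK l y : ci l (co l y) = y.
  rewrite ciE /cin0 [RHS](coord_basis (bP l)) ?memvf //.
  by apply: eq_bigr => p _; rewrite coutE.
have coutK l c : co l (ci l c) = bproj k nu l *m c.
  apply/colP => q; rewrite [bproj _ _ _ *m c]/(_ *m _) mxE (bigD1 q) //= big1 => [|p pq]; last first.
    by rewrite mxE eq_sym (negbTE pq) mul0r.
  rewrite addr0 mxE eqxx /=; case: eqP => [ql|nq]; last first.
    rewrite mul0r coE mxE big_pred0 // => p; apply/eqP => E.
    by apply: nq; rewrite -E nu_fidx.
  have [p <-] := fidx_onto ql; rewrite coutE mul1r ciE linear_sum (bigD1 p) //= big1 ?addr0.
    by rewrite linearZ /= (coord_free _ _ (basis_free (bP l))) eqxx mulr1.
  move=> p' pp; rewrite linearZ /= (coord_free _ _ (basis_free (bP l))).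
  by rewrite (negbTE pp) mulr0.
exists (fun a => mxfun (co _ \o rep_map M a \o ci _)%VF); split.
exists ci co => // a c; by rewrite mxfunE !comp_lfunE.
Qed.

Lemma coords_rep (M : rep k D) X Y : coords nu M X -> solid_shape nu Y ->
  exists N : rep k D, inhabited (coords nu N Y) /\ dimvec N =1 dimvec M.
Proof.
move=> C hY; pose N := @Rep k I D M (fun a => unmat C C (ssrc a) (stgt a) (Y a)).
exists N; split=> //; split.
refine (@Coords k I D n nu N Y (cin C) (cout C) _ _ _) => [l y|l c|a c].
- exact: (cinK C y).
- exact: (coutK C l c).
- by rewrite /= -[LHS](matE C C) mat_unmat.
Qed.
End Exist.

(** Invertible morphisms in both directions suffice: their composite is a nonzero scalar, one of
    them is rescaled, and the dotted parts of the composites vanish because both modules are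
    bricks. *)
Lemma bricks_rep_iso (k : closedFieldType) (I : finType) (D : diff_biquiver k I)
    n (nu : 'I_n.+1 -> I) (M N : rep k D) X Y (C : coords nu M X) (C' : coords nu N Y) :
  brick M -> brick N ->
  (exists g s, g \is a GRing.unit /\ mhom nu X Y g s) ->
  (exists g s, g \is a GRing.unit /\ mhom nu Y X g s) -> rep_iso M N.
Proof.
move=> /(brick_mat C) bX /(brick_mat C') bY [g [s [gu hg]]] [h [t [hu hh]]].
have hX := coords_shape C; have hY := coords_shape C'.
have [c cE _] := bX _ _ (mhom_comp hX hY hX hg hh).
have c0 : c != 0.
  have : h * g \is a GRing.unit by rewrite unitrMl.
  by rewrite cE; apply: contraTneq => ->; rewrite scale0r unitr0.
have [t' ht] := mhom_scale c^-1 hh.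
have [hgu _ _] := hg; have [hhu _ _] := ht.
pose S := unhom C C' g s; pose S' := unhom C' C (c^-1 *: h) t'.
have hS : is_hom S by exact: is_hom_unhom.
have hS' : is_hom S' by exact: is_hom_unhom.
have E : hmat C' C S' * hmat C C' S = 1.
  by rewrite !hmat_unhom // -scalerAl cE scalerA mulVf // scale1r.
have E' : hmat C C' S * hmat C' C S' = 1 := mulmx1C E.
exists S, S'; split=> //.
  apply/(is_scalar_mat C); rewrite (hmat_comp C C' C) E scale1r; split=> // v.
  rewrite (dmat_comp C C' C).
  have [] := bX _ _ (mhom_comp hX hY hX ((is_hom_mat C C' S).1 hS) ((is_hom_mat C' C S').1 hS')).
  by [].
apply/(is_scalar_mat C'); rewrite (hmat_comp C' C C') E' scale1r; split=> // v.
rewrite (dmat_comp C' C C').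
by have [] := bY _ _ (mhom_comp hY hX hY ((is_hom_mat C' C S').1 hS') ((is_hom_mat C C' S).1 hS)).
Qed.

(** * Families over k[t] *)

(** The one-dimensional module on which t acts as c. The parameter is kept in the type because each
    c gives another module structure on k. *)
Definition evmod_at (k : fieldType) (c : k) : Type := k.

Section EvaluationModule.
Variables (k : fieldType) (c : k).
Local Notation evmod := (evmod_at c).

HB.instance Definition _ := GRing.Zmodule.copy evmod k.

Definition evscale (r : {poly k}) (x : evmod) : evmod := r.[c] * (x : k).

Fact evscaleA a b x : evscale a (evscale b x) = evscale (a * b) x.
Proof. by rewrite /evscale hornerM mulrA. Qed.
Fact evscale1 : left_id 1 evscale.
Proof. by move=> x; rewrite /evscale hornerC mul1r. Qed.
Fact evscaleDr : right_distributive evscale +%R.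
Proof. by move=> r x y; apply: mulrDr. Qed.
Fact evscaleDl x : {morph evscale^~ x : a b / a + b}.
Proof. by move=> a b; rewrite /evscale hornerD mulrDl. Qed.
HB.instance Definition _ := GRing.Zmodule_isLmodule.Build {poly k} evmod
  evscaleA evscale1 evscaleDr evscaleDl.

Lemma evmod_scale (r : {poly k}) (x : evmod) : r *: x = r.[c] * (x : k) :> k.
Proof. by []. Qed.

Definition evquot (r : {poly k}^o) : evmod := r.[c].
Fact evquot_linear : linear evquot.
Proof. by move=> a x y; rewrite /evquot hornerD hornerM. Qed.
HB.instance Definition _ := GRing.isLinear.Build {poly k} {poly k}^o evmod _ evquot
  evquot_linear.

Lemma evmod_quotient : @is_quotient_at k (rational_kt k) c evmod.
Proof.
exists (evquot : {linear {poly k}^o -> evmod}); split=> [x|r].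
  by exists (x : k)%:P; rewrite /= /evquot hornerC.
have E : (ra_t (rational_kt k) - c%:A : {poly k}) = 'X - c%:P by rewrite alg_polyC.
rewrite E; split=> [r0|[s ->]]; last by rewrite /= /evquot !hornerE subrr mul0r.
have /factor_theorem[s ->] : root r c by apply/eqP.
by exists s; rewrite mulrC.
Qed.
End EvaluationModule.

Lemma quotient_kt (k : fieldType) (c : k) (L : lmodType {poly k}) :
  @is_quotient_at k (rational_kt k) c L ->
  exists q : {poly k} -> L, [/\ forall r, q r = r *: q 1, forall l, exists r, q r = l &
    forall r, q r = 0 <-> root r c].
Proof.
move=> [q [qs qk]]; exists q; split=> [r|//|r].
  have : q ((r : rational_kt k) *: (1 : (rational_kt k)^o)) = (r : rational_kt k) *: q 1.
    by rewrite linearZ.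
  by rewrite -[_ *: (1 : (rational_kt k)^o)]/((r : {poly k}) * 1) mulr1.
have E : (ra_t (rational_kt k) - c%:A : {poly k}) = 'X - c%:P by rewrite alg_polyC.
have {qk} := qk r; rewrite E => qk; split=> [/qk[s ->]|/factor_theorem[s rE]].
  by rewrite rootM root_XsubC eqxx.
by apply/qk; exists s; rewrite mulrC.
Qed.

Section AffineFamily.
Variables (k : closedFieldType) (I : finType) (D : diff_biquiver k I).
Variables (n : nat) (nu : 'I_n.+1 -> I).
Local Notation A := 'M[k]_n.+1.
Local Notation col := 'cV[k]_n.+1.
Variables P0 P1 : solid D -> A.

Definition affine_matrix (a : solid D) (p q : 'I_n.+1) : {poly k} :=
  (P0 a p q)%:P + (P1 a p q)%:P * 'X.

Definition affine_family : proj_functor D (rational_kt k) :=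
  free_functor nu affine_matrix.

Definition affine_at c (a : solid D) : A := P0 a + c *: P1 a.

Lemma quotient_scale c (L : lmodType {poly k}) : @is_quotient_at k (rational_kt k) c L ->
  exists (l0 : L) (f : L -> k), [/\ forall x, x = (f x)%:A *: l0,
    forall d x y, f (d%:A *: x + y) = d * f x + f y,
    forall d, f (d%:A *: l0) = d &
    forall r x, f (r *: x) = r.[c] * f x].
Proof.
move=> /quotient_kt[q [qZ qs qk]]; pose l0 := q 1.
have qE r : q r = r.[c]%:A *: l0.
  apply/eqP; rewrite qZ -subr_eq0 -scalerBl -qZ; apply/eqP/qk.
  by rewrite /root !hornerE ?mulr1 subrr.
have fex x : exists d : k, x == d%:A *: l0.
  by have [r <-] := qs x; exists r.[c]; rewrite qE.
pose f x := xchoose (fex x).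
have fE x : x = (f x)%:A *: l0 by apply/eqP; exact: xchooseP (fex x).
have inj d d' : d%:A *: l0 = d'%:A *: l0 -> d = d'.
  move=> E; have : q ((d - d')%:P : {poly k}) = 0.
    by rewrite qE hornerC scalerBl scalerBl E subrr.
  by move=> /qk; rewrite rootC subr_eq0 => /eqP.
exists l0, f; split=> // [d x y|d|r x].
- apply: inj; rewrite -fE {1}[x]fE {1}[y]fE scalerA -scalerDl; congr (_ *: _).
  by rewrite !alg_polyC -polyCM -polyCD.
- by apply: inj; rewrite -fE.
- apply: inj; rewrite -fE {1}[x]fE scalerA alg_polyC.
  by rewrite -qZ qE !hornerE.
Qed.

Hypotheses (h0 : solid_shape nu P0) (h1 : solid_shape nu P1).

Lemma affine_at_shape c : solid_shape nu (affine_at c).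
Proof. by move=> a; apply: in_blockD => //; apply: in_blockZ. Qed.

Lemma affine_matrixE c a p q : (affine_matrix a p q).[c] = affine_at c a p q.
Proof. by rewrite /affine_matrix /affine_at !hornerE !mxE mulrC. Qed.

Lemma affine_at_out c a p q : (nu p != stgt a) || (nu q != ssrc a) -> affine_at c a p q = 0.
Proof.
by rewrite -(affine_at_shape c a) bprojMr bprojMl => /orP[/negbTE ->|/negbTE ->];
  rewrite /= ?mul0r ?mulr0.
Qed.

Lemma specialization_coords c (M : rep k D) : is_specialization affine_family c M ->
  inhabited (coords nu M (affine_at c)).
Proof.
move=> [L /quotient_scale[l0 [f [fE fL f0 fZ]]] /induced_frame[j [pi fr]]].
have f1 : f l0 = 1 by rewrite -[RHS]f0 !scale1r.
have fD x y : f (x + y) = f x + f y by have := fL 1 x y; rewrite mul1r !scale1r.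
have f00 : f 0 = 0 by apply: (addIr (f 0)); rewrite add0r -fD addr0.
have f_sum (J : finType) (F : J -> L) : f (\sum_i F i) = \sum_i f (F i).
  exact: (big_morph f fD f00).
have fA d x : f (d%:A *: x) = d * f x by have := fL d x 0; rewrite f00 !addr0.
pose cin0 l (v : col) : M l := \sum_q v q 0 *: j l q l0.
pose cout0 l (y : M l) : col := \col_q f (pi l q y).
have lin1 l : linear (cin0 l).
  move=> d x y; rewrite /cin0 scaler_sumr -big_split; apply: eq_bigr => p _ /=.
  by rewrite !mxE scalerDl scalerA.
have lin2 l : linear (cout0 l).
  by move=> d x y; apply/colP => q; rewrite !mxE (frame_proj fr) fL.
have [ci ciE] := fin_all_exists (fun l => lfun_of_linear (lin1 l)).
have [co coE] := fin_all_exists (fun l => lfun_of_linear (lin2 l)).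
have fpi l p (J : finType) (v : J -> k) (y : J -> M l) :
    f (pi l p (\sum_i v i *: y i)) = \sum_i v i * f (pi l p (y i)).
  rewrite (frame_proj_sum fr) f_sum; apply: eq_bigr => i _.
  by rewrite (frame_projZ fr) fA.
split; refine (@Coords k I D n nu M _ ci co _ _ _) => [l y|l v|a v].
- rewrite ciE /cin0 -[RHS](frame_sum fr); apply: eq_bigr => q _.
  by rewrite coE mxE -(frame_injZ fr) -fE.
- apply/colP => p; rewrite [bproj _ _ _ *m v]/(_ *m _) coE mxE ciE fpi mxE.
  apply: eq_bigr => q _; rewrite mxE (frame_orth fr) mulrC.
  by case: (eqVneq p q) => [->|_] /=; last rewrite f00 !mul0r; case: (nu q == l); rewrite ?f00 ?f1 ?mul0r ?mulr0 ?mul1r ?mulr1.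
- apply/colP => p; rewrite coE mxE ciE linear_sum.
  under eq_bigr => q _ do rewrite linearZ /=.
  rewrite fpi mxE; apply: eq_bigr => q _; rewrite mulrC (frame_map_gen fr).
  case: eqP => [qa|/eqP nq]; last first.
    by rewrite (frame_proj0 fr) f00 affine_at_out ?mul0r // nq orbT.
  congr (_ * _); rewrite (frame_proj_sum fr) (bigD1 p) //= big1 ?addr0 => [|p' np]; last first.
    by rewrite (frame_orth fr) eq_sym (negbTE np).
  rewrite (frame_orth fr) eqxx /=; case: eqP => [_|/eqP np].
    by rewrite fZ f1 mulr1 affine_matrixE.
  by rewrite f00 affine_at_out // np.
Qed.

Lemma coords_specialization c (M : rep k D) : coords nu M (affine_at c) ->
  is_specialization affine_family c M.
Proof.
move=> C; exists (evmod_at c : lmodType {poly k}); first exact: evmod_quotient.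
pose j l q (x : evmod_at c) : M l := cin C l ((x : k) *: delta_mx q 0).
pose pi l q (y : M l) : evmod_at c := cout C l y q 0.
suff fr : @frame k I D {poly k} _ nu affine_matrix (evmod_at c) M j pi by apply: frame_induced fr.
have cA d (x : evmod_at c) : (d%:A : {poly k}) *: x = d * (x : k) :> k.
  by rewrite evmod_scale alg_polyC hornerC.
split=> [l q d x y|l q d x y|l p q x|l y|a q x qa].
- have E : ((d%:A : {poly k}) *: x + y : evmod_at c) = d * (x : k) + (y : k) :> k by rewrite -cA.
  by rewrite /j E scalerDl -scalerA linearP.
- by rewrite /pi linearP !mxE cA.
- rewrite /pi /j coutK -scalemxAr -colE !mxE.
  case: (eqVneq p q) => [->|_] /=; last by rewrite mulr0.
  by case: (nu q == l); rewrite ?mulr1 ?mulr0.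
- rewrite /j /pi -linear_sum -[RHS](cinK C); congr (cin C l _).
  rewrite [RHS]matrix_sum_delta; apply: eq_bigr => q _.
  by rewrite big_ord1.
- rewrite -[LHS](cinK C) cmap /j -linear_sum; congr (cin C _ _).
  apply/colP => p; rewrite -scalemxAr -colE !mxE summxE (bigD1 p) //= big1 ?addr0 => [|p' np].
    by rewrite evmod_scale affine_matrixE !mxE !eqxx mulr1 mulrC.
  by rewrite !mxE eq_sym (negbTE np) mulr0.
Qed.
End AffineFamily.

Lemma coords_eq (k : closedFieldType) (I : finType) (D : diff_biquiver k I) n
    (nu : 'I_n.+1 -> I) (M : rep k D) X Y : X =1 Y -> coords nu M X -> coords nu M Y.
Proof.
move=> XY C; refine (@Coords k I D n nu M Y (cin C) (cout C) (cinK C) (coutK C) _) => a c.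
by rewrite cmap XY.
Qed.

Lemma brick_family_kt (k : closedFieldType) (I : finType) (D : diff_biquiver k I)
    (d : I -> nat) : BT_box D -> (exists M : rep k D, brick M /\ dimvec M =1 d) ->
  exists F : proj_functor D (rational_kt k), brick_family F /\
    forall M : rep k D, brick M -> dimvec M =1 d -> belongs_to F M.
Proof.
move=> [_ [al [tld [al_loop tld_inj tld_dual dif_al]]]] [M1 [b1 d1]].
have d0 : (0 < \sum_i d i)%N.
  case: posnP => // /eqP; rewrite sum_nat_eq0 => /forallP h.
  by case: b1.1 => i; rewrite d1; apply/eqP/(implyP (h i)).
have [n [nu nuE]] := fibres_exist d0.
have dimE (M : rep k D) : dimvec M =1 d -> forall i, dimvec M i = fdim nu i.
  by move=> dM i; rewrite nuE dM.
have [X [C1]] := coords_exist (dimE _ d1).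
have bX := (brick_mat C1).1 b1; have hX := coords_shape C1.
have [E [E1 E2 E3]] := matrix_brick_family al_loop tld_inj tld_dual dif_al hX bX.
set a1 := \sum_i _ in E1 E2 E3.
(* The family is affine in t: only the loops move, in the direction of the diagonal blocks of E. *)
pose P0 := with_loops nu al X a1; pose P1 := with_loops nu al (fun=> 0) E.
have PE c : affine_at P0 P1 c =1 with_loops nu al X (a1 + c *: E).
  move=> a; rewrite /affine_at /P0 /P1 /with_loops; case: pickP => [i _|_].
    by rewrite mulrDr mulrDl -scalerAr -scalerAl.
  by rewrite scaler0 addr0.
have h0 : solid_shape nu P0 by exact: with_loops_shape.
have h1 : solid_shape nu P1.
  by apply: with_loops_shape => // a; exact: in_block0.
exists (affine_family nu P0 P1); split; first split.
- move=> c M _ /(specialization_coords h0 h1)[/(coords_eq (PE c)) C].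
  exact/(brick_mat C).
- move=> c c' M M' _ _ /(specialization_coords h0 h1)[/(coords_eq (PE c)) C].
  move=> /(specialization_coords h0 h1)[/(coords_eq (PE c')) C'] /(rep_iso_mat C C').
  by move=> [g [s [gu h]]]; exact: E2 gu h.
move=> M bM dM; have [Y [C]] := coords_exist (dimE _ dM).
have [c [hMN hNM]] := E3 Y (coords_shape C) ((brick_mat C).1 bM).
(* The member of the family is realized on the spaces of M, with the matrices at parameter c. *)
have [N [[CN] _]] := coords_rep C (affine_at_shape h0 h1 c).
exists c, N; have CN' := coords_eq (PE c) CN; split; first by rewrite hornerC oner_neq0.
  exact: coords_specialization CN.
by apply: (bricks_rep_iso C CN') => //; apply/(brick_mat CN').
Qed.

(** No exceptional bricks occur: for each d there is one family or none. *)
Lemma brick_tame_BT (k : closedFieldType) (I : finType) (D : diff_biquiver k I) :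
  BT_box D -> brick_tame D.
Proof.
move=> hD d; have z (P : 'I_0 -> Type) : forall s, P s by case.
have [/(brick_family_kt hD)[F [F1 F2]]|nM] :=
    classic (exists M : rep k D, brick M /\ dimvec M =1 d).
  exists 1%N, (fun=> rational_kt k), (fun=> F), 0%N, (z _).
  by split=> [_ //|M bM dM]; left; exists ord0; apply: F2.
exists 0%N, (fun=> rational_kt k), (z _), 0%N, (z _).
by split=> [[] //|M bM dM]; case: nM; exists M.
Qed.

(** * A criterion for wildness *)

Definition fixpt (La : pzRingType) (L : lmodType La) (f : L -> L) := fun x => f x == x.

Section Idempotent.
Variables (La : pzRingType) (L : lmodType La) (f : {linear L -> L}).

Fact fixpt_closed : submod_closed (fixpt f).
Proof.
split=> [|a x y]; rewrite !unfold_in /fixpt ?linear0 // => /eqP fx /eqP fy.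
by rewrite linearP fx fy.
Qed.
HB.instance Definition _ := GRing.isSubmodClosed.Build La L (fixpt f) fixpt_closed.

Record fixmod := Fixmod { fixval :> L; fixvalP : fixpt f fixval }.
HB.instance Definition _ := [isSub for fixval].
HB.instance Definition _ := [Choice of fixmod by <:].
HB.instance Definition _ := [SubChoice_isSubZmodule of fixmod by <:].
HB.instance Definition _ := [SubZmodule_isSubLmodule of fixmod by <:].
End Idempotent.

Lemma idempotent_split (k : fieldType) (La : algType k) (L : lmodType La)
    (f f2 : {linear L -> L}) : (forall x, f (f x) = f x) -> (forall x, f x + f2 x = x) ->
  mod_iso L (fixmod f * fixmod f2)%type.
Proof.
move=> ff fD; have ff2 x : f (f2 x) = 0.
  by apply: (addrI (f (f x))); rewrite -linearD fD addr0 ff.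
have f2f x : f2 (f x) = 0 by apply: (addrI (f (f x))); rewrite fD addr0 ff.
have f22 x : f2 (f2 x) = f2 x by have := fD (f2 x); rewrite ff2 add0r.
have p1 x : fixpt f (f x) by apply/eqP.
have p2 x : fixpt f2 (f2 x) by apply/eqP.
pose phi x : fixmod f * fixmod f2 := (Fixmod (p1 x), Fixmod (p2 x)).
have lin : linear phi by move=> a x y; congr (_, _); apply: val_inj; rewrite /= linearP.
pose g : {linear L -> (fixmod f * fixmod f2)%type} :=
  HB.pack phi (GRing.isLinear.Build La L (fixmod f * fixmod f2)%type _ phi lin).
exists g, (fun u => fixval u.1 + fixval u.2) => [x|[u v]]; first exact: fD.
have fu : f (fixval u) = fixval u by apply/eqP; exact: fixvalP.
have fv : f2 (fixval v) = fixval v by apply/eqP; exact: fixvalP.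
congr (_, _); apply: val_inj; rewrite /= linearD.
  by rewrite fu -fv ff2 addr0.
by rewrite fv -fu f2f add0r.
Qed.

Section RepCategory.
Variables (k : closedFieldType) (I : finType) (D : diff_biquiver k I).
Implicit Types M N : rep k D.

Lemma ev1_0 M N (S : hom_data M N) j i (p : qpath D j i) :
  (forall v, hdot S v = 0) -> ev1 S p = 0.
Proof.
move=> S0; elim: p => [|a p IHp|v p _] //=; first by rewrite IHp comp_lfun0r.
by rewrite S0 comp_lfun0l.
Qed.

Lemma is_hom_pure M N (S : hom_data M N) : (forall v, hdot S v = 0) ->
  (forall a, (hob S (stgt a) \o rep_map M a)%VF = (rep_map N a \o hob S (ssrc a))%VF) ->
  is_hom S.
Proof.
move=> S0 h a; rewrite h subrr /klift big1 // => p _.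
by rewrite ev1_0 // scaler0.
Qed.

Lemma hcompK M N (S : hom_data M N) (S' : hom_data N M) :
  is_scalar 1 (hcomp S' S) -> forall i y, hob S' i (hob S i y) = y.
Proof. by move=> [h _] i y; have /lfunP/(_ y) := h i; rewrite /= comp_lfunE scale1r id_lfunE. Qed.

Lemma iso_dim M N (S : hom_data M N) (S' : hom_data N M) :
  is_scalar 1 (hcomp S' S) -> is_scalar 1 (hcomp S S') -> dimvec M =1 dimvec N.
Proof.
move=> [h _] [h' _] i; have := h i; have := h' i; rewrite /= !scale1r => E' E.
have k0 : (lker (hob S i) == 0)%VS.
  by apply/lker0P; apply: (can_inj (g := hob S' i)) => x; rewrite -comp_lfunE E id_lfunE.
have k0' : (lker (hob S' i) == 0)%VS.
  by apply/lker0P; apply: (can_inj (g := hob S i)) => x; rewrite -comp_lfunE E' id_lfunE.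
have d := limg_dim_eq (f := hob S i) (U := fullv).
have d' := limg_dim_eq (f := hob S' i) (U := fullv).
rewrite (eqP k0) capv0 in d; rewrite (eqP k0') capv0 in d'.
apply/eqP; rewrite eqn_leq /dimvec -{1}(d erefl) -{2}(d' erefl).
by rewrite !dimvS ?subvf.
Qed.

(** Reduced to [mhom_comp]; equal dimension vectors let one grading nu serve all three modules,
    which covers composites along isomorphisms. *)
Lemma is_hom_comp M N L (S' : hom_data N L) (S : hom_data M N) :
  ~ rep_zero M -> dimvec M =1 dimvec N -> dimvec N =1 dimvec L ->
  is_hom S' -> is_hom S -> is_hom (hcomp S' S).
Proof.
move=> M0 dMN dNL hS' hS; have d0 : (0 < \sum_i dimvec M i)%N.
  case: posnP => // /eqP; rewrite sum_nat_eq0 => /forallP h.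
  by case: M0 => i; apply/eqP/(implyP (h i)).
have [n [nu nuE]] := fibres_exist d0.
have [X [C]] : exists X, inhabited (coords nu M X) by apply: coords_exist.
have [Y [C']] : exists X, inhabited (coords nu N X).
  by apply: coords_exist => i; rewrite nuE dMN.
have [Z [C'']] : exists X, inhabited (coords nu L X).
  by apply: coords_exist => i; rewrite nuE dMN dNL.
apply/(is_hom_mat C C''); rewrite (hmat_comp C C' C'').
have h := mhom_comp (coords_shape C) (coords_shape C') (coords_shape C'')
  ((is_hom_mat C C' S).1 hS) ((is_hom_mat C' C'' S').1 hS').
have [h1 h2 h3] := h; split=> [//|v|a _]; first exact: mat_block.
rewrite h3 //; apply: eq_wlift; elim=> [|[b|v] w IHw] //=; first by rewrite IHw.
by rewrite (dmat_comp C C' C'').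
Qed.

Definition diag_fun (V W : vectType k) (c d : k) (z : (V * W)%type) : (V * W)%type :=
  (c *: z.1, d *: z.2).

Fact diag_fun_linear (V W : vectType k) c d : linear (@diag_fun V W c d).
Proof.
by move=> a x y; congr (_, _); rewrite /= scalerDr !scalerA mulrC.
Qed.

Lemma rep_sum_mapE M N a z :
  rep_map (rep_sum M N) a z = (rep_map M a z.1, rep_map N a z.2).
Proof.
pose f (z : (M (ssrc a) * N (ssrc a))%type) : (M (stgt a) * N (stgt a))%type :=
  (rep_map M a z.1, rep_map N a z.2).
have lin : linear f by move=> c x y; congr (_, _); rewrite linearP.
pose g : {linear (M (ssrc a) * N (ssrc a))%type -> (M (stgt a) * N (stgt a))%type} :=
  HB.pack f (GRing.isLinear.Build k _ _ _ f lin).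
exact: (lfunE g).
Qed.

Lemma diag_sum_exists M N c d : exists S : hom_data (rep_sum M N) (rep_sum M N),
  is_hom S /\ forall i z, hob S i z = (c *: z.1, d *: z.2).
Proof.
have H i : exists f : 'End((M i * N i)%type), forall z, f z = (c *: z.1, d *: z.2).
  by apply: lfun_of_linear; exact: diag_fun_linear.
have [f fE] := fin_all_exists H.
exists (@HomData k I D (rep_sum M N) (rep_sum M N) f (fun=> 0)); split=> //.
apply: is_hom_pure => // a; apply/lfunP => z; rewrite !comp_lfunE /=.
by rewrite fE !rep_sum_mapE fE /= !linearZ.
Qed.
End RepCategory.

(** * Modules with triangular morphisms *)

Section Criterion.
Variables (k : closedFieldType) (I : finType) (D : diff_biquiver k I) (La : algType k).
Variables (gens : seq La) (Q0 : finType) (nu : Q0 -> I) (G : solid D -> Q0 -> Q0 -> La).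
Variables (rk : Q0 -> nat) (w0 : Q0).
Hypothesis gensP : forall P : La -> Prop, (forall x, x \in gens -> P x) -> P 1 ->
  (forall c x y, P x -> P y -> P (c *: x + y)) ->
  (forall x y, P x -> P y -> P (x * y)) -> forall x, P x.

Definition entry (L L' : lmodType La) (N N' : rep k D) (j : forall l, Q0 -> L -> N l)
    (pi' : forall l, Q0 -> N' l -> L') (S : hom_data N N') (p q : Q0) (x : L) : L' :=
  pi' (nu q) p (hob S (nu q) (j (nu q) q x)).

(** Entries between different vertices vanish anyway ([entry_out]). The common diagonal map commutes
    with the generators, hence is La-linear by [entry_linear]: it recovers a map between the
    La-modules from a morphism of the induced modules. *)
Definition unitriangular : Prop := forall (L L' : lmodType La) (N N' : rep k D) j pi j' pi',
  @frame _ _ _ _ _ nu G L N j pi -> @frame _ _ _ _ _ nu G L' N' j' pi' ->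
  forall S : hom_data N N', is_hom S ->
  [/\ forall p q x, nu p = nu q -> p != q -> (rk p <= rk q)%N -> entry j pi' S p q x = 0,
      forall p x, entry j pi' S p p x = entry j pi' S w0 w0 x &
      forall g x, g \in gens -> entry j pi' S w0 w0 (g *: x) = g *: entry j pi' S w0 w0 x].
Hypothesis uni : unitriangular.

Section Entries.
Variables (L L' : lmodType La) (N N' : rep k D).
Variables (j : forall l, Q0 -> L -> N l) (pi : forall l, Q0 -> N l -> L).
Variables (j' : forall l, Q0 -> L' -> N' l) (pi' : forall l, Q0 -> N' l -> L').
Arguments j {l}.
Arguments pi {l}.
Arguments j' {l}.
Arguments pi' {l}.
Hypothesis fr : frame nu G (@j) (@pi).
Hypothesis fr' : frame nu G (@j') (@pi').
Local Notation entry := (entry (@j) (@pi')).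

Lemma entry_at (S : hom_data N N') l p q x : nu q = l ->
  pi' p (hob S l (j q x)) = entry S p q x.
Proof. by move=> <-. Qed.

Lemma entry_lin (S : hom_data N N') p q c x y :
  entry S p q (c%:A *: x + y) = c%:A *: entry S p q x + entry S p q y.
Proof. by rewrite /entry (frame_inj fr) linearP (frame_proj fr'). Qed.

Lemma entryD S p q x y : entry S p q (x + y) = entry S p q x + entry S p q y.
Proof. by have := entry_lin S p q 1 x y; rewrite !scale1r. Qed.

Lemma entry0 S p q : entry S p q 0 = 0.
Proof. by apply: (addIr (entry S p q 0)); rewrite add0r -entryD addr0. Qed.

Lemma entry_out S p q x : nu p != nu q -> entry S p q x = 0.
Proof. by move=> pq; rewrite /entry (frame_proj_out fr'). Qed.

Lemma entry_linear (S : hom_data N N') : is_hom S ->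
  exists w : {linear L -> L'}, forall x, w x = entry S w0 w0 x.
Proof.
move=> hS; have [_ _ hg] := uni fr fr' hS.
have comm g : forall x, entry S w0 w0 (g *: x) = g *: entry S w0 w0 x.
  elim/gensP: g => [g gg x|x|c g h IHg IHh x|g h IHg IHh x].
  - exact: hg.
  - by rewrite !scale1r.
  - have cE : c *: g = c%:A * g by rewrite -scalerAl mul1r.
    rewrite cE !scalerDl entryD IHh -!scalerA; congr (_ + _).
    by have := entry_lin S w0 w0 c (g *: x) 0; rewrite entry0 !addr0 IHg.
  - by rewrite -!scalerA IHg IHh.
have lin : linear (entry S w0 w0) by move=> g x y; rewrite entryD comm.
pose w : {linear L -> L'} := HB.pack (entry S w0 w0) (GRing.isLinear.Build La L L' _ _ lin).
by exists w.
Qed.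

Lemma entry_sum (S : hom_data N N') q x :
  hob S (nu q) (j q x) = \sum_p j' p (entry S p q x).
Proof. by rewrite -[LHS](frame_sum fr'). Qed.
End Entries.

Section Induced.
Variables (L L' : lmodType La) (N N' : rep k D).
Variables (j : forall l, Q0 -> L -> N l) (pi : forall l, Q0 -> N l -> L).
Variables (j' : forall l, Q0 -> L' -> N' l) (pi' : forall l, Q0 -> N' l -> L').
Hypothesis fr : frame nu G j pi.
Hypothesis fr' : frame nu G j' pi'.
Arguments pi : clear implicits.

(** A middle index p other than w0 would need rk p > rk w0 for S and rk w0 > rk p for S'. *)
Lemma entry_mul (S : hom_data N N') (S' : hom_data N' N) x : is_hom S -> is_hom S' ->
  pi _ w0 (hob S' (nu w0) (hob S (nu w0) (j (nu w0) w0 x))) =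
  entry j' pi S' w0 w0 (entry j pi' S w0 w0 x).
Proof.
move=> hS hS'; have [t1 _ _] := uni fr fr' hS; have [t1' _ _] := uni fr' fr hS'.
rewrite (entry_sum j fr') linear_sum (frame_proj_sum fr) (bigD1 w0) //= big1 ?addr0 // => p pw.
have [pn|pn] := eqVneq (nu p) (nu w0); last first.
  by rewrite (frame_inj_out fr') // linear0 (frame_proj0 fr).
have [rkp|rkp] := leqP (rk p) (rk w0).
  by rewrite t1 // (frame_inj0 fr') linear0 (frame_proj0 fr).
by rewrite (entry_at _ _ _ _ _ pn) t1' ?(ltnW rkp) // eq_sym.
Qed.
End Induced.

Lemma induced_iso (L L' : lmodType La) (N N' : rep k D) :
  is_induced (free_functor nu G) L N -> is_induced (free_functor nu G) L' N' ->
  rep_iso N N' -> mod_iso L L'.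
Proof.
move=> /induced_frame[j [pi fr]] /induced_frame[j' [pi' fr']] [S [S' [hS hS' E E']]].
have [w wE] := entry_linear fr fr' hS; have [w' wE'] := entry_linear fr' fr hS'.
exists w, w' => x; rewrite wE wE'.
  rewrite -(entry_mul fr fr') // (hcompK E).
  by rewrite (frame_proj_inj fr).
rewrite -(entry_mul fr' fr) // (hcompK E').
by rewrite (frame_proj_inj fr').
Qed.

(** With zero diagonal, S = S S is strictly triangular at the vertex l. Each expansion of S S raises
    by one the rank gap up to which all entries vanish. *)
Lemma strict_idempotent (L : lmodType La) (N : rep k D) j pi (S : hom_data N N) l :
  frame nu G (L := L) (N := N) j pi -> is_hom S ->
  (forall x, entry j pi S w0 w0 x = 0) -> (forall y, hob S l (hob S l y) = hob S l y) ->
  hob S l = 0.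
Proof.
move=> fr hS S0 SS; have [t1 t2 _] := uni fr fr hS.
have e0 n p q x : nu q = l -> (rk p <= rk q + n)%N -> entry j pi S p q x = 0.
  move=> ql; elim: n p q x ql => [|n IHn] p q x ql.
    rewrite addn0 => rpq; have [pq|pq] := eqVneq (nu p) (nu q); last exact: (entry_out j fr).
    by have [->|npq] := eqVneq p q; [rewrite t2 S0 | rewrite t1].
  move=> rpq; rewrite /entry ql -SS -ql (entry_sum j fr) linear_sum (frame_proj_sum fr) big1 // => r _.
  have [rn|rn] := eqVneq (nu r) (nu q); last first.
    by rewrite (frame_inj_out fr) // linear0 (frame_proj0 fr).
  rewrite -rn -[LHS]/(entry j pi S p r _).
  have [rr|rr] := leqP (rk r) (rk q).
    have [->|nrq] := eqVneq r q; first by rewrite t2 S0 (entry0 fr fr).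
    by rewrite (t1 r q) // (entry0 fr fr).
  by apply: IHn; [rewrite rn | apply: leq_trans rpq _; rewrite addnS -addSn leq_add2r].
apply/lfunP => y; rewrite zero_lfunE -[y](frame_sum fr) linear_sum big1 // => q _.
have [ql|ql] := eqVneq (nu q) l; last by rewrite (frame_inj_out fr) // linear0.
move: (pi l q y) => x; rewrite -ql /= (entry_sum j fr) big1 // => p _.
by rewrite (e0 (rk p) p q) ?(frame_inj0 fr) // leq_addl.
Qed.

(** A decomposition of N gives complementary idempotents whose entries at w0 are complementary
    idempotents of L. One of the latter is zero, so the corresponding idempotent of N is strictly
    triangular, hence zero, and its summand is zero. *)
Lemma induced_indecomposable (L : lmodType La) (N : rep k D) :
  mod_indecomposable L -> is_induced (free_functor nu G) L N -> rep_indecomposable N.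
Proof.
move=> [L0 Lind] /induced_frame[j [pi fr]].
have N0 : ~ rep_zero N.
  move=> N0; apply: L0 => x; rewrite -(frame_proj_inj fr x (erefl (nu w0))).
  have /eqP := N0 (nu w0); rewrite /dimvec dimv_eq0 => /eqP E.
  have -> : j (nu w0) w0 x = 0 by apply/eqP; rewrite -memv0 -E memvf.
  exact: (frame_proj0 fr).
split=> // M1 M2 [T [T' [hT hT' E E']]].
have dT := iso_dim E E'.
have TK := hcompK E.
have TK' := hcompK E'.
have endo c d : exists2 S : hom_data N N, is_hom S &
    forall l y, hob S l y = hob T' l (c *: (hob T l y).1, d *: (hob T l y).2).
  have [R [hR RE]] := diag_sum_exists M1 M2 c d.
  exists (hcomp T' (hcomp R T)); last by move=> l y; rewrite !comp_lfunE RE.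
  exact: (is_hom_comp N0 dT (fsym dT) hT' (is_hom_comp N0 dT (frefl _) hR hT)).
have [S1 h1 S1E] := endo 1 0; have [S2 h2 S2E] := endo 0 1.
have [f fE] := entry_linear fr fr h1; have [g gE] := entry_linear fr fr h2.
have S11 l y : hob S1 l (hob S1 l y) = hob S1 l y.
  by rewrite !S1E TK' /= !scale0r !scale1r.
have S22 l y : hob S2 l (hob S2 l y) = hob S2 l y.
  by rewrite !S2E TK' /= !scale0r !scale1r.
have S12 l y : hob S1 l y + hob S2 l y = y.
  rewrite S1E S2E -linearD -[RHS]TK; congr (hob T' l _); case: (hob T l y) => u v.
  by congr (_, _); rewrite /= !scale0r scale1r ?addr0 ?add0r.
have ff x : f (f x) = f x.
  by rewrite !fE -(entry_mul fr fr) // S11.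
have fg x : f x + g x = x.
  by rewrite fE gE /entry -(frame_projD fr) S12 (frame_proj_inj fr).
have zero (S : hom_data N N) (u : {linear L -> L}) : is_hom S ->
    (forall l y, hob S l (hob S l y) = hob S l y) ->
    (forall x, u x = entry j pi S w0 w0 x) -> (forall x, u (u x) = u x) ->
    mod_zero (fixmod u) -> forall l, hob S l = 0.
  move=> hS SS uE uu u0 l; apply: (strict_idempotent fr) => // x.
  have fx : fixpt u (u x) by apply/eqP.
  by rewrite -uE -[u x]/(fixval (Fixmod fx)) (u0 (Fixmod fx)).
have gg x : g (g x) = g x by rewrite !gE -(entry_mul fr fr) // S22.
have dim0 (V : vectType k) : (forall y : V, y = 0) -> \dim {:V} = 0%N.
  move=> V0; apply/eqP; rewrite dimv_eq0; apply/eqP/vspaceP => y.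
  by rewrite memvf (V0 y) mem0v.
have [u0|u0] := Lind _ _ (idempotent_split ff fg); [left|right] => l; apply: dim0 => y.
- have := S1E l (hob T' l (y, 0)); rewrite (zero S1 f h1) // zero_lfunE TK' /= scale0r scale1r.
  by move=> /esym/(congr1 (hob T l)); rewrite TK' linear0 => /(congr1 fst).
- have := S2E l (hob T' l (0, y)); rewrite (zero S2 g h2) // zero_lfunE TK' /= scale0r scale1r.
  by move=> /esym/(congr1 (hob T l)); rewrite TK' linear0 => /(congr1 snd).
Qed.
End Criterion.

Section EntryEquations.
Variables (k : closedFieldType) (I : finType) (D : diff_biquiver k I) (La : algType k).
Variables (Q0 : finType) (nu : Q0 -> I) (G : solid D -> Q0 -> Q0 -> La).
Hypothesis G_shape : forall a p q, (nu p != stgt a) || (nu q != ssrc a) -> G a p q = 0.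
Variables (L L' : lmodType La) (N N' : rep k D).
Variables (j : forall l, Q0 -> L -> N l) (pi : forall l, Q0 -> N l -> L).
Variables (j' : forall l, Q0 -> L' -> N' l) (pi' : forall l, Q0 -> N' l -> L').
Hypothesis fr : frame nu G j pi.
Hypothesis fr' : frame nu G j' pi'.
Arguments j l : clear implicits.
Arguments pi' l : clear implicits.
Variable S : hom_data N N'.
Local Notation entry := (entry nu j pi' S).

Definition dentry (v : dotted D) (p q : Q0) (x : L) : L' :=
  pi' (dtgt v) p (hdot S v (j (dsrc v) q x)).

Lemma dentry0 v p q : dentry v p q 0 = 0.
Proof. by rewrite /dentry (frame_inj0 fr) linear0 (frame_proj0 fr'). Qed.

Fixpoint word0 (w : seq (solid D + dotted D)) (p q : Q0) : La :=
  match w with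
  | [::] => (p == q)%:R
  | inl a :: w' => \sum_r G a p r * word0 w' r q
  | inr _ :: _ => 0
  end.

Fixpoint word1 (w : seq (solid D + dotted D)) (p q : Q0) (x : L) : L' :=
  match w with
  | [::] => 0
  | inl a :: w' => \sum_r G a p r *: word1 w' r q x
  | inr v :: w' => \sum_r dentry v p r (word0 w' r q *: x)
  end.

Lemma sum_delta (V : lmodType La) (W : nmodType) (f : Q0 -> V -> W) q x :
  (forall p, f p 0 = 0) -> \sum_p f p ((p == q)%:R *: x) = f q x.
Proof.
move=> f0; rewrite (bigD1 q) //= eqxx scale1r big1 ?addr0 // => p /negbTE ->.
by rewrite scale0r.
Qed.

Lemma ev0_frame s t (w : qpath D s t) q x : nu q = s ->
  ev0 N w (j s q x) = \sum_p j t p (word0 (qword w) p q *: x).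
Proof.
move=> qs; elim: w => [|a w IHw|v w _] /=.
- rewrite id_lfunE (sum_delta (f := fun p y => j s p y)) // => p.
  exact: (frame_inj0 fr).
- rewrite comp_lfunE IHw linear_sum /=.
  under eq_bigr => p _ do rewrite (frame_map_gen fr).
  rewrite (eq_bigr (fun p => \sum_r j (stgt a) r (G a r p *: (word0 (qword w) p q *: x)))).
    rewrite exchange_big; apply: eq_bigr => p _; rewrite -(frame_inj_sum fr) scaler_suml.
    by congr (j _ _ _); apply: eq_bigr => r _; rewrite scalerA.
  move=> p _; case: eqP => // /eqP np; rewrite big1 // => r _.
  by rewrite G_shape ?np ?orbT // scale0r (frame_inj0 fr).
- by rewrite zero_lfunE big1 // => p _; rewrite scale0r (frame_inj0 fr).
Qed.

Lemma frame_proj_map a p y :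
  pi' (stgt a) p (rep_map N' a y) = \sum_r G a p r *: pi' (ssrc a) r y.
Proof.
rewrite -{1}[y](frame_sum fr') linear_sum /= (frame_proj_sum fr').
apply: eq_bigr => r _; rewrite (frame_map_gen fr'); case: eqP => [nr|/eqP nr]; last first.
  by rewrite (frame_proj0 fr') G_shape ?nr ?orbT // scale0r.
rewrite (frame_proj_sum fr') (bigD1 p) //= big1 ?addr0 => [|p' np]; last first.
  by rewrite (frame_orth fr') eq_sym (negbTE np).
rewrite (frame_orth fr') eqxx /=; case: eqP => // /eqP np.
by rewrite G_shape ?np // scale0r.
Qed.

Lemma ev1_frame s t (w : qpath D s t) p q x : nu q = s ->
  pi' t p (ev1 S w (j s q x)) = word1 (qword w) p q x.
Proof.
move=> qs; elim: w p => [|a w IHw|v w _] p /=.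
- by rewrite zero_lfunE (frame_proj0 fr').
- by rewrite comp_lfunE frame_proj_map; apply: eq_bigr => r _; rewrite IHw.
- rewrite comp_lfunE ev0_frame // linear_sum /= (frame_proj_sum fr').
  by apply: eq_bigr.
Qed.

Lemma klift_ev1_frame s t (z : {malg k[qpath D s t]}) p q x : nu q = s ->
  pi' t p (klift (fun w => ev1 S w) z (j s q x)) =
  wlift (fun w => word1 w p q x : kres L') z.
Proof.
move=> qs; pose f (g : 'Hom(N s, N' t)) : kres L' := pi' t p (g (j s q x)).
have lin : linear f.
  by move=> c g h; rewrite /f add_lfunE scale_lfunE (frame_proj fr').
pose fl : {linear 'Hom(N s, N' t) -> kres L'} := HB.pack f (GRing.isLinear.Build k _ _ _ f lin).
rewrite -[LHS]/(fl _) klift_lfun.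
apply: (@eq_klift k I D (kres L')) => w _; exact: ev1_frame.
Qed.

Lemma entry_hom a p q x : is_hom S -> nu q = ssrc a ->
  \sum_r entry p r (G a r q *: x) - \sum_r G a p r *: entry r q x =
  wlift (fun w => word1 w p q x : kres L') (dsolid a).
Proof.
move=> hS qa; rewrite -klift_ev1_frame // -hS.
have piB l (y z : N' l) : pi' l p (y - z) = pi' l p y - pi' l p z.
  by have := frame_proj fr' p (-1) z y; rewrite !scaleN1r addrC => ->; rewrite addrC.
rewrite add_lfunE opp_lfunE !comp_lfunE piB; congr (_ - _); last first.
  rewrite frame_proj_map; apply: eq_bigr => r _; congr (_ *: _).
  by rewrite -(entry_at j pi' S _ _ qa).
rewrite (frame_map fr) // linear_sum (frame_proj_sum fr').
apply: eq_bigr => r _ /=; have [ra|ra] := eqVneq (nu r) (stgt a).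
  by rewrite -(entry_at j pi' S _ _ ra).
rewrite G_shape ?ra // scale0r (entry0 fr fr').
by rewrite (frame_inj0 fr) linear0 (frame_proj0 fr').
Qed.

Section Loops.
Variables (al : I -> solid D) (tld : {x : solid D | x \notin codom al} -> dotted D).
Local Notation bb := {x : solid D | x \notin codom al}.
Hypothesis al_loop : forall i, ssrc (al i) = i /\ stgt (al i) = i.
Hypothesis tld_dual : forall x, dsrc (tld x) = stgt (val x) /\ dtgt (tld x) = ssrc (val x).
Hypothesis dif_al : forall i, dif D (kword k i i [:: inl (al i)]) =
            \sum_(x | stgt (val x) == i) kword k i i [:: inl (val x); inr (tld x)]
          - \sum_(x | dtgt (tld x) == i) kword k i i [:: inr (tld x); inl (val x)].
Variable b : bb.
Hypothesis G_other : forall x : bb, x != b -> forall p q, G (val x) p q = 0.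

(** Only b acts among the arrows of [frakb], so just the terms of dif (al i) with [tld b] survive.
    With h the component at [tld b], they are b h and h b. *)
Lemma entry_hom_al i p q x : is_hom S -> nu q = i ->
  \sum_r entry p r (G (al i) r q *: x) - \sum_r G (al i) p r *: entry r q x =
  (if stgt (val b) == i then \sum_r G (val b) p r *: dentry (tld b) r q x else 0) -
  (if ssrc (val b) == i then \sum_r dentry (tld b) p r (G (val b) r q *: x) else 0).
Proof.
move=> hS qi; rewrite (entry_hom _ _ hS) ?(al_loop i).1 //.
rewrite (wlift_dsolid_al al_loop tld_dual dif_al).
have sd v (r s : Q0) (y : L) : \sum_p dentry v r p ((p == s)%:R *: y) = dentry v r s y.
  by apply: (sum_delta (f := dentry v r)) => p'; apply: dentry0.
congr (_ - _).
- rewrite big_mkcond (bigD1 b) //= [X in _ + X]big1 ?addr0 => [|y yb]; last first.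
    by case: (_ == i) => //; rewrite big1 // => r _; rewrite G_other // scale0r.
  by case: (_ == i) => //; apply: eq_bigr => r _; rewrite sd.
- rewrite big_mkcond (bigD1 b) //= [X in _ + X]big1 ?addr0 => [|y yb]; last first.
    case: (_ == i) => //; rewrite big1 // => r _.
    rewrite [X in X *: _]big1 ?scale0r ?dentry0 // => r' _.
    by rewrite G_other // mul0r.
  case: (_ == i) => //; apply: eq_bigr => r _; congr (dentry _ _ _ (_ *: _)).
  rewrite (bigD1 q) //= eqxx mulr1 big1 ?addr0 // => r' /negbTE rq.
  by rewrite rq mulr0.
Qed.
End Loops.
End EntryEquations.

(** * Two block representations *)

Section Blocks.
Variables (k : fieldType) (La : algType k) (m n : nat) (g : 'I_n.+1 -> La).

Definition block_index : finType := ('I_m.+1 * 'I_n.+1 + unit)%type.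
Local Notation Q0 := block_index.
Definition blk (c : nat) (r : 'I_n.+1) : Q0 := inl (inord c, r).
Definition wblk : Q0 := inr tt.

Definition companion (r' r : 'I_n.+1) : La :=
  if r == ord_max then g r' else (r' == r.+1 :> nat)%:R.

(* A matrix over La given by blocks: T c' c = Some true and Some false stand for
   the identity and the companion matrix, y c' = true for the first unit vector
   in the last column. *)
Definition block_matrix (T : nat -> nat -> option bool) (y : nat -> bool) (p q : Q0) : La :=
  match p, q with
  | inl (c', r'), inl (c, r) =>
      match T c' c with
      | Some true => (r' == r)%:R
      | Some false => companion r' r
      | None => 0
      end
  | inl (c', r'), inr _ => if y c' then (r' == ord0)%:R else 0
  | inr _, _ => 0
  end.

Definition companion_col (L : lmodType La) (V : nmodType) (F : 'I_n.+1 -> L -> V) q x :=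
  \sum_r F r (companion r q *: x).
Definition companion_row (L : lmodType La) (F : 'I_n.+1 -> L) q :=
  \sum_r companion q r *: F r.

Lemma companion_row0 (L : lmodType La) (F : 'I_n.+1 -> L) q :
  (forall r, F r = 0) -> companion_row F q = 0.
Proof. by move=> F0; apply: big1 => r _; rewrite F0 scaler0. Qed.

Lemma companion_col0 (L : lmodType La) (V : nmodType) (F : 'I_n.+1 -> L -> V) q x :
  (forall r x, F r x = 0) -> companion_col F q x = 0.
Proof. by move=> F0; apply: big1 => r _. Qed.

Lemma blkP (p : Q0) : p = wblk \/ exists c r, (c < m.+1)%N /\ p = blk c r.
Proof.
case: p => [[c r]|[]]; [right | by left].
by exists c, r; rewrite /blk inord_val ltn_ord.
Qed.

Lemma sum_blocks (V : nmodType) (F : Q0 -> V) :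
  \sum_r F r = \sum_(0 <= c < m.+1) \sum_r F (blk c r) + F wblk.
Proof.
rewrite big_sumType /= [X in _ + X](bigD1 tt) //= [X in _ + (_ + X)]big1 ?addr0 => [|[] //].
congr (_ + _); rewrite big_mkord.
rewrite (eq_bigr (fun p => F (inl (p.1, p.2)))) => [|[] //].
rewrite -(pair_big xpredT xpredT (fun c r => F (inl (c, r)))).
by apply: eq_bigr => c _; rewrite /blk inord_val.
Qed.

Section Sums.
Variables (L : lmodType La) (T : nat -> nat -> option bool) (y : nat -> bool).

Lemma sum_block_col (V : nmodType) (f : Q0 -> L -> V) c q x : (c < m.+1)%N ->
  (forall p, f p 0 = 0) ->
  \sum_r f r (block_matrix T y r (blk c q) *: x) =
  \sum_(0 <= c' < m.+1) match T c' c with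
    | Some true => f (blk c' q) x
    | Some false => companion_col (fun r => f (blk c' r)) q x
    | None => 0
    end.
Proof.
move=> cm f0; rewrite sum_blocks /= scale0r f0 addr0.
apply: eq_big_nat => c' /andP[_ cm']; rewrite /= !inordK //.
case: (T c' c) => [[]//|]; last by rewrite big1 // => r _; rewrite scale0r f0.
rewrite (bigD1 q) //= eqxx scale1r big1 ?addr0 // => r /negbTE ->.
by rewrite scale0r f0.
Qed.

Lemma sum_wblock_col (V : nmodType) (f : Q0 -> L -> V) x : (forall p, f p 0 = 0) ->
  \sum_r f r (block_matrix T y r wblk *: x) =
  \sum_(0 <= c' < m.+1) if y c' then f (blk c' ord0) x else 0.
Proof.
move=> f0; rewrite sum_blocks /= scale0r f0 addr0.
apply: eq_big_nat => c' /andP[_ cm']; rewrite /= !inordK //.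
case: (y c'); last by rewrite big1 // => r _; rewrite scale0r f0.
rewrite (bigD1 ord0) // eqxx scale1r /= big1 ?addr0 // => r /negbTE ->.
by rewrite scale0r f0.
Qed.

Lemma sum_block_row (f : Q0 -> L) c q : (c < m.+1)%N ->
  \sum_r block_matrix T y (blk c q) r *: f r =
  \sum_(0 <= c' < m.+1) match T c c' with
    | Some true => f (blk c' q)
    | Some false => companion_row (fun r => f (blk c' r)) q
    | None => 0
    end + (if y c then (q == ord0)%:R *: f wblk else 0).
Proof.
move=> cm; rewrite sum_blocks /= inordK //; congr (_ + _); last first.
  by case: (y c); rewrite ?scale0r.
apply: eq_big_nat => c' /andP[_ cm']; rewrite /= !inordK //.
case: (T c c') => [[]//|]; last by rewrite big1 // => r _; rewrite scale0r.
rewrite (bigD1 q) //= eqxx scale1r big1 ?addr0 // => r rq.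
by rewrite eq_sym (negbTE rq) scale0r.
Qed.

Lemma sum_wblock_row (f : Q0 -> L) : \sum_r block_matrix T y wblk r *: f r = 0.
Proof. by rewrite big1 // => r _; rewrite scale0r. Qed.
End Sums.

(** The companion matrix carries each unit vector to the next, so commuting with it propagates the
    first column of s to all columns and makes s diagonal with entries w. Its last column then
    compares w after g_r with g_r after w. *)
Lemma companion_diagonal (L L' : lmodType La) (s : 'I_n.+1 -> 'I_n.+1 -> L -> L') (w : L -> L') :
  (forall r x, s r ord0 x = (r == ord0)%:R *: w x) -> (forall r r', s r r' 0 = 0) ->
  (forall r r' x, companion_col (s r) r' x = companion_row (fun i => s i r' x) r) ->
  (forall r r' x, s r r' x = (r == r')%:R *: w x) /\
  (forall r x, w (g r *: x) = g r *: w x).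
Proof.
move=> s0 sz comm.
have comp_row r r' x : (forall r, s r r' x = (r == r')%:R *: w x) ->
    companion_row (fun i => s i r' x) r = companion r r' *: w x.
  move=> E; rewrite /companion_row (bigD1 r') //= E eqxx scale1r big1 ?addr0 // => i /negbTE ne.
  by rewrite E ne scale0r scaler0.
have diag r r' x : s r r' x = (r == r')%:R *: w x.
  case: r' => r' hr'; elim: r' hr' r x => [|r' IHr'] hr' r x.
    have -> : Ordinal hr' = ord0 by apply: val_inj.
    exact: s0.
  have hr : (r' < n.+1)%N by exact: ltnW.
  have nmax : (Ordinal hr == ord_max) = false.
    by apply/eqP => /(congr1 val) /= E; move: hr'; rewrite E ltnn.
  have := comm r (Ordinal hr) x; rewrite (comp_row _ _ _ (fun r => IHr' hr r x)).
  rewrite /companion_col /companion nmax (bigD1 (Ordinal hr')) //= eqxx scale1r big1 ?addr0 => [->|i ni].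
    by [].
  by rewrite -[r'.+1]/(val (Ordinal hr')) (inj_eq val_inj) (negbTE ni) scale0r sz.
split=> // r x; have := comm r ord_max x; rewrite (comp_row _ _ _ (fun r => diag r ord_max x)).
rewrite /companion_col /companion eqxx (bigD1 r) //= diag eqxx scale1r big1 ?addr0 // => i ni.
by rewrite diag eq_sym (negbTE ni) scale0r.
Qed.
End Blocks.

Ltac expand := rewrite ?sum_block_col ?sum_block_row ?sum_wblock_col ?sum_wblock_row //;
  rewrite unlock /= ?(add0r, addr0, oppr0).

Section LoopCase.
Variables (k : fieldType) (La : algType k) (n : nat) (g : 'I_n.+1 -> La).
Variables L L' : lmodType La.
Local Notation Q0 := (block_index 2 n).
Local Notation blk c r := (blk 2 c r).
Local Notation W := (wblk 2 n).

(* The arrow b shifts the blocks 0 -> 1 -> 2; the loop consists of the companion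
   matrix 1 -> 0 and the first unit vector W -> 0. *)
Definition shift3 (c' c : nat) := if (c' == c.+1) && (c < 2)%N then Some true else None.
Definition loop3 (c' c : nat) := if (c' == 0%N) && (c == 1%N) then Some false else None.
Local Notation B := (@block_matrix _ _ 2 _ g shift3 (fun=> false)).
Local Notation Aa := (@block_matrix _ _ 2 _ g loop3 (fun c => c == 0%N)).

Definition rank3 (p : Q0) : nat :=
  match p with inl (c, _) => c | inr _ => 1 end.

Variables f h : Q0 -> Q0 -> L -> L'.
Hypothesis f0 : forall p q, f p q 0 = 0.
Hypothesis h0 : forall p q, h p q 0 = 0.
Hypothesis eB : forall p q x, \sum_r f p r (B r q *: x) - \sum_r B p r *: f r q x = 0.
Hypothesis eA : forall p q x, \sum_r f p r (Aa r q *: x) - \sum_r Aa p r *: f r q x =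
  \sum_r B p r *: h r q x - \sum_r h p r (B r q *: x).



(** Commuting with the shift gives triangularity and equal diagonal blocks. The companion sits at
    (0, 1), where b h has no entry and h b contributes only h 0 2. That entry is also the value of b
    h at (1, 2), where all other terms are zero; so it vanishes and the companion equation is exact.
    The third block serves this purpose. *)
Lemma loop_case : [/\ forall p q x, p != q -> (rank3 p <= rank3 q)%N -> f p q x = 0,
  forall p x, f p p x = f W W x & forall r x, f W W (g r *: x) = g r *: f W W x].
Proof.
have z01 r' r x : f (blk 0 r') (blk 1 r) x = 0.
  by have := eB (blk 0 r') (blk 0 r) x; expand.
have z02 r' r x : f (blk 0 r') (blk 2 r) x = 0.
  by have := eB (blk 0 r') (blk 1 r) x; expand.
have d11 r' r x : f (blk 1 r') (blk 1 r) x = f (blk 0 r') (blk 0 r) x.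
  by have := eB (blk 1 r') (blk 0 r) x; expand => /eqP; rewrite subr_eq0 => /eqP.
have d22 r' r x : f (blk 2 r') (blk 2 r) x = f (blk 0 r') (blk 0 r) x.
  by have := eB (blk 2 r') (blk 1 r) x; expand => /eqP; rewrite subr_eq0 d11 => /eqP.
have z12 r' r x : f (blk 1 r') (blk 2 r) x = 0.
  by have := eB (blk 1 r') (blk 1 r) x; expand; rewrite z01 subr0.
have zW1 r x : f W (blk 1 r) x = 0 by have := eB W (blk 0 r) x; expand.
have zW2 r x : f W (blk 2 r) x = 0 by have := eB W (blk 1 r) x; expand.
have z0W r x : f (blk 0 r) W x = 0.
  by have := eB (blk 1 r) W x; expand => /eqP; rewrite oppr_eq0 => /eqP.
have z1W r x : f (blk 1 r) W x = 0.
  by have := eB (blk 2 r) W x; expand => /eqP; rewrite oppr_eq0 => /eqP.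
have h02 r' r x : h (blk 0 r') (blk 2 r) x = 0.
  by have := eA (blk 1 r') (blk 2 r) x; expand.
have [diag comm] : (forall r r' x, f (blk 0 r) (blk 0 r') x = (r == r')%:R *: f W W x) /\
    forall r x, f W W (g r *: x) = g r *: f W W x.
  apply: companion_diagonal => [r x|//|r r' x].
    have := eA (blk 0 r) W x; expand; rewrite companion_row0 // add0r.
    by move=> /eqP; rewrite subr_eq0 => /eqP.
  have := eA (blk 0 r) (blk 1 r') x; expand; rewrite zW1 h02 scaler0 addr0 oppr0.
  move=> /eqP; rewrite subr_eq0 => /eqP ->.
  by apply: eq_bigr => i _; rewrite d11.
split=> // [p q x|p x].
- have [->|[c' [r' [hc' ->]]]] := blkP p; have [->|[c [r [hc ->]]]] := blkP q.
  + by rewrite eqxx.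
  + by rewrite /= inordK //; move: c hc => [|[|[|]]].
  + by rewrite /= inordK //; move: c' hc' => [|[|[|]]].
  + rewrite /= !inordK //; move: c' c hc hc' => [|[|[|//]]] [|[|[|//]]] // _ _ ne _;
      rewrite ?d11 ?d22 ?diag //;
      by case: (eqVneq r' r) ne => [->|_]; rewrite ?eqxx ?scale0r.
- have [->//|[c [r [hc ->]]]] := blkP p.
  move: c hc => [|[|[|//]]] _; rewrite ?d11 ?d22 diag eqxx scale1r //.
Qed.
End LoopCase.

Section ArrowCase.
Variables (k : fieldType) (La : algType k) (n : nat) (g : 'I_n.+1 -> La).
Variables L L' : lmodType La.
Local Notation Q0 := (block_index 11 n).
Local Notation blk c r := (blk 11 c r).
Local Notation W := (wblk 11 n).

(* The arrow b is the identity of X (blocks 0-3 at its source, 6-9 at its target);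
   the source contains in addition K (blocks 4, 5 and W), the target C (blocks 10
   and 11). The loops contribute maps K -> X -> C which, up to the terms b h and
   h b, cut the morphisms commuting with b down to the triangular ones with equal
   diagonal blocks; 3 -> 2 is the companion matrix, W -> 5 the unit vector. *)
Definition arrow12 (c' c : nat) := if (c' == c + 6)%N && (c < 4)%N then Some true else None.
Definition target12 (c' c : nat) :=
  if (c', c) \in [:: (10, 7); (11, 6)] then Some true else None.
Definition source12 (c' c : nat) :=
  if (c', c) \in [:: (0, 1); (0, 2); (1, 3); (1, 4); (3, 5)] then Some true
  else if (c' == 2) && (c == 3) then Some false else None.
Local Notation B := (@block_matrix _ _ 11 _ g arrow12 (fun=> false)).
Local Notation At := (@block_matrix _ _ 11 _ g target12 (fun=> false)).
Local Notation As := (@block_matrix _ _ 11 _ g source12 (fun c => c == 5)).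

Definition side12 (p : Q0) : bool := if p is inl (c, _) then (5 < c)%N else false.
(** Both copies of X carry the order 0 < 1, 2 < 3. At the target it is raised by 2, which leaves
    ranks 0 and 1 to C; at the source the blocks of K, with W last, lie above X. *)
Definition rank_seq : seq nat := [:: 0; 1; 1; 2; 3; 4; 2; 3; 3; 4; 1; 0]%N.
Definition rank12 (p : Q0) : nat := if p is inl (c, _) then nth 0%N rank_seq c else 5.

Variables f h : Q0 -> Q0 -> L -> L'.
Hypothesis f0 : forall p q, f p q 0 = 0.
Hypothesis h0 : forall p q, h p q 0 = 0.
Hypothesis eB : forall p q x, ~~ side12 q ->
  \sum_r f p r (B r q *: x) - \sum_r B p r *: f r q x = 0.
Hypothesis eT : forall p q x, side12 q ->
  \sum_r f p r (At r q *: x) - \sum_r At p r *: f r q x = \sum_r B p r *: h r q x.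
Hypothesis eS : forall p q x, ~~ side12 q ->
  \sum_r f p r (As r q *: x) - \sum_r As p r *: f r q x = - \sum_r h p r (B r q *: x).

Lemma side_blk c r : (c < 12)%N -> side12 (blk c r) = (5 < c)%N.
Proof. by move=> hc; rewrite /= inordK. Qed.

Ltac inst H := have := H; rewrite ?side_blk // => /(_ isT); expand.

(** b h reaches only the rows of X at the target and h b only the columns of X at the source. So
    rows in C and columns in K give exact equations, and [dX] carries their consequences from one
    copy of X to the other. *)
Lemma arrow_case : [/\ forall p q x, side12 p = side12 q -> p != q ->
    (rank12 p <= rank12 q)%N -> f p q x = 0,
  forall p x, f p p x = f W W x & forall r x, f W W (g r *: x) = g r *: f W W x].
Proof.
have opp0 (u : L') : - u = 0 -> u = 0 by move/eqP; rewrite oppr_eq0 => /eqP.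
have sub0 (u v : L') : u - v = 0 -> u = v by move/eqP; rewrite subr_eq0 => /eqP.
have dX c' c r' r x : (c' < 4)%N -> (c < 4)%N ->
    f (blk (c' + 6) r') (blk (c + 6) r) x = f (blk c' r') (blk c r) x.
  by move: c' c => [|[|[|[|//]]]] [|[|[|[|//]]]] _ _; apply: sub0;
    [inst (@eB (blk 6 r') (blk 0 r) x) | inst (@eB (blk 6 r') (blk 1 r) x)
    |inst (@eB (blk 6 r') (blk 2 r) x) | inst (@eB (blk 6 r') (blk 3 r) x)
    |inst (@eB (blk 7 r') (blk 0 r) x) | inst (@eB (blk 7 r') (blk 1 r) x)
    |inst (@eB (blk 7 r') (blk 2 r) x) | inst (@eB (blk 7 r') (blk 3 r) x)
    |inst (@eB (blk 8 r') (blk 0 r) x) | inst (@eB (blk 8 r') (blk 1 r) x)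
    |inst (@eB (blk 8 r') (blk 2 r) x) | inst (@eB (blk 8 r') (blk 3 r) x)
    |inst (@eB (blk 9 r') (blk 0 r) x) | inst (@eB (blk 9 r') (blk 1 r) x)
    |inst (@eB (blk 9 r') (blk 2 r) x) | inst (@eB (blk 9 r') (blk 3 r) x)].
have z10 c r' r x : (c < 4)%N -> f (blk 10 r') (blk (c + 6) r) x = 0.
  by move: c => [|[|[|[|//]]]] _; [inst (@eB (blk 10 r') (blk 0 r) x)
    |inst (@eB (blk 10 r') (blk 1 r) x)|inst (@eB (blk 10 r') (blk 2 r) x)
    |inst (@eB (blk 10 r') (blk 3 r) x)].
have z11 c r' r x : (c < 4)%N -> f (blk 11 r') (blk (c + 6) r) x = 0.
  by move: c => [|[|[|[|//]]]] _; [inst (@eB (blk 11 r') (blk 0 r) x)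
    |inst (@eB (blk 11 r') (blk 1 r) x)|inst (@eB (blk 11 r') (blk 2 r) x)
    |inst (@eB (blk 11 r') (blk 3 r) x)].
have z4 c r' r x : (c < 4)%N -> f (blk c r') (blk 4 r) x = 0.
  by move: c => [|[|[|[|//]]]] _; apply: opp0; [inst (@eB (blk 6 r') (blk 4 r) x)
    |inst (@eB (blk 7 r') (blk 4 r) x)|inst (@eB (blk 8 r') (blk 4 r) x)
    |inst (@eB (blk 9 r') (blk 4 r) x)].
have z5 c r' r x : (c < 4)%N -> f (blk c r') (blk 5 r) x = 0.
  by move: c => [|[|[|[|//]]]] _; apply: opp0; [inst (@eB (blk 6 r') (blk 5 r) x)
    |inst (@eB (blk 7 r') (blk 5 r) x)|inst (@eB (blk 8 r') (blk 5 r) x)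
    |inst (@eB (blk 9 r') (blk 5 r) x)].
have zW c r' x : (c < 4)%N -> f (blk c r') W x = 0.
  by move: c => [|[|[|[|//]]]] _; apply: opp0; [inst (@eB (blk 6 r') W x)
    |inst (@eB (blk 7 r') W x)|inst (@eB (blk 8 r') W x) |inst (@eB (blk 9 r') W x)].
have d10 r' r x : f (blk 10 r') (blk 10 r) x = f (blk 7 r') (blk 7 r) x.
  by apply: sub0; inst (@eT (blk 10 r') (blk 7 r) x).
have d11 r' r x : f (blk 11 r') (blk 11 r) x = f (blk 6 r') (blk 6 r) x.
  by apply: sub0; inst (@eT (blk 11 r') (blk 6 r) x).
have z7 c r' r x : c \in [:: 8; 9; 10; 11] -> f (blk 7 r') (blk c r) x = 0.
  by rewrite !inE => /or4P[] /eqP cE; rewrite cE; apply: opp0; [inst (@eT (blk 10 r') (blk 8 r) x)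
    |inst (@eT (blk 10 r') (blk 9 r) x)|inst (@eT (blk 10 r') (blk 10 r) x)
    |inst (@eT (blk 10 r') (blk 11 r) x)].
have z6 c r' r x : c \in [:: 8; 9; 10; 11] -> f (blk 6 r') (blk c r) x = 0.
  by rewrite !inE => /or4P[] /eqP cE; rewrite cE; apply: opp0; [inst (@eT (blk 11 r') (blk 8 r) x)
    |inst (@eT (blk 11 r') (blk 9 r) x)|inst (@eT (blk 11 r') (blk 10 r) x)
    |inst (@eT (blk 11 r') (blk 11 r) x)].
(* The entries h 0 7, h 0 8, h 1 9 and h 2 9 are what h b adds to the source equations at (0, 1),
   (0, 2), (1, 3) and (2, 3). The target equations kill them. *)
have h07 r' r x : h (blk 0 r') (blk 7 r) x = 0.
  by inst (@eT (blk 6 r') (blk 7 r) x); rewrite z6.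
have h08 r' r x : h (blk 0 r') (blk 8 r) x = 0 by inst (@eT (blk 6 r') (blk 8 r) x).
have h19 r' r x : h (blk 1 r') (blk 9 r) x = 0 by inst (@eT (blk 7 r') (blk 9 r) x).
have h29 r' r x : h (blk 2 r') (blk 9 r) x = 0 by inst (@eT (blk 8 r') (blk 9 r) x).
have z01 r' r x : f (blk 0 r') (blk 1 r) x = 0.
  by inst (@eS (blk 0 r') (blk 4 r) x); rewrite !z4 // addr0 subr0.
have zE r' r x : f (blk 11 r') (blk 10 r) x = 0.
  by inst (@eT (blk 11 r') (blk 7 r) x); rewrite (@dX 0 1) // z01 subr0.
have z21 r' r x : f (blk 2 r') (blk 1 r) x = 0.
  by inst (@eS (blk 2 r') (blk 4 r) x); rewrite companion_row0 ?subr0 // => i; rewrite z4.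
have d44 r' r x : f (blk 1 r') (blk 1 r) x = f (blk 4 r') (blk 4 r) x.
  by apply: sub0; inst (@eS (blk 1 r') (blk 4 r) x); rewrite z4 // add0r.
have z03 r' r x : f (blk 0 r') (blk 3 r) x = 0.
  by inst (@eS (blk 0 r') (blk 5 r) x); rewrite !z5 // addr0 subr0.
have z13 r' r x : f (blk 1 r') (blk 3 r) x = 0 by rewrite -dX // z7.
have z45 r' r x : f (blk 4 r') (blk 5 r) x = 0.
  by apply: opp0; inst (@eS (blk 1 r') (blk 5 r) x); rewrite z13 z5 // !add0r.
have z23 r' r x : f (blk 2 r') (blk 3 r) x = 0.
  by inst (@eS (blk 2 r') (blk 5 r) x); rewrite companion_row0 ?subr0 // => i; rewrite z5.
have d55 r' r x : f (blk 3 r') (blk 3 r) x = f (blk 5 r') (blk 5 r) x.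
  by apply: sub0; inst (@eS (blk 3 r') (blk 5 r) x).
have z43 r' r x : f (blk 4 r') (blk 3 r) x = 0 by inst (@eS (blk 4 r') (blk 5 r) x).
have z4W r x : f (blk 4 r) W x = 0.
  by apply: opp0; inst (@eS (blk 1 r) W x); rewrite z5 // zW // !add0r.
have z5W r x : f (blk 5 r) W x = 0.
  by apply: opp0; inst (@eS (blk 3 r) W x); rewrite z5 // !add0r.
have z12 r' r x : f (blk 1 r') (blk 2 r) x = 0 by rewrite -dX // z7.
have z02 r' r x : f (blk 0 r') (blk 2 r) x = 0 by rewrite -dX // z6.
have d01 r' r x : f (blk 0 r') (blk 0 r) x = f (blk 1 r') (blk 1 r) x.
  by apply: sub0; inst (@eS (blk 0 r') (blk 1 r) x); rewrite z21 h07 addr0 oppr0.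
have d02 r' r x : f (blk 0 r') (blk 0 r) x = f (blk 2 r') (blk 2 r) x.
  by apply: sub0; inst (@eS (blk 0 r') (blk 2 r) x); rewrite z12 h08 add0r oppr0.
have d13 r' r x : f (blk 1 r') (blk 1 r) x = f (blk 3 r') (blk 3 r) x.
  apply: sub0; inst (@eS (blk 1 r') (blk 3 r) x); rewrite z43 h19 companion_col0 //.
  by rewrite !addr0 oppr0.
have [diag comm] : (forall r r' x, f (blk 3 r) (blk 3 r') x = (r == r')%:R *: f W W x) /\
    forall r x, f W W (g r *: x) = g r *: f W W x.
  apply: companion_diagonal => [r x|//|r r' x].
    by apply: sub0; rewrite d55; inst (@eS (blk 5 r) W x).
  apply: sub0; inst (@eS (blk 2 r) (blk 3 r') x); rewrite z21 h29 add0r oppr0 => <-.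
  by congr (_ - _); apply: eq_bigr => i _; rewrite -d02 d01 d13.
have d3 c r' r x : (c < 12)%N -> f (blk c r') (blk c r) x = f (blk 3 r') (blk 3 r) x.
  move: c => [|[|[|[|[|[|c]]]]]] hc; rewrite -?d55 -?d44 -?d02 ?d01 ?d13 //.
  move: c hc => [|[|[|[|[|[|//]]]]]] _; rewrite ?d10 ?d11 ?(@dX 0 0) ?(@dX 1 1) ?(@dX 2 2) ?(@dX 3 3) //;
    by rewrite -?d02 ?d01 ?d13.
split=> // [p q x|p x]; last first.
  by have [->//|[c [r [hc ->]]]] := blkP p; rewrite d3 // diag eqxx scale1r.
have [->|[c' [r' [hc' ->]]]] := blkP p; have [->|[c [r [hc ->]]]] := blkP q.
- by rewrite eqxx.
- by rewrite side_blk //= inordK //; move: c hc => [|[|[|[|[|[|c]]]]]].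
- rewrite side_blk // => + _ _; move: c' hc' => [|[|[|[|[|[|c]]]]]] //; rewrite ?zW //.
- rewrite !side_blk // /= !inordK //.
  move: c' c hc hc' => [|[|[|[|[|[|[|[|[|[|[|[|//]]]]]]]]]]]]
     [|[|[|[|[|[|[|[|[|[|[|[|//]]]]]]]]]]]] _ _ //= _ ne _;
   rewrite ?z01 ?z02 ?z03 ?z12 ?z13 ?z21 ?z23 ?(@z4 0) ?(@z4 1) ?(@z4 2) ?(@z4 3) ?(@z5 0) ?(@z5 1)
     ?(@z5 2) ?(@z5 3) ?z45 ?(@z6 8) ?(@z6 9) ?(@z7 8) ?(@z7 9) ?zE
     ?(@z10 0) ?(@z10 1) ?(@z10 2) ?(@z10 3) ?(@z11 0) ?(@z11 1) ?(@z11 2) ?(@z11 3) //.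
  all: rewrite ?(@dX 0 1) ?(@dX 2 1) ?(@dX 2 3) // ?z01 ?z21 ?z23 ?d3 ?diag //.
  all: case: (eqVneq r' r) ne => [->|_]; rewrite ?eqxx ?scale0r //.
Qed.
End ArrowCase.

(** * Change of dotted generators *)

Section Substitution.
Variables (k : fieldType) (I : finType) (Q : biquiver I).
Local Notation kQ j i := {malg k[qpath Q j i]}.
Implicit Types j i l : I.

Lemma qcompA j i l l' (p : qpath Q l l') (q : qpath Q i l) (r : qpath Q j i) :
  qcomp (qcomp p q) r = qcomp p (qcomp q r).
Proof. by elim: p q => //= a p IHp q; rewrite IHp. Qed.

Lemma kcompA j i l l' (x : kQ l l') (y : kQ i l) (z : kQ j i) :
  kcomp (kcomp x y) z = kcomp x (kcomp y z).
Proof.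
rewrite [LHS]kcompE klift_kcomp [RHS]kcompE; apply: eq_klift => p _; rewrite klift_kcomp.
apply: eq_klift => q _; apply: eq_klift => r _; by rewrite qcompA.
Qed.

Lemma klift_comb (V : lmodType k) j i (c : k) (f h : qpath Q j i -> V) x :
  klift (fun p => c *: f p + h p) x = c *: klift f x + klift h x.
Proof.
rewrite /klift scaler_sumr -big_split; apply: eq_bigr => p _ /=.
by rewrite scalerDr !scalerA mulrC.
Qed.

Lemma kcomp_linearr j i l (x : kQ i l) : linear (fun y : kQ j i => kcomp x y).
Proof.
move=> c y z; rewrite !kcompE -klift_comb; apply: eq_klift => p _.
by rewrite linearP.
Qed.

Lemma kcomp_linearl j i l (y : kQ j i) : linear (fun x : kQ i l => kcomp x y).
Proof. by move=> c x z; rewrite !kcompE linearP. Qed.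

HB.instance Definition _ j i l (x : kQ i l) :=
  GRing.isLinear.Build k (kQ j i) (kQ j l) *:%R (kcomp x) (kcomp_linearr x).
Definition kcompr j i l (y : kQ j i) (x : kQ i l) := kcomp x y.
HB.instance Definition _ j i l (y : kQ j i) :=
  GRing.isLinear.Build k (kQ i l) (kQ j l) *:%R (kcompr y) (@kcomp_linearl j i l y).

Variable F : forall v : dotted Q, kQ (dsrc v) (dtgt v).

Fixpoint subst_path j i (p : qpath Q j i) : kQ j i :=
  match p with
  | qid => kpath k (qid j)
  | qsol a p' => kcomp (kpath k (sarrow a)) (subst_path p')
  | qdot v p' => kcomp (F v) (subst_path p')
  end.

Definition subst j i : kQ j i -> kQ j i := klift (@subst_path j i).
HB.instance Definition _ j i := GRing.Linear.on (@subst j i).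

Lemma subst0 j i : subst (0 : kQ j i) = 0.
Proof. exact: (linear0 (klift (@subst_path j i))). Qed.

Lemma subst_kpath j i (p : qpath Q j i) : subst (kpath k p) = subst_path p.
Proof. exact: klift_kpath. Qed.

Lemma kcompid j i (x : kQ j i) : kcomp (kpath k (qid i)) x = x.
Proof. by rewrite kcompE klift_kpath [RHS]kpathE. Qed.

Lemma subst_qcomp j i l (p : qpath Q i l) (q : qpath Q j i) :
  subst_path (qcomp p q) = kcomp (subst_path p) (subst_path q).
Proof.
elim: p q => [|a p IHp|v p IHp] q /=; first by rewrite kcompid.
  by rewrite IHp kcompA.
by rewrite IHp kcompA.
Qed.

Lemma subst_kcomp j i l (x : kQ i l) (y : kQ j i) :
  subst (kcomp x y) = kcomp (subst x) (subst y).
Proof.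
rewrite [LHS]klift_kcomp -[RHS]/(kcompr (subst y) (klift (@subst_path i l) x)) klift_lfun.
apply: eq_klift => p _; rewrite -[RHS]/(kcomp (subst_path p) (klift (@subst_path j i) y)).
by rewrite klift_lfun; apply: eq_klift => q _; apply: subst_qcomp.
Qed.

Lemma homogeneousP d j i (x : kQ j i) : homogeneous d x <->
  forall p, qdeg p != d -> x@_p = 0.
Proof.
split=> h p; last by rewrite -mcoeff_neq0; apply: contraNeq => /h ->.
by apply: contraNeq; rewrite mcoeff_neq0 => /h ->.
Qed.

Lemma homogeneous_lin d j i (c : k) (x y : kQ j i) :
  homogeneous d x -> homogeneous d y -> homogeneous d (c *: x + y).
Proof.
move=> /homogeneousP hx /homogeneousP hy; apply/homogeneousP => p pd.
by rewrite mcoeffD mcoeffZ hx // hy // mulr0 addr0.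
Qed.

Lemma homogeneous0 d j i : homogeneous d (0 : kQ j i).
Proof. by apply/homogeneousP => p _; rewrite mcoeff0. Qed.

Lemma homogeneous_sum d j i (T : eqType) (r : seq T) (c : T -> k) (x : T -> kQ j i) :
  (forall t, t \in r -> homogeneous d (x t)) -> homogeneous d (\sum_(t <- r) c t *: x t).
Proof.
elim: r => [|t r IHr] h; first by rewrite big_nil; exact: homogeneous0.
rewrite big_cons; apply: homogeneous_lin; first by apply: h; rewrite inE eqxx.
by apply: IHr => u ur; apply: h; rewrite inE ur orbT.
Qed.

Lemma qdeg_comp j i l (p : qpath Q i l) (q : qpath Q j i) :
  qdeg (qcomp p q) = (qdeg p + qdeg q)%N.
Proof. by elim: p q => //= v p IHp q; rewrite IHp. Qed.

Lemma homogeneous_kcomp d e j i l (x : kQ i l) (y : kQ j i) :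
  homogeneous d x -> homogeneous e y -> homogeneous (d + e) (kcomp x y).
Proof.
move=> hx hy; rewrite kcompE; apply: homogeneous_sum => p /hx <-.
apply: homogeneous_sum => q /hy <-; rewrite -qdeg_comp.
exact: homogeneous_kpath.
Qed.

Hypothesis F1 : forall v, homogeneous 1 (F v).

Lemma homogeneous_subst d j i (x : kQ j i) : homogeneous d x -> homogeneous d (subst x).
Proof.
move=> hx; apply: homogeneous_sum => p /hx <- {hx}.
elim: p => [|a p IHp|v p IHp] /=; first exact: (homogeneous_kpath (qid j)).
  by apply: (homogeneous_kcomp (d := 0)) IHp; apply: (homogeneous_kpath (sarrow a)).
by rewrite -add1n; apply: homogeneous_kcomp.
Qed.
End Substitution.

Lemma subst_id (k : fieldType) (I : finType) (Q : biquiver I)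
    (F H : forall v : dotted Q, {malg k[qpath Q (dsrc v) (dtgt v)]}) :
  (forall v, subst F (H v) = kpath k (darrow v)) ->
  forall j i (x : {malg k[qpath Q j i]}), subst F (subst H x) = x.
Proof.
move=> FH j i x; rewrite [subst H x]/(klift _ _) klift_lfun [RHS]kpathE.
apply: eq_bigr => p _; congr (_ *: _).
elim: p => [|a p IHp|v p IHp] /=; first exact: subst_kpath.
  by rewrite subst_kcomp subst_kpath /= kcomp_kpath IHp kcomp_kpath.
by rewrite subst_kcomp FH IHp kcomp_kpath.
Qed.

Section ChangeOfBasis.
Variables (k : fieldType) (I : finType) (D : diff_biquiver k I).
Local Notation kQ j i := {malg k[qpath D j i]}.
Variables F H : forall v : dotted D, kQ (dsrc v) (dtgt v).
Hypothesis F1 : forall v, homogeneous 1 (F v).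
Hypothesis H1 : forall v, homogeneous 1 (H v).
Hypothesis FH : forall v, subst F (H v) = kpath k (darrow v).
Hypothesis HF : forall v, subst H (F v) = kpath k (darrow v).

(** The biquiver is kept and the differential is conjugated, so that [subst F] becomes an
    isomorphism from the new box to D. *)
Definition twisted_dif (j i : I) : {linear kQ j i -> kQ j i} :=
  (@subst _ _ _ H j i \o (dif D \o @subst _ _ _ F j i))%FUN.

Fact twisted_dif_deg d (j i : I) (x : kQ j i) :
  homogeneous d x -> homogeneous d.+1 (twisted_dif j i x).
Proof. by move=> hx; apply/(homogeneous_subst H1)/dif_deg/(homogeneous_subst F1). Qed.

Fact twisted_dif_dif (j i : I) (x : kQ j i) : twisted_dif j i (twisted_dif j i x) = 0.
Proof.
have E y : twisted_dif j i y = subst H (dif D (subst F y)) by [].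
have e1 := congr1 (fun y => subst H (dif D y)) (subst_id FH (dif D (subst F x))).
have e2 := congr1 (@subst _ _ _ H j i) (dif_dif (subst F x)).
have e0 := congr1 (fun y => subst H (dif D (subst F y))) (E x).
exact: (etrans (E _) (etrans e0 (etrans e1 (etrans e2 (subst0 H j i))))).
Qed.

Fact twisted_dif_comp d (j i l : I) (x : kQ i l) (y : kQ j i) : homogeneous d x ->
  twisted_dif j l (kcomp x y) =
  kcomp (twisted_dif i l x) y + (-1) ^+ d *: kcomp x (twisted_dif j i y).
Proof.
move=> hx; rewrite /= subst_kcomp (dif_comp _ (homogeneous_subst F1 hx)) linearD linearZ /=.
by rewrite !subst_kcomp !(subst_id HF).
Qed.

Definition change_of_basis : diff_biquiver k I :=
  DiffBiquiver twisted_dif_deg twisted_dif_dif twisted_dif_comp.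

Lemma same_box_change : same_box D change_of_basis.
Proof.
exists (fun j i => @subst _ _ _ F j i : {linear kQ j i -> kQ j i}); split.
- by move=> j i; exists (@subst _ _ _ H j i) => x; rewrite /= ?(subst_id HF) ?(subst_id FH).
- by move=> i; exact: subst_kpath.
- by move=> j i l x y; exact: subst_kcomp.
- by move=> d j i x; exact: homogeneous_subst.
- by move=> j i x; rewrite /= (subst_id FH).
Qed.
End ChangeOfBasis.

Section DottedBasis.
Variables (k : fieldType) (I : finType) (Q : biquiver I).
Local Notation kQ j i := {malg k[qpath Q j i]}.

Lemma kword_darrow (v : dotted Q) :
  kword k (dsrc v) (dtgt v) [:: inr v] = kpath k (darrow v).
Proof. by rewrite /kword -[[:: _]]/(qword (darrow v)) qwordK. Qed.

(** [kword] is 0 on arrows not parallel to v, so the sum may run over all dotted arrows. *)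
Definition dotted_comb (s : dotted Q -> dotted Q -> k) (v : dotted Q) : kQ (dsrc v) (dtgt v) :=
  \sum_u s v u *: kword k (dsrc v) (dtgt v) [:: inr u].

Lemma qpath_of_wordK j i s (p : qpath Q j i) : qpath_of_word j i s = Some p -> qword p = s.
Proof.
have castE i1 i2 (e : i1 = i2) (q : qpath Q j i1) : qword (qcast e q) = qword q.
  by case: _ / e.
elim: s i p => [|[a|v] s IHs] i p /=.
- by case: eqP => // e [<-]; rewrite castE.
- case: eqP => // e; case E: (qpath_of_word _ _ _) => [q|] //= [<-].
  by rewrite castE /= (IHs _ _ E).
- case: eqP => // e; case E: (qpath_of_word _ _ _) => [q|] //= [<-].
  by rewrite castE /= (IHs _ _ E).
Qed.

Lemma homogeneous_dotted_comb s v : homogeneous 1 (dotted_comb s v).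
Proof.
apply: homogeneous_sum => u _; rewrite /kword.
case E: (qpath_of_word _ _ _) => [p|]; last exact: homogeneous0.
suff -> : 1%N = qdeg p by exact: homogeneous_kpath.
have := qpath_of_wordK E; case: p {E} => [|a p|w p] //= [_ pE].
by case: p pE.
Qed.

Lemma subst_dotted_comb s v j i : dsrc v = j -> dtgt v = i ->
  subst (dotted_comb s) (kword k j i [:: inr v]) = \sum_u s v u *: kword k j i [:: inr u].
Proof.
move=> <- <-; rewrite kword_darrow subst_kpath /=.
have -> : kcomp (dotted_comb s v) (kpath k (qid (dsrc v))) = dotted_comb s v.
  rewrite kcompE [RHS]kpathE; apply: eq_bigr => p _.
  rewrite klift_kpath; congr (_ *: kpath k _).
  by elim: p => //= [a p ->|w p ->].
by [].
Qed.

Lemma subst_dotted_id s t v : (forall v u, s v u != 0 -> dsrc u = dsrc v /\ dtgt u = dtgt v) ->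
  (forall v w, \sum_u s v u * t u w = (v == w)%:R) ->
  subst (dotted_comb t) (dotted_comb s v) = kpath k (darrow v).
Proof.
move=> par st; rewrite linear_sum -kword_darrow.
transitivity (\sum_u \sum_w (s v u * t u w) *: kword k (dsrc v) (dtgt v) [:: inr w]).
  apply: eq_bigr => u _; rewrite linearZ /=; have [->|nz] := eqVneq (s v u) 0.
    by rewrite scale0r big1 // => w _; rewrite mul0r scale0r.
  have [e1 e2] := par _ _ nz; rewrite subst_dotted_comb // scaler_sumr.
  by apply: eq_bigr => w _; rewrite scalerA.
rewrite exchange_big (bigD1 v) //= -scaler_suml st eqxx scale1r big1 ?addr0 // => w vw.
by rewrite -scaler_suml st eq_sym (negbTE vw) scale0r.
Qed.

(** Coefficient matrix of the exchange of v0 for the combination l. It is invertible when l v0 is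
    nonzero, with inverse [dotted_unreplace]. *)
Definition dotted_replace (v0 : dotted Q) (l : dotted Q -> k) (v u : dotted Q) : k :=
  if v == v0 then l u else (v == u)%:R.

Definition dotted_unreplace (v0 : dotted Q) (l : dotted Q -> k) (v u : dotted Q) : k :=
  if v == v0 then (if u == v0 then 1 else - l u) / l v0 else (v == u)%:R.

Lemma dotted_replaceK v0 l v w : l v0 != 0 ->
  \sum_u dotted_replace v0 l v u * dotted_unreplace v0 l u w = (v == w)%:R.
Proof.
move=> l0; rewrite /dotted_replace /dotted_unreplace; have [->|vv] := eqVneq v v0.
  rewrite (bigD1 v0) //= eqxx; have [->|wv] := eqVneq w v0.
    rewrite mul1r mulfV // big1 ?addr0 ?eqxx // => u /negbTE uv.
    by rewrite uv mulr0.
  rewrite (bigD1 w) //= ?(negbTE wv) eqxx mulr1 big1 ?addr0; last first.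
    by move=> u /andP[/negbTE -> /negbTE ->]; rewrite mulr0.
  by rewrite mulrCA mulfV // mulr1 addNr.
rewrite (bigD1 v) //= (negbTE vv) eqxx mul1r big1 ?addr0 // => u /negbTE uv.
by rewrite eq_sym uv mul0r.
Qed.

Lemma dotted_unreplaceK v0 l v w : l v0 != 0 ->
  \sum_u dotted_unreplace v0 l v u * dotted_replace v0 l u w = (v == w)%:R.
Proof.
move=> l0; rewrite /dotted_replace /dotted_unreplace; have [->|vv] := eqVneq v v0.
  rewrite (bigD1 v0) //= eqxx; have [->|wv] := eqVneq w v0.
    rewrite mul1r mulVf // big1 ?addr0 ?eqxx // => u /negbTE uv.
    by rewrite uv mulr0.
  rewrite (bigD1 w) //= ?(negbTE wv) eqxx mulr1 big1 ?addr0; last first.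
    by move=> u /andP[/negbTE -> /negbTE ->]; rewrite mulr0.
  by rewrite mul1r mulrC mulNr addrN.
rewrite (bigD1 v) //= (negbTE vv) eqxx mul1r big1 ?addr0 // => u /negbTE uv.
by rewrite eq_sym uv mul0r.
Qed.
End DottedBasis.

Section Superfluous.
Variables (k : fieldType) (I : finType) (D : diff_biquiver k I).

Lemma dotted_word_ends j i (p : qpath D j i) v : qword p = [:: inr v] ->
  dsrc v = j /\ dtgt v = i.
Proof.
case: p => [//|a p //|w p] /= [<- pE]; split=> //.
by case: p pE.
Qed.

(** If v0 occurs in dif b, a combination of dotted arrows, then dif b can take the place of v0 among
    the generators. In the box so presented the differential of b is a single dotted arrow. *)
Lemma not_superfluous (b : solid D) : no_superfluous_arrows D ->
  (forall p, p \in msupp (dsolid b) -> exists v, qword p = [:: inr v]) -> dsolid b = 0.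
Proof.
move=> noS hb; have [E|/fset0Pn[p0 p0b]] := eqVneq (msupp (dsolid b)) fset0.
  by rewrite [LHS]kpathE E big_seq_fset0.
exfalso.
have [v0 v0E] := hb _ p0b; have [s0 t0] := dotted_word_ends v0E.
pose K u : {malg k[qpath D (ssrc b) (stgt b)]} := kword k (ssrc b) (stgt b) [:: inr u].
pose l u : k := wlift (fun w => (w == [:: inr u])%:R : k^o) (dsolid b).
have l0 : l v0 != 0 by rewrite /l -v0E wlift_coef mcoeff_neq0.
have par u : l u != 0 -> dsrc u = dsrc v0 /\ dtgt u = dtgt v0.
  move=> lu; have : exists2 p, p \in msupp (dsolid b) & qword p = [:: inr u].
    apply: NNPP => no; move: lu; rewrite /l /wlift /klift big_seq big1 ?eqxx // => p pb.
    by case: eqP => [E|_]; rewrite ?scaler0 //; case: no; exists p.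
  by case=> p _ /dotted_word_ends[-> ->].
have bE : dsolid b = \sum_u l u *: K u.
  rewrite [LHS]kpathE /l /wlift /klift.
  under [RHS]eq_bigr do rewrite scaler_suml.
  rewrite exchange_big; apply: eq_big_seq => p /hb[v vE] /=.
  rewrite (bigD1 v) //= vE eqxx [X in _ + X]big1 ?addr0 => [|u vu].
    have -> : kpath k p = K v by rewrite /K -vE /kword qwordK.
    by rewrite -[_ *: 1]/(_ * 1) mulr1.
  rewrite eqseq_cons andbT; case: eqP => [[E]|_]; last by rewrite scaler0 scale0r.
  by rewrite E eqxx in vu.
pose F := dotted_comb (dotted_replace v0 l).
pose H := dotted_comb (dotted_unreplace v0 l).
have FH v : subst F (H v) = kpath k (darrow v).
  apply: subst_dotted_id => [w u|w u]; last exact: dotted_unreplaceK.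
  rewrite /dotted_unreplace; have [->|_] := eqVneq w v0; last first.
    by have [->|] := eqVneq w u; rewrite ?eqxx.
  have [->//|_] := eqVneq u v0; rewrite mulf_eq0 negb_or oppr_eq0 => /andP[/par].
  by [].
have HF v : subst H (F v) = kpath k (darrow v).
  apply: subst_dotted_id => [w u|w u]; last exact: dotted_replaceK.
  rewrite /dotted_replace; have [->|_] := eqVneq w v0; first exact: par.
  by have [->|] := eqVneq w u; rewrite ?eqxx.
have F1 v : homogeneous 1 (F v) by exact: homogeneous_dotted_comb.
have H1 v : homogeneous 1 (H v) by exact: homogeneous_dotted_comb.
pose D' := change_of_basis F1 H1 FH HF.
have sD : same_box D D' by exact: same_box_change.
apply: (noS D' sD b); exists v0 => //.
have E1 : subst F (kpath k (sarrow b)) = kpath k (sarrow b).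
  by rewrite subst_kpath /= kcomp_kpath.
rewrite -[LHS]/(subst H (dif D (subst F (kpath k (sarrow b))))) E1 -/(@dsolid k I D b).
have -> : dsolid b = subst F (K v0).
  rewrite subst_dotted_comb // bE; apply: eq_bigr => u _.
  by rewrite /dotted_replace eqxx.
by rewrite (subst_id HF).
Qed.

Variables (al : I -> solid D) (tld : {x : solid D | x \notin codom al} -> dotted D).
Local Notation bb := {x : solid D | x \notin codom al}.
Hypothesis al_loop : forall i, ssrc (al i) = i /\ stgt (al i) = i.
Hypothesis tld_inj : injective tld.
Hypothesis tld_dual : forall x, dsrc (tld x) = stgt (val x) /\ dtgt (tld x) = ssrc (val x).
Hypothesis dif_al : forall i, dif D (kword k i i [:: inl (al i)]) =
            \sum_(x | stgt (val x) == i) kword k i i [:: inl (val x); inr (tld x)]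
          - \sum_(x | dtgt (tld x) == i) kword k i i [:: inr (tld x); inl (val x)].

(** If all solid arrows were distinguished loops, connectedness would leave one vertex, hence one
    loop. *)
Lemma nondistinguished_exists : solid_connected D -> ~ coincides_with_kt D -> inhabited bb.
Proof.
move=> [I0 con] nkt; apply: NNPP => nb.
have all_al a : exists i, a = al i.
  by case: (boolP (a \in codom al)) => [/codomP|na] //; case: nb; split; exists a.
have I1 : #|I| = 1%N.
  have /card_gt0P[i0 _] := I0; rewrite -(card1 i0); apply: eq_card => i.
  rewrite !inE; apply/esym/eqP.
  have /connectP[p] := con i0 i; elim: p i0 => [|i1 p IHp] i0 /= => [_ -> //|].
  move=> /andP[/existsP[a] h /IHp{}IHp] E; rewrite IHp //.
  have [l aE] := all_al a; move: h; rewrite aE (al_loop l).1 (al_loop l).2.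
  by move=> /orP[] /andP[/eqP<- /eqP<-].
apply: nkt; split=> //; rewrite -I1 -(card_codom (al_inj al_loop)).
apply: eq_card => a; apply/esym; rewrite inE.
by have [i ->] := all_al a; apply: codom_f.
Qed.

Lemma closed_nondistinguished : solid_triangular D -> solid_connected D ->
  no_superfluous_arrows D -> ~ coincides_with_kt D -> exists b : bb, dsolid (val b) = 0.
Proof.
move=> [h hT] con noS nkt; have [b0] := nondistinguished_exists con nkt.
pose b := [arg min_(x < b0) h (val x)]; exists b.
have bmin (x : bb) : (h (val b) <= h (val x))%N.
  rewrite /b; case: arg_minnP => [//|y _ ymin]. exact: (ymin x isT).
apply: not_superfluous => // p pb.
(* Minimality of the height concerns only [frakb]; distinguished loops do not occur in dif b because
   [frakb] is closed. Without solid letters, degree 1 leaves a single dotted letter. *)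
have sol a : inl a \in qword p -> False.
  move=> ap; have ha : frakb al a.
    have /allP/(_ _ ap) := frakb_closed tld_inj tld_dual dif_al (valP b) pb.
    by [].
  have := hT (val b) a; rewrite ltnNge (bmin (Sub a ha)) => H.
  by have /H : solid_occurs a (dsolid (val b)) by exists p.
have := dsolid_homogeneous pb; rewrite qdegE.
case: (qword p) sol => [//|[a|v] w] sol; first by case: (sol a); rewrite inE eqxx.
case: w sol => [|[a|u] w] sol //=; first by exists v.
by case: (sol a); rewrite !inE eqxx orbT.
Qed.
End Superfluous.

(** * Wildness *)

Section Wildness.
Variables (k : closedFieldType) (I : finType) (D : diff_biquiver k I).
Variables (al : I -> solid D) (tld : {x : solid D | x \notin codom al} -> dotted D).
Local Notation bb := {x : solid D | x \notin codom al}.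
Hypothesis al_loop : forall i, ssrc (al i) = i /\ stgt (al i) = i.
Hypothesis tld_dual : forall x, dsrc (tld x) = stgt (val x) /\ dtgt (tld x) = ssrc (val x).
Hypothesis dif_al : forall i, dif D (kword k i i [:: inl (al i)]) =
            \sum_(x | stgt (val x) == i) kword k i i [:: inl (val x); inr (tld x)]
          - \sum_(x | dtgt (tld x) == i) kword k i i [:: inr (tld x); inl (val x)].
Variable b : bb.
Hypothesis dif_b : dsolid (val b) = 0.
Variables (La : algType k) (n : nat) (g : 'I_n.+1 -> La).

Lemma val_bb_al (x : bb) i : (val x == al i) = false.
Proof. by apply: contraNF (valP x) => /eqP ->; exact: codom_f. Qed.

Section LoopCase.
Hypothesis b_loop : stgt (val b) = ssrc (val b).
Let i := ssrc (val b).

Definition loop_vertex (p : block_index 2 n) : I := i.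
Definition loop_matrix (a : solid D) : block_index 2 n -> block_index 2 n -> La :=
  if a == val b then block_matrix g shift3 (fun=> false)
  else if a == al i then block_matrix g loop3 (fun c => c == 0%N) else fun _ _ => 0.

Lemma loop_unitriangular :
  unitriangular (codom g) loop_vertex loop_matrix (@rank3 n) (wblk 2 n).
Proof.
move=> L L' N N' j pi j' pi' fr fr' S hS.
have shape a p q : (loop_vertex p != stgt a) || (loop_vertex q != ssrc a) ->
    loop_matrix a p q = 0.
  rewrite /loop_matrix /loop_vertex; have [->|_] := eqVneq a (val b); first by rewrite b_loop eqxx.
  by have [->|//] := eqVneq a (al i); rewrite (al_loop i).1 (al_loop i).2 eqxx.
have Gb : loop_matrix (val b) = block_matrix g shift3 (fun=> false).
  by rewrite /loop_matrix eqxx.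
have Ga : loop_matrix (al i) = block_matrix g loop3 (fun c => c == 0%N).
  by rewrite /loop_matrix eq_sym val_bb_al eqxx.
have Go (x : bb) : x != b -> forall p q, loop_matrix (val x) p q = 0.
  by move=> xb p q; rewrite /loop_matrix (inj_eq val_inj) (negbTE xb) val_bb_al.
have [||||t1 t2 t3] := @loop_case k La n g L L' (entry loop_vertex j pi' S) (dentry j pi' S (tld b)).
- by move=> p q; apply: entry0 fr fr' _ _ _.
- by move=> p q; apply: dentry0 fr fr' _ _ _ _.
(* Since dif b = 0, the entries commute with b exactly. *)
- move=> p q x; rewrite -Gb (entry_hom shape fr fr' p x hS (erefl : loop_vertex q = ssrc (val b))).
  by rewrite dif_b linear0.
- move=> p q x; rewrite -Ga -Gb.
  rewrite (entry_hom_al shape fr fr' al_loop tld_dual dif_al Go p x hS (erefl : loop_vertex q = i)).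
  by rewrite b_loop eqxx.
by split=> // [p q x _|y x /codomP[r ->]]; [apply: t1 | apply: t3].
Qed.
End LoopCase.

Section ArrowCase.
Hypothesis b_arrow : stgt (val b) <> ssrc (val b).
Local Notation s := (ssrc (val b)).
Local Notation t := (stgt (val b)).

Definition arrow_vertex (p : block_index 11 n) : I := if side12 p then t else s.
Definition arrow_matrix (a : solid D) : block_index 11 n -> block_index 11 n -> La :=
  if a == val b then block_matrix g arrow12 (fun=> false)
  else if a == al t then block_matrix g target12 (fun=> false)
  else if a == al s then block_matrix g source12 (fun c => c == 5)
  else fun _ _ => 0.

Lemma arrow12_side (p q : block_index 11 n) : ~~ side12 p || side12 q ->
  block_matrix g arrow12 (fun=> false) p q = 0.
Proof.
case: p q => [[c' r']|[]] [[c r]|[]] //=; rewrite /arrow12.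
case: eqP => //= ->; case: ifP => // c4; rewrite addnC ltnS leq_addr /=.
by case: ltngtP (ltn_trans c4 (isT : 4 < 5)%N).
Qed.

Lemma target12_side (p q : block_index 11 n) : ~~ side12 p || ~~ side12 q ->
  block_matrix g target12 (fun=> false) p q = 0.
Proof.
case: p q => [[c' r']|[]] [[c r]|[]] //=; rewrite /target12 !inE.
by case: eqP => [[-> ->]|_] //; case: eqP => [[-> ->]|_].
Qed.

Lemma source12_side (p q : block_index 11 n) : side12 p || side12 q ->
  block_matrix g source12 (fun c => c == 5) p q = 0.
Proof.
case: p q => [[c' r']|[]] [[c r]|[]] //=; rewrite /source12.
  rewrite !inE; do 5!case: eqP => [[-> ->]|_] //=.
  by case: eqP => //= ->; case: eqP => // ->.
by case: eqP => // ->.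
Qed.

Lemma arrow_vertex_t p : (arrow_vertex p == t) = side12 p.
Proof. by rewrite /arrow_vertex; case: side12; rewrite ?eqxx //; apply/eqP => /esym. Qed.

Lemma arrow_vertex_s p : (arrow_vertex p == s) = ~~ side12 p.
Proof. by rewrite /arrow_vertex; case: side12; rewrite ?eqxx //; apply/eqP. Qed.

Lemma arrow_unitriangular :
  unitriangular (codom g) arrow_vertex arrow_matrix (@rank12 n) (wblk 11 n).
Proof.
move=> L L' N N' j pi j' pi' fr fr' S hS.
have ts : (al t == al s) = false by rewrite (inj_eq (al_inj al_loop)); apply/eqP.
have shape a p q : (arrow_vertex p != stgt a) || (arrow_vertex q != ssrc a) ->
    arrow_matrix a p q = 0.
  rewrite /arrow_matrix; have [->|_] := eqVneq a (val b).
    by rewrite arrow_vertex_t arrow_vertex_s negbK; apply: arrow12_side.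
  have [->|_] := eqVneq a (al t).
    by rewrite (al_loop t).1 (al_loop t).2 !arrow_vertex_t; apply: target12_side.
  have [->|//] := eqVneq a (al s).
  by rewrite (al_loop s).1 (al_loop s).2 !arrow_vertex_s !negbK; apply: source12_side.
have Gb : arrow_matrix (val b) = block_matrix g arrow12 (fun=> false).
  by rewrite /arrow_matrix eqxx.
have Gt : arrow_matrix (al t) = block_matrix g target12 (fun=> false).
  by rewrite /arrow_matrix eq_sym val_bb_al eqxx.
have Gs : arrow_matrix (al s) = block_matrix g source12 (fun c => c == 5).
  by rewrite /arrow_matrix eq_sym val_bb_al eq_sym ts eqxx.
have Go (x : bb) : x != b -> forall p q, arrow_matrix (val x) p q = 0.
  by move=> xb p q; rewrite /arrow_matrix (inj_eq val_inj) (negbTE xb) !val_bb_al.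
have st : (s == t) = false by rewrite eq_sym; apply/eqP.
have [|||||t1 t2 t3] := @arrow_case k La n g L L' (entry arrow_vertex j pi' S) (dentry j pi' S (tld b)).
- by move=> p q; apply: entry0 fr fr' _ _ _.
- by move=> p q; apply: dentry0 fr fr' _ _ _ _.
- move=> p q x; rewrite -arrow_vertex_s => /eqP qs.
  by rewrite -Gb (entry_hom shape fr fr' p x hS qs) dif_b linear0.
- move=> p q x; rewrite -arrow_vertex_t => /eqP qt; rewrite -Gt -Gb.
  rewrite (entry_hom_al shape fr fr' al_loop tld_dual dif_al Go p x hS qt).
  by rewrite eqxx st subr0.
- move=> p q x; rewrite -arrow_vertex_s => /eqP qs; rewrite -Gs -Gb.
  rewrite (entry_hom_al shape fr fr' al_loop tld_dual dif_al Go p x hS qs).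
  by rewrite eqxx eq_sym st sub0r.
split=> // [p q x pq|y x /codomP[r ->]]; last exact: t3.
by apply: t1; rewrite -!arrow_vertex_t pq.
Qed.
End ArrowCase.
End Wildness.

Lemma wild_of_closed (k : closedFieldType) (I : finType) (D : diff_biquiver k I)
    (al : I -> solid D) (tld : {x : solid D | x \notin codom al} -> dotted D) :
  (forall i, ssrc (al i) = i /\ stgt (al i) = i) ->
  (forall x, dsrc (tld x) = stgt (val x) /\ dtgt (tld x) = ssrc (val x)) ->
  (forall i, dif D (kword k i i [:: inl (al i)]) =
     \sum_(x | stgt (val x) == i) kword k i i [:: inl (val x); inr (tld x)]
     - \sum_(x | dtgt (tld x) == i) kword k i i [:: inr (tld x); inl (val x)]) ->
  (exists b : {x : solid D | x \notin codom al}, dsolid (val b) = 0) -> wild D.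
Proof.
move=> al_loop tld_dual dif_al [b dif_b] La [gs gsP].
(* The n generators are followed by the default value 0 at index n, so the index type is nonempty
   even without generators. *)
pose n := size gs; pose g (r : 'I_n.+1) : La := nth 0 gs r.
have gP (P : La -> Prop) : (forall x, x \in codom g -> P x) -> P 1 ->
    (forall c x y, P x -> P y -> P (c *: x + y)) ->
    (forall x y, P x -> P y -> P (x * y)) -> forall x, P x.
  move=> Pg; apply: gsP => x xg; apply: Pg; apply/codomP.
  exists (inord (index x gs)); rewrite /g inordK ?nth_index //.
  by rewrite ltnS index_size.
suff [Q0 [nu [G [rk [w0 uni]]]]] : exists (Q0 : finType) (nu : Q0 -> I)
    (G : solid D -> Q0 -> Q0 -> La) (rk : Q0 -> nat) (w0 : Q0),
    unitriangular (codom g) nu G rk w0.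
  exists (free_functor nu G); split=> [L N _|L L' N N' _ _].
    exact: (induced_indecomposable gP uni).
  exact: (induced_iso gP uni).
have [bl|/eqP bn] := eqVneq (stgt (val b)) (ssrc (val b)).
  exists (block_index 2 n), (loop_vertex b (n := n)), (loop_matrix b g), (@rank3 n), (wblk 2 n).
  exact: (loop_unitriangular al_loop tld_dual dif_al dif_b).
exists (block_index 11 n), (arrow_vertex b (n := n)), (arrow_matrix b g), (@rank12 n), (wblk 11 n).
exact: (arrow_unitriangular al_loop tld_dual dif_al dif_b).
Qed.

Lemma wild_BT (k : closedFieldType) (I : finType) (D : diff_biquiver k I) : BT_box D ->
  solid_connected D -> no_superfluous_arrows D -> ~ coincides_with_kt D -> wild D.
Proof.
move=> [tri [al [tld [al_loop tld_inj tld_dual dif_al]]]] con noS nkt.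
apply: (wild_of_closed al_loop tld_dual dif_al).
exact: (closed_nondistinguished al_loop tld_inj tld_dual dif_al tri con noS nkt).
Qed.

Theorem theorem4p2 (k : closedFieldType) (I : finType) (D : diff_biquiver k I)
    (hBT : BT_box D) :
  (brick_tame D /\
   forall d : I -> nat,
     (exists M : rep k D, brick M /\ dimvec M =1 d) ->
     exists F : proj_functor D (rational_kt k),
       brick_family F /\
       forall M : rep k D, brick M -> dimvec M =1 d -> belongs_to F M) /\
  (solid_connected D -> no_superfluous_arrows D -> ~ coincides_with_kt D ->
   wild D).
Proof.
split; last exact: wild_BT.
by split=> [|d]; [exact: brick_tame_BT | exact: brick_family_kt].
Qed.
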